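(* There is an algorithm that, given two matroids $\mathbf M_1=(S,\mathcal I_1)$ and $\mathbf M_2=(S,\mathcal I_2)$ on the same finite ground set $S$ with $|S|=n$, each given by an independence oracle, and an integer $\tau$, enumerates (outputs exactly once each) all inclusion-wise maximal common independent sets $I$ of $\mathbf M_1$ and $\mathbf M_2$ with $|I|\ge\tau$, with delay $O(n^6Q)$ and space $O(n^2+\hat Q)$.
   Context: A common independent set of $\mathbf M_1,\mathbf M_2$ is a set $I\subseteq S$ with $I\in\mathcal I_1\cap\mathcal I_2$. An independence oracle for a matroid $\mathbf M=(S,\mathcal I)$ answers, for any $X\subseteq S$, whether $X\in\mathcal I$; each oracle call takes $Q$ time and $\hat Q$ space. The delay of an enumeration algorithm is the maximum time elapsed between two consecutive outputs, including preprocessing before the first output and post-processing after the last one. *)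

(* Defs.v *)
From HB Require Import structures.
From mathcomp Require Import all_boot all_order all_algebra.

Set Implicit Arguments.
Unset Strict Implicit.
Unset Printing Implicit Defensive.

Record matroid (T : finType) := Matroid {
  indep : pred {set T};
  indep_set0 : indep set0;
  indep_sub : forall I J : {set T}, I \subset J -> indep J -> indep I;
  indep_aug : forall I J : {set T}, indep I -> indep J -> #|I| < #|J| ->
    exists2 e, e \in J :\: I & indep (e |: I) }.

Definition common_indep (T : finType) (M1 M2 : matroid T) : pred {set T} :=
  fun I => indep M1 I && indep M2 I.

(* The model of computation is a word RAM with two oracles and an output tape.
   The memory is a sequence of natural numbers, one per word; program variables
   are memory cells with a constant address.  Programs do not mention the
   ground set, the matroids or the oracle costs: oracle queries are the only
   access to the matroids. *)

Inductive binop := Add | Sub | Mul | Eqb | Ltb.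

Inductive expr :=
  | Const of nat
  | Read of expr
  | Bin of binop & expr & expr.

Inductive cmd :=
  | Store of expr & expr            (* address, value *)
  | If of expr & seq cmd & seq cmd
  | While of expr & seq cmd
  | Query of bool & expr & expr     (* oracle, address of set, address of answer *)
  | Output of expr.                 (* address of set *)

Definition program := seq cmd.
Definition memory := seq nat.

(* [Sub] is truncated subtraction. *)
Definition eval_op (o : binop) (x y : nat) : nat :=
  match o with
  | Add => x + y
  | Sub => x - y
  | Mul => x * y
  | Eqb => x == y
  | Ltb => x < y
  end.

Fixpoint eval (m : memory) (e : expr) : nat :=
  match e with
  | Const k => k
  | Read a => nth 0 m (eval m a)
  | Bin o e1 e2 => eval_op o (eval m e1) (eval m e2)
  end.

Fixpoint expr_time (e : expr) : nat :=
  match e with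
  | Const _ => 1
  | Read a => (expr_time a).+1
  | Bin _ e1 e2 => (expr_time e1 + expr_time e2).+1
  end.

(* What an observer records at one machine step: the time it takes, the space
   in use while it is performed, and the set it outputs, if any. *)
Record event (T : finType) := Event {
  ev_time : nat;
  ev_space : nat;
  ev_out : option {set T} }.

Section Machine.
Variables (T : finType) (orc : bool -> pred {set T}).
(* [Q] and [Qs] are the time and the space of an oracle call; [W] is the
   largest value that fits in a memory word. *)
Variables (Q Qs W : nat).

(* The elements of T are numbered from 0 by [enum_rank]; a subset is stored as
   its characteristic vector in #|T| consecutive words. *)
Definition set_at (m : memory) (a : nat) : {set T} :=
  [set x : T | nth 0 m (a + enum_rank x) != 0].

(* A configuration is the list of the commands still to be executed and the
   memory.  That list plays the role of a program counter: there are no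
   procedure calls, so its length is bounded by a constant depending only on
   the program, and it is not charged for.  The memory grows (padded with
   zeros) up to the largest address written and never shrinks, so its size is
   the space used so far.  A write that overflows a word leaves the machine
   stuck.  Writing out a set costs one unit per element of T. *)
Definition config := (seq cmd * memory)%type.

Definition step (cf : config) : option (event T * config) :=
  let: (k, m) := cf in
  match k with
  | [::] => None
  | Store a e :: k' =>
      let m' := set_nth 0 m (eval m a) (eval m e) in
      if eval m e <= W then
        Some (Event (1 + expr_time a + expr_time e) (size m') None, (k', m'))
      else None
  | If e p q :: k' =>
      Some (Event (1 + expr_time e) (size m) None,
            ((if eval m e != 0 then p else q) ++ k', m))
  | While e p :: k' =>
      Some (Event (1 + expr_time e) (size m) None,
            (if eval m e != 0 then p ++ k else k', m))
  | Query b a r :: k' =>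
      let m' := set_nth 0 m (eval m r) (orc b (set_at m (eval m a))) in
      Some (Event (1 + expr_time a + expr_time r + Q) (size m' + Qs) None,
            (k', m'))
  | Output a :: k' =>
      Some (Event (1 + expr_time a + #|T|) (size m)
              (Some (set_at m (eval m a))), (k', m))
  end.

(* [run cf tr]: started in cf, the machine halts normally (no command left),
   with trace tr. *)
Inductive run : config -> seq (event T) -> Prop :=
  | RunHalt m : run ([::], m) [::]
  | RunStep cf ev cf' tr : step cf = Some (ev, cf') -> run cf' tr ->
      run cf (ev :: tr).

End Machine.

Section Trace.
Variable T : finType.
Implicit Type tr : seq (event T).

Definition outputs tr : seq {set T} := pmap (@ev_out T) tr.

(* [t] is the time elapsed since the last output, or since the start. *)
Fixpoint delay_from (t : nat) tr : nat :=
  match tr with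
  | [::] => t
  | ev :: tr' =>
      if ev_out ev is Some _
      then maxn (t + ev_time ev) (delay_from 0 tr')
      else delay_from (t + ev_time ev) tr'
  end.

Definition delay tr : nat := delay_from 0 tr.

Definition peak_space tr : nat := \max_(ev <- tr) ev_space ev.

End Trace.

(* The integer tau is given by its absolute value and its sign. *)
Definition input (n : nat) (tau : int) : memory :=
  [:: n; absz tau; nat_of_bool (tau < 0)%R].

(* Words have O(log n) bits, except that a word can always hold tau. *)
Definition word_max (c n : nat) (tau : int) : nat :=
  maxn (absz tau) (c * n.+1 ^ c).

Definition oracles (T : finType) (M1 M2 : matroid T) : bool -> pred {set T} :=
  fun b => if b then indep M2 else indep M1.

(* Main.v *)
(* Call a set a solution if it is a maximal common independent set of size at
   least tau.  If a common independent set I is not maximum, the first exchange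
   I + v1 - v2 of a shortest augmenting path gives a common independent set of
   the same size whose shortest augmenting path is shorter.  Completing it
   greedily to a maximal set defines the parent of I.  Sizes never decrease
   from a solution to its parent, and the progress #|I| * (n + 1) + (n - d),
   with d the length of a shortest augmenting path, strictly increases; so the
   solutions form a forest whose roots are the maximum common independent sets.

   Every child of P has the form P + e - f1 - f2, so the children of P are found
   by testing O(n^3) candidates, and the roots are listed in lexicographic order
   with matroid intersection under the constraint that the intersection with a
   set F of frozen elements is prescribed.  Since parents are computable, the
   forest can be traversed depth first without a stack.  Outputs at nodes of
   even depth are made on entering and at nodes of odd depth on leaving, so that
   only boundedly many moves, each of cost O(n^6 Q), separate two outputs. *)

Require Import Defs.
From HB Require Import structures.
From mathcomp Require Import all_boot all_order all_algebra zify.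

Set Implicit Arguments.
Unset Strict Implicit.
Unset Printing Implicit Defensive.

(** * Shortest augmenting paths *)

(** Only the first exchange of a path is made so that parent and child stay close, yet the
    completion that follows might seem to add many elements. Maximality of the child prevents this:
    in each matroid separately, every element of the parent, with one exception, lies in the child
    or can be added to it; an element missing from the child that is neither of the two exceptions
    could be added in both.

    A maximum set must have no parent, although exchanges keep the size. Each exchange leaves an
    augmenting path, so exchanges from a maximum set would run, with growing progress, into a larger
    common independent set.

    The exponent: one step computes distances in [n] rounds over [n^2] possible arcs; the search for
    children repeats this for [n^3] triples, and the search for the next root makes [(n + 1)^2]
    steps for each of [n] elements.

    Since a list of machine commands is required, the program is compiled from a language of bounded
    loops, where termination is built in, the exponent is the nesting depth, and overflow and space
    are settled once for all programs. *)

Section Best.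
Variable T : finType.
Implicit Types (P : pred T) (w : T -> nat).

Definition better P w (o : option T) (u : T) : option T :=
  if P u && (if o is Some v then w u < w v else true) then Some u else o.

(** Ties go to the element that comes first in [enum T]. The left fold is the scan that a program
    loop performs, so both choose the same element. *)
Definition best P w : option T := foldl (better P w) None (enum T).

Variant best_spec P w : option T -> Prop :=
  | BestNone of (forall u, ~~ P u) : best_spec P w None
  | BestSome v of P v & (forall u, P u -> w v <= w u) : best_spec P w (Some v).

Lemma bestP P w : best_spec P w (best P w).
Proof.
suff: match best P w with
      | None => {in enum T, forall u, ~~ P u}
      | Some v => P v /\ {in enum T, forall u, P u -> w v <= w u} end.
  case: best => [v [Pv minv]|noP].
    by apply: BestSome => // u; apply: minv; rewrite mem_enum.
  by apply: BestNone => u; apply: noP; rewrite mem_enum.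
rewrite /best; elim/last_ind: (enum T) => [//|s u].
rewrite -cats1 foldl_cat /=; set o := foldl _ _ s; rewrite /better.
case: o => [v [Pv minv]|noP] /=.
  case: ifP => [/andP[Pu lt_uv] | ].
    split=> // x; rewrite mem_cat inE => /orP[/minv minx Px|/eqP-> //].
    exact: leq_trans (ltnW lt_uv) (minx Px).
  move=> h; split=> // x; rewrite mem_cat inE => /orP[/minv|/eqP-> Pu] //.
  by move: h; rewrite Pu /= ltnNge => /negbFE.
case: ifP => [/andP[Pu _]|h].
  split=> // x; rewrite mem_cat inE => /orP[/noP/negPf->|/eqP->] //.
move=> x; rewrite mem_cat inE => /orP[/noP|/eqP->] //.
by rewrite andbT in h; rewrite h.
Qed.

End Best.

(** * The exchange graph and the distances to its sinks *)

Section Exchange.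
Variables (T : finType) (M1 M2 : matroid T).
Implicit Types (I J F U X Y : {set T}) (u v x y : T) (d : T -> nat).

Definition src F I u := [&& u \notin I, u \notin F & indep M1 (u |: I)].
Definition snk F I u := [&& u \notin I, u \notin F & indep M2 (u |: I)].
Definition arc F I u v := [&& u \notin F, v \notin F &
  if v \in I then (u \notin I) && indep M2 ((u |: I) :\ v)
  else (u \in I) && indep M1 ((v |: I) :\ u)].

(** Breadth-first search backwards from the sinks. Values are shifted by one: 0 means that no sink
    has been reached, 1 marks a sink, and [j.+1] a shortest path of [j] arcs. Round [k] only writes
    the value [k.+1], over zeros. *)
Fixpoint dist F I k : T -> nat :=
  if k is k'.+1 then fun u =>
    let d := dist F I k' in
    if d u != 0 then d u
    else if [exists v, (d v == k'.+1) && arc F I u v] then k'.+2 else 0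
  else fun u => snk F I u.

(** The exchange arguments use distances through these properties only, and apply them to the sets
    before and after an exchange alike. *)
Record is_dist F I d : Prop := IsDist {
  dist_snk : forall u, (d u == 1) = snk F I u;
  dist_next : forall u k, d u = k.+2 -> exists2 v, arc F I u v & d v = k.+1;
  dist_arc : forall u v, arc F I u v -> 0 < d v -> 0 < d u <= (d v).+1;
  dist_max : forall u, d u <= #|T| }.

Section Dist.
Variables F I : {set T}.
Local Notation dist := (dist F I).

Lemma dist_le k u : dist k u <= k.+1.
Proof.
elim: k u => [|k IH] u /=; first by case: snk.
by case: ifP => [_|_]; [exact: leqW | case: ifP].
Qed.

Lemma dist_stable k u : dist k u != 0 -> dist k.+1 u = dist k u.
Proof. by move=> /= ->. Qed.

Lemma dist_stable_le j k u : j <= k -> dist j u != 0 -> dist k u = dist j u.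
Proof.
elim: k => [|k IH]; first by rewrite leqn0 => /eqP->.
rewrite leq_eqVlt => /orP[/eqP->//|]; rewrite ltnS => lejk nz.
by rewrite dist_stable IH.
Qed.

Lemma dist_when k u j : dist k u = j.+1 -> j <= k /\ dist j u = j.+1.
Proof.
elim: k u => [|k IH] u.
  by move=> e; have := dist_le 0 u; rewrite e ltnS leqn0 => /eqP j0; rewrite -e j0.
rewrite [LHS]/=; case: ifP => [nz /IH [le1 e]|/negbFE/eqP z]; first by split=> //; exact: leqW.
case: ifP => // ex [<-]; split=> //; by rewrite /= z eqxx /= ex.
Qed.

Lemma dist_pred k u j : dist k u = j.+2 ->
  exists2 v, arc F I u v & dist k v = j.+1.
Proof.
move=> /dist_when[lejk]; rewrite [LHS]/=; case: ifP => [nz e|_].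
  by move: (dist_le j u); rewrite e ltnn.
case: ifP => // /existsP[v /andP[/eqP dv uv]] _; exists v => //.
by rewrite -dv; apply: dist_stable_le; [exact: ltnW | rewrite dv].
Qed.

(** Every smaller positive value occurs further along a path to a sink, so a value cannot exceed the
    number of elements. This is why [#|T|] rounds suffice. *)
Lemma dist_layers k u j : dist k u = j.+1 ->
  j < #|[set x | 0 < dist k x <= j.+1]|.
Proof.
elim: j u => [|j IH] u du.
  by apply/card_gt0P; exists u; rewrite inE du.
have [v _ /IH lt_j] := dist_pred du.
apply: leq_ltn_trans lt_j _; apply: proper_card; apply/properP; split.
  by apply/subsetP => x; rewrite !inE => /andP[-> /leqW].
by exists u; rewrite !inE du //= ltnn.
Qed.

Lemma dist_is_dist : is_dist F I (dist #|T|).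
Proof.
have maxd u : dist #|T| u <= #|T|.
  case e: (dist #|T| u) => [//|j]; apply: leq_trans (dist_layers e) _.
  exact: max_card.
split=> //.
- move=> u; apply/eqP/idP => [/dist_when[_] /=|h]; first by case: snk.
  by rewrite (@dist_stable_le 0) //= h.
- by move=> u k; apply: dist_pred.
move=> u v uv; case dv: (dist #|T| v) => [//|j] _.
have [_ djv] := dist_when dv.
have ltj: j < #|T| by rewrite -dv maxd.
have h: 0 < dist j.+1 u <= j.+2.
  rewrite dist_le andbT /=; case: ifP => [|_]; first by rewrite lt0n.
  by case: ifP => // /existsP[]; exists v; rewrite djv eqxx.
by rewrite (dist_stable_le ltj) // -lt0n; case/andP: h.
Qed.
End Dist.


(** * Extension and exchange in a single matroid *)

Section Matroid.
Variable M : matroid T.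

Lemma indep_extend X Y : indep M X -> indep M Y -> #|X| <= #|Y| ->
  exists K : {set T}, [/\ X \subset K, K \subset X :|: Y, indep M K & #|K| = #|Y|].
Proof.
move=> iX iY; move: {2}(#|Y| - #|X|) (erefl (#|Y| - #|X|)) => k.
elim: k X iX => [|k IH] X iX e le.
  by exists X; rewrite subxx subsetUl iX; split=> //; lia.
have [|x] := indep_aug iX iY; first lia.
rewrite inE => /andP[xX xY] ixX.
have cx: #|x |: X| = #|X|.+1 by rewrite cardsU1 xX.
have [||K [s1 s2 iK cK]] := IH _ ixX; try lia.
exists K; split=> //; first by apply: subset_trans s1; apply: subsetUr.
by apply: subset_trans s2 _; rewrite -setUA subUset subxx sub1set inE xY orbT.
Qed.

(** The circuit of [e |: I] cannot lie inside the independent set [e |: X], so one of its elements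
    outside [X] can leave. Circuits are avoided: extending [e |: X] by elements of [I] to the size
    of [I] omits exactly one element of [e |: I], and that is [w]. *)
Lemma indep_exchange X I e : X \subset I -> indep M I -> e \notin I ->
  indep M (e |: X) -> ~~ indep M (e |: I) ->
  exists2 w, w \in I :\: X & indep M ((e |: I) :\ w).
Proof.
move=> sXI iI eI ieX nieI.
have lt: #|X| < #|I|.
  rewrite ltnNge; apply: contra nieI => le.
  by have /eqP <- : X == I by rewrite eqEcard sXI.
have eX: e \notin X by apply: contra eI; apply: (subsetP sXI).
have [|K [s1 s2 iK cK]] := indep_extend ieX iI; first by rewrite cardsU1 eX.
have sK: K \subset e |: I.
  by apply: subset_trans s2 _; rewrite subUset subsetUr andbT setUS.
have : 0 < #|(e |: I) :\: K|.
  by rewrite cardsD (setIidPr sK) cK cardsU1 eI add1n subSn // subnn.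
case/card_gt0P => w; rewrite !inE => /andP[wK]; rewrite -in_setU1 => weI.
exists w; last first.
  apply: indep_sub iK; apply/subsetP.
  suff <-: K = (e |: I) :\ w by [].
  apply/eqP; rewrite eqEcard subsetD1 sK wK /=.
  by move: (cardsD1 w (e |: I)); rewrite weI cardsU1 eI cK => /addnI->.
have wX: w \notin e |: X by apply: contra wK; apply: (subsetP s1).
by move: wX weI; rewrite !inE negb_or => /andP[/negPf-> ->].
Qed.

End Matroid.

(** * Optimality without augmenting paths, and the effect of the first exchange *)

Section Swap.
Variables F I : {set T}.
Variable d : T -> nat.
Hypothesis dP : is_dist F I d.
Hypothesis I1 : indep M1 I.
Hypothesis I2 : indep M2 I.

Lemma dist_unfrozen u : 0 < d u -> u \notin F.
Proof.
case e: (d u) => [//|[|k]] _; last by have [v /and3P[]] := dist_next dP e.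
by move/eqP: e; rewrite (dist_snk dP) => /and3P[].
Qed.

(* The set of elements that reach a sink attains the minimum in the matroid
   intersection min-max formula. *)
Lemma no_path_max J : (forall u, src F I u -> d u = 0) ->
  indep M1 J -> indep M2 J -> J :&: F = I :&: F -> #|J| <= #|I|.
Proof.
move=> nosrc J1 J2 JF; pose U := [set u | 0 < d u].
have notF e : e \in J -> e \notin I -> e \notin F.
  move=> eJ; apply: contra => eF.
  by move/setP/(_ e): JF; rewrite !inE eJ eF !andbT => <-.
(* Otherwise some unreached [e] of [J] enlarges [I :\: U] in [M2]. It is then a sink, or can be
   exchanged for some [w] in [U], which is an arc from [e] into [U]; both contradict that [e] is
   unreached. *)
have h2 : #|J :\: U| <= #|I :\: U|.
  rewrite leqNgt; apply/negP => lt.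
  have IU2 : indep M2 (I :\: U) by apply: indep_sub I2; apply: subsetDl.
  have JU2 : indep M2 (J :\: U) by apply: indep_sub J2; apply: subsetDl.
  have [e] := indep_aug IU2 JU2 lt.
  rewrite inE [e \in J :\: U]inE => /and3P[eIU eU eJ] indE.
  have eI: e \notin I by move: eIU; rewrite inE eU.
  have eF := notF e eJ eI.
  have de: d e = 0 by move: eU; rewrite inE lt0n negbK => /eqP.
  have nX: ~~ indep M2 (e |: I).
    apply/negP => ind; have := dist_snk dP e.
    by rewrite de /snk eI eF ind.
  have [|w] := indep_exchange _ I2 eI indE nX; first exact: subsetDl.
  rewrite !inE negb_and negbK => /andP[/orP[dw|/negPf->]]; last by [].
  move=> wI ind; have /(dist_arc dP) : arc F I e w.
    by rewrite /arc eF dist_unfrozen // wI eI.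
  by rewrite de => /(_ dw).
have h1 : #|J :&: (U :|: F)| <= #|I :&: (U :|: F)|.
  rewrite leqNgt; apply/negP => lt.
  have IU1 : indep M1 (I :&: (U :|: F)) by apply: indep_sub I1; apply: subsetIl.
  have JU1 : indep M1 (J :&: (U :|: F)) by apply: indep_sub J1; apply: subsetIl.
  have [e] := indep_aug IU1 JU1 lt.
  rewrite inE [e \in J :&: _]inE => /and3P[eIU eJ eUF] indE.
  have eI: e \notin I by move: eIU; rewrite inE eUF andbT.
  have eF := notF e eJ eI.
  have de: 0 < d e by move: eUF; rewrite !inE (negPf eF) orbF.
  have nX: ~~ indep M1 (e |: I).
    by apply/negP => ind; move: de; rewrite nosrc // /src eI eF.
  have [|w] := indep_exchange _ I1 eI indE nX; first exact: subsetIl.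
  rewrite !inE => /andP[+ wI]; rewrite wI /= negb_or => /andP[dw wF] ind.
  have /(dist_arc dP)/(_ de) : arc F I w e by rewrite /arc eF wF (negPf eI) wI.
  by rewrite (negPf dw).
have UF0 : U :&: F = set0.
  by apply/setP => x; rewrite !inE; apply/negP => /andP[/dist_unfrozen/negP].
(* As [U] and [F] are disjoint, the two bounds together cover [K] once and [K :&: F] once more; the
   latter has the same size for [J] and [I]. *)
have split_card (K : {set T}) : #|K| + #|K :&: F| = #|K :\: U| + #|K :&: (U :|: F)|.
  have -> : K :&: (U :|: F) = (K :&: U) :|: (K :&: F) by rewrite setIUr.
  rewrite cardsU -{1}(cardsID U K).
  have -> : K :&: U :&: (K :&: F) = set0.
    by rewrite setIACA UF0 setI0.
  by rewrite cards0 subn0; lia.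
by move: (split_card J) (split_card I); rewrite JF; lia.
Qed.

Variable v1 : T.
Hypothesis v1src : src F I v1.
Hypothesis v1min : forall u, src F I u -> 0 < d u -> d v1 <= d u.
Variable v2 : T.
Hypothesis v12 : arc F I v1 v2.
Hypothesis dv12 : d v1 = (d v2).+1.
Hypothesis dv2 : 0 < d v2.

Let I' := (v1 |: I) :\ v2.

Let v1I : v1 \notin I. Proof. by case/and3P: v1src. Qed.
Let v1F : v1 \notin F. Proof. by case/and3P: v1src. Qed.
Let v2F : v2 \notin F. Proof. by case/and3P: v12. Qed.

Let v2I : v2 \in I.
Proof. by case/and3P: v12 => _ _; case: ifP => // _; rewrite (negPf v1I). Qed.

Lemma swap_indep1 : indep M1 I'.
Proof. by case/and3P: v1src => _ _; apply: indep_sub; apply: subsetDl. Qed.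

Lemma swap_indep2 : indep M2 I'.
Proof. by case/and3P: v12 => _ _; rewrite v2I v1I. Qed.

Lemma swap_card : #|I'| = #|I|.
Proof.
have := cardsD1 v2 (v1 |: I); rewrite cardsU1 v1I !inE v2I orbT.
by rewrite -/I' => /addnI.
Qed.

Lemma swap_frozen : I' :&: F = I :&: F.
Proof.
apply/setP => x; rewrite !inE; case: eqP => [->|_] /=; first by rewrite (negPf v2F) andbF.
by case: eqP => [->|//]; rewrite (negPf v1F) !andbF.
Qed.

Let in_I' x : (x \in I') = (x != v2) && ((x == v1) || (x \in I)).
Proof. by rewrite !inE. Qed.

(* As d v1 is minimal, no element closer than v1 is itself a source; this keeps
   the exchanges of such elements valid in M1 once v1 has been added. *)
Let keep1 x y : y \in I -> x \notin I -> x \notin F -> 0 < d x < d v1 ->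
  indep M1 ((x |: I) :\ y) -> indep M1 (v1 |: ((x |: I) :\ y)).
Proof.
move=> yI xI xF /andP[dx ltx] ind.
have iv1: indep M1 (v1 |: I) by case/and3P: v1src.
have c1: #|(x |: I) :\ y| = #|I|.
  have := cardsD1 y (x |: I); rewrite cardsU1 xI !inE yI orbT.
  by move=> /addnI.
have [|e] := indep_aug ind iv1; first by rewrite c1 cardsU1 v1I.
rewrite !inE negb_and negbK => /andP[/orP[/eqP->|]].
  move=> _ ixI; suff: d v1 <= d x by rewrite leqNgt ltx.
  apply: v1min => //; rewrite /src xI xF /=.
  by rewrite setD1K // !inE yI orbT in ixI.
by rewrite negb_or => /andP[_ /negPf->]; rewrite orbF => /eqP->.
Qed.

Variable d' : T -> nat.
Hypothesis d'P : is_dist F I' d'.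

(** The arcs and the sink on a shortest path from [x] survive the exchange. For arcs of [M1] this is
    [keep1]. In [M2], augmenting [I'] from [x |: I], or [I' :\ y] from [(x |: I) :\ y], adds either
    [x], which gives the sink or arc wanted, or [v2]. The latter would make [v1] a sink or give it
    an arc to [y], so that [d v1 <= d x], although [d x < d v2 < d v1]. *)
Lemma swap_dist x : 0 < d x -> d x < d v2 -> 0 < d' x <= d x.
Proof.
move: {2}(d x) (erefl (d x)) => k; elim: k x => [|k IH] x; first by move=> ->.
case: k IH => [|k] IH dx _ ltx.
  have: snk F I x by rewrite -(dist_snk dP) dx.
  case/and3P=> xI xF ixI.
  have xv2 : x != v2 by apply: contraNneq xI => ->.
  have xv1 : x != v1 by apply: contraTneq ltx => ->; rewrite dv12 -leqNgt.
  suff: snk F I' x by rewrite -(dist_snk d'P) dx => /eqP->.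
  rewrite /snk in_I' xv2 (negPf xv1) (negPf xI) xF /=.
  have [|e] := indep_aug swap_indep2 ixI; first by rewrite swap_card cardsU1 xI.
  rewrite in_setD in_I' negb_and negbK negb_or in_setU1.
  case/andP=> /orP[/eqP->|/andP[_ /negPf->]]; last by rewrite orbF => /eqP->.
  rewrite setD1K; last by rewrite !inE v2I orbT.
  move=> _ ind; have: d v1 == 1 by rewrite (dist_snk dP) /snk v1I v1F.
  by rewrite dv12 eqSS -leqn0 leqNgt dv2.
have [y xy dy] := dist_next dP dx.
have xv1 : x != v1 by apply: contraTneq ltx => ->; rewrite dv12 -leqNgt.
have xv2 : x != v2 by apply: contraTneq ltx => ->; rewrite ltnn.
have lty : d y < d v2 by apply: leq_trans ltx; rewrite dx dy.
have yv1 : y != v1 by apply: contraTneq lty => ->; rewrite dv12 -leqNgt.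
have yv2 : y != v2 by apply: contraTneq lty => ->; rewrite ltnn.
have /andP[d'y le'y]: 0 < d' y <= d y by apply: IH; rewrite // dy.
suff xy' : arc F I' x y.
  case/andP: (dist_arc d'P xy' d'y) => -> le; by rewrite (leq_trans le) // dx -dy ltnS.
case/and3P: xy => xF yF; rewrite /arc xF yF /= !in_I' xv2 yv2 (negPf xv1) (negPf yv1) /=.
case: ifP => [yI /andP[xI ind]|/negbT yI /andP[xI ind]].
  rewrite xI /=.
  have c1: #|(x |: I) :\ y| = #|I|.
    by have := cardsD1 y (x |: I); rewrite cardsU1 xI !inE yI orbT => /addnI.
  have iy: indep M2 (I' :\ y) by apply: indep_sub swap_indep2; apply: subsetDl.
  have cI'y : #|I'| = #|I' :\ y|.+1 by rewrite (cardsD1 y I') in_I' yv2 yI orbT.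
  have [|e] := indep_aug iy ind; first by rewrite c1 -swap_card cI'y.
  rewrite in_setD [e \in I' :\ y]in_setD1 in_I' in_setD1 in_setU1.
  have [-> | ev2] := eqVneq e v2.
    move=> _ ind'; have /(dist_arc dP) : arc F I v1 y.
      rewrite /arc v1F yF yI v1I /=; apply: indep_sub ind'; apply/subsetP => z.
      by rewrite /I' !(in_setU1, in_setD1); case: (z == v2); case: (z == y); case: (z == v1).
    rewrite dy => /(_ isT)/andP[_]; rewrite leqNgt -dx dv12.
    by rewrite (ltn_trans ltx).
  case: eqVneq => //= ey; rewrite negb_or => /andP[/andP[_ /negPf->]].
  rewrite orbF => /eqP-> ind'; apply: indep_sub ind'; apply/subsetP => z.
  by rewrite /I' !(in_setU1, in_setD1); case: (z == x); case: (z == y); case: (z == v2).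
rewrite xI /=.
have ind' := @keep1 y x xI yI yF _ ind; apply: indep_sub (ind' _); last first.
  by apply/andP; split; [rewrite dy | rewrite dv12 ltnS ltnW].
apply/subsetP => z; rewrite !inE.
by case: eqVneq => //= zx; case: eqVneq => //= zy; case: eqVneq => //= zv1 /andP[].
Qed.

(** The new source is the successor [v3] of [v2] on the shortest path, two arcs closer than [v1].
    The arc from [v2] to [v3] says that [v3] can replace [v2] in [M1], and by [keep1] still can with
    [v1] present. A successor exists because [v2], being in [I], is no sink. *)
Lemma swap_closer : exists2 v3, src F I' v3 & 0 < d' v3 < d v1.
Proof.
case dv2': (d v2) dv2 => [//|[|k]] _.
  by move/eqP: dv2'; rewrite (dist_snk dP) /snk v2I.
have [v3 v23 dv3] := dist_next dP dv2'.
have v31: v3 != v1 by apply: contra_eqN dv3 => /eqP->; rewrite dv12 dv2' gtn_eqF.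
have v32: v3 != v2 by apply: contra_eqN dv3 => /eqP->; rewrite dv2' gtn_eqF.
have := @swap_dist v3; rewrite dv3 dv2' ltnSn => /(_ isT isT) /andP[dv3' le3].
exists v3; last by rewrite dv3' dv12 dv2' ltnS (leq_trans le3).
case/and3P: v23 => _ v3F; case: ifP => [v3I /andP[]|/negbT v3I]; first by rewrite v2I.
rewrite v2I /= => ind; rewrite /src in_I' v32 (negPf v31) (negPf v3I) v3F /=.
have ind' := @keep1 v3 v2 v2I v3I v3F _ ind; apply: indep_sub (ind' _); last by rewrite dv3 dv12 dv2' ltnS leqnSn.
apply/subsetP => z; rewrite !inE; case: eqVneq => [->|_] /=; first by rewrite v32 orbT.
by case: eqVneq.
Qed.

End Swap.
End Exchange.

(** * The lexicographic order on subsets *)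

Section Rank.
Variable T : finType.
Implicit Types (I J : {set T}) (x y : T) (s : seq T).

Definition rk x : nat := enum_rank x.

Lemma rk_lt x : rk x < #|T|. Proof. exact: ltn_ord. Qed.

Lemma rk_inj : injective rk.
Proof. by move=> x y /val_inj /enum_rank_inj. Qed.

Lemma rk_index x : rk x = index x (enum T).
Proof.
rewrite -{2}(nth_enum_rank x x) index_uniq ?enum_uniq //.
by rewrite -cardE; apply: rk_lt.
Qed.

Lemma rk_split s1 x s2 y : enum T = s1 ++ x :: s2 -> (y \in s1) = (rk y < rk x).
Proof.
move=> e; have := enum_uniq T; rewrite e cat_uniq /= negb_or.
case/and3P=> _ /andP[xs1 _] _; rewrite !rk_index e !index_cat (negPf xs1) /= eqxx addn0.
by case: ifP => [|_]; rewrite ?index_mem ?(ltnNge _ (size s1)) ?leq_addr.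
Qed.

Lemma rk_surj i : i < #|T| -> exists x, rk x = i.
Proof. by move=> lti; exists (enum_val (Ordinal lti)); rewrite /rk enum_valK. Qed.

(* Sets are compared as binary numbers whose leading digit tells whether the
   element of rank 0 is present. *)
Definition pcode I s := foldl (fun c x => c.*2 + (x \in I)) 0 s.
Definition code I := pcode I (enum T).

Lemma pcode_rcons I s x : pcode I (rcons s x) = (pcode I s).*2 + (x \in I).
Proof. by rewrite /pcode foldl_rcons. Qed.

Lemma pcode_inj I J s : pcode I s = pcode J s -> {in s, I =i J}.
Proof.
elim/last_ind: s => [//|s x IH]; rewrite !pcode_rcons => e.
have [ex es] : (x \in I) = (x \in J) /\ pcode I s = pcode J s.
  by move: e; case: (x \in I); case: (x \in J) => /=; split=> //; lia.
by move=> y; rewrite mem_rcons inE => /orP[/eqP->|/(IH es)].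
Qed.

Lemma code_inj : injective code.
Proof. by move=> I J e; apply/setP => x; apply: (pcode_inj e); rewrite mem_enum. Qed.

Lemma eq_pcode I J s : {in s, I =i J} -> pcode I s = pcode J s.
Proof.
elim/last_ind: s => [//|s x IH] h; rewrite !pcode_rcons h ?mem_rcons ?mem_head //.
by rewrite IH // => y ys; apply: h; rewrite mem_rcons inE ys orbT.
Qed.

Lemma pcode_lt_cat I J s1 s2 : pcode I s1 < pcode J s1 ->
  pcode I (s1 ++ s2) < pcode J (s1 ++ s2).
Proof.
move=> lt; elim/last_ind: s2 => [|s2 x IH]; first by rewrite cats0.
by rewrite -rcons_cat !pcode_rcons; case: (x \in I); case: (x \in J) => /=; lia.
Qed.

Lemma pcode_ltP I J s : pcode I s < pcode J s ->
  exists s1 x s2, [/\ s = s1 ++ x :: s2, {in s1, I =i J}, x \notin I & x \in J].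
Proof.
elim/last_ind: s => [//|s x IH]; rewrite !pcode_rcons.
case: (ltngtP (pcode I s) (pcode J s)) => [/IH[s1 [y [s2 [-> h1 h2 h3]]]] _|lt|/pcode_inj e].
- by exists s1, y, (rcons s2 x); rewrite rcons_cat.
- by case: (x \in I); case: (x \in J) => /=; lia.
rewrite (eq_pcode e) ltn_add2l => lt; exists s, x, [::]; rewrite cats1.
by case: (x \in I) lt; case: (x \in J).
Qed.

Lemma code_lt I J x : (forall y, rk y < rk x -> (y \in I) = (y \in J)) ->
  x \notin I -> x \in J -> code I < code J.
Proof.
move=> agree xI xJ; have: x \in enum T by rewrite mem_enum.
rewrite /code; move e: (enum T) => s xs; case/splitPr: xs e => s1 s2 e.
rewrite -cat_rcons; apply: pcode_lt_cat.
rewrite !pcode_rcons (negPf xI) xJ addn0 addn1 ltnS (@eq_pcode I J) // => y.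
by rewrite (rk_split _ e) => /agree.
Qed.

Lemma code_ltP I J : code I < code J -> exists x,
  [/\ x \notin I, x \in J & forall y, rk y < rk x -> (y \in I) = (y \in J)].
Proof.
case/pcode_ltP => s1 [x [s2 [e agree xI xJ]]]; exists x; split=> // y.
by rewrite -(rk_split _ e) => /agree.
Qed.

End Rank.

(** * Augmenting steps, greedy completion and parents *)

Section Step.
Variables (T : finType) (M1 M2 : matroid T).
Implicit Types (I J K P R A B F : {set T}) (u v x y : T).
Local Notation common := (common_indep M1 M2).
Local Notation dist := (dist M1 M2).
Local Notation arc := (arc M1 M2).
Local Notation src := (src M1).
Local Notation n := #|T|.

Definition start F I := let d := dist F I n in
  best (fun u => (d u != 0) && src F I u) d.

(** Any second vertex of a shortest path from [v] will do; the constant weight makes [best] return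
    the first one, which keeps parents deterministic. *)
Definition pivot F I v := let d := dist F I n in
  best (fun w => ((d w).+1 == d v) && arc F I v w) (fun=> 0).

(* The first exchange of a shortest augmenting path avoiding the frozen
   elements F. *)
Definition augstep F I : option {set T} :=
  if start F I is Some v then
    if dist F I n v == 1 then Some (v |: I)
    else if pivot F I v is Some w then Some ((v |: I) :\ w) else None
  else None.

Definition progress F I :=
  #|I| * n.+1 + (n - (if start F I is Some v then dist F I n v else 0)).

Lemma progress_lt F I : progress F I < n.+1 ^ 2.
Proof.
rewrite /progress; set k := (X in n - X).
have := max_card (mem I); rewrite -(leq_pmul2r (ltn0Sn n)) => le.
apply: leq_ltn_trans (leq_add le (leq_subr _ _)) _.
by rewrite expnS expn1 mulSn addnC ltn_add2r.
Qed.

Lemma progress_card F F' I I' : #|I| < #|I'| ->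
  (if start F I is Some v then dist F I n v else 0) > 0 ->
  progress F I < progress F' I'.
Proof.
move=> lt; rewrite /progress; set k := (X in n - X); set k' := (X in _ + (n - X)).
rewrite -(leq_pmul2r (ltn0Sn n)) in lt; move: lt; rewrite mulSn.
set a := _ * _; set b := _ * _; lia.
Qed.

(** For an exchange two facts are recorded beyond the growth of progress. Every larger common
    independent set has larger progress, whatever its distances: needed when [complete] adds
    elements afterwards. And an augmenting path remains, which excludes exchanges at maximum
    sets. *)
Variant augstep_spec F I : option {set T} -> Prop :=
  | AugNone of start F I = None & (forall J, common J -> J :&: F = I :&: F -> #|J| <= #|I|) :
      augstep_spec F I None
  | AugGrow v of v \notin I & common (v |: I)
      & (v |: I) :&: F = I :&: F & progress F I < progress F (v |: I) :
      augstep_spec F I (Some (v |: I))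
  | AugSwap v w of v \notin I & w \in I & common ((v |: I) :\ w)
      & #|(v |: I) :\ w| = #|I| & ((v |: I) :\ w) :&: F = I :&: F
      & (forall F' J, common J -> #|I| < #|J| -> progress F I < progress F' J)
      & progress F I < progress F ((v |: I) :\ w)
      & start F ((v |: I) :\ w) <> None :
      augstep_spec F I (Some ((v |: I) :\ w)).

Lemma augstepP F I : common I -> augstep_spec F I (augstep F I).
Proof.
case/andP=> I1 I2; rewrite /augstep; case e: (start F I) => [v|]; last first.
  move: (e); rewrite /start; case: bestP => // nosrc _; constructor => // J /andP[J1 J2].
  apply: (no_path_max (dist_is_dist M1 M2 F I)) => // u su; apply/eqP.
  by move: (nosrc u); rewrite su andbT negbK.
have eg F' J : #|I| < #|J| -> progress F I < progress F' J.
  move=> lt; apply: progress_card => //; rewrite e.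
  move: e; rewrite /start; case: bestP => // v' /andP[dv _] _ [<-].
  by rewrite lt0n.
move: (e); rewrite /start; case: bestP => // v' /andP[dv sv] minv [?]; subst v'.
have dP := dist_is_dist M1 M2 F I.
have [vI vF iv] := and3P sv.
case: eqP => [d1|d1].
  have c: common (v |: I).
    have: snk M2 F I v by rewrite -(dist_snk dP) d1.
    by case/and3P=> _ _ h; rewrite /common_indep iv.
  apply: AugGrow => //; last by apply: eg; rewrite cardsU1 vI.
  by apply/setP => x; rewrite !inE; case: eqP => [->|//]; rewrite (negPf vF) !andbF.
case dv': (dist F I n v) dv d1 => [//|[//|k]] _ _.
have [w vw dw] := dist_next dP dv'.
rewrite /pivot; case: bestP => [no|{vw dw}w /andP[/eqP dw vw] _].
  by have := no w; rewrite dw dv' eqxx vw.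
have minv' u : src F I u -> 0 < dist F I n u -> dist F I n v <= dist F I n u.
  by move=> su du; apply: minv; rewrite su -lt0n du.
have d2 : 0 < dist F I n w by rewrite -ltnS dw dv'.
have wI : w \in I.
  by case/and3P: vw => _ _; case: ifP => // _; rewrite (negPf vI).
have c := swap_card sv vw.
have dP' := dist_is_dist M1 M2 F ((v |: I) :\ w).
have [v3 sv3 dv3] := swap_closer dP sv minv' vw (esym dw) d2 dP'.
have [v4 e4 lt4] : exists2 v4, start F ((v |: I) :\ w) = Some v4 &
    dist F ((v |: I) :\ w) n v4 < dist F I n v.
  rewrite /start; case: bestP => [no|v4 _ min4].
    by case/andP: dv3 => dv3 _; have := no v3; rewrite /= sv3 -lt0n dv3.
  exists v4 => //; case/andP: dv3 => dv3; apply: leq_ltn_trans; apply: min4.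
  by rewrite /= sv3 -lt0n dv3.
apply: AugSwap => //.
- by rewrite /common_indep (swap_indep1 sv) (swap_indep2 sv vw).
- exact: (@swap_frozen T M1 M2 F I v sv w vw).
- by move=> F' J _; apply: eg.
- rewrite /progress c e e4 ltn_add2l; apply: ltn_sub2l => //.
  exact: leq_trans lt4 (dist_max dP v).
- by rewrite e4.
Qed.

Lemma augstep_common F I J : common I -> augstep F I = Some J ->
  [/\ common J, J :&: F = I :&: F, #|I| <= #|J| & progress F I < progress F J].
Proof.
move=> cI; case: augstepP => // [v vI c f pr [<-]|v w vI wI c e f _ pr _ [<-]]; split=> //.
  by rewrite cardsU1 vI leqnSn.
by rewrite e.
Qed.

(* progress is below n.+1 ^ 2 and grows at every step, so the iteration ends
   at a set without augmenting path. *)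
Definition maximize F I := iter (n.+1 ^ 2) (fun J => odflt J (augstep F J)) I.

Lemma maximizeP F I : common I ->
  [/\ common (maximize F I), maximize F I :&: F = I :&: F
    & forall J, common J -> J :&: F = I :&: F -> #|J| <= #|maximize F I|].
Proof.
move=> cI; rewrite /maximize.
set f := fun J => _.
(* Each iteration either has stalled for good or has raised the progress by at least one. *)
have inv k : [/\ common (iter k f I), iter k f I :&: F = I :&: F
   & augstep F (iter k f I) = None \/ k <= progress F (iter k f I)].
  elim: k => [|k [c e p]]; first by split=> //; right.
  have fE J : f J = odflt J (augstep F J) by [].
  rewrite iterS fE; case eJ: (augstep F (iter k f I)) p => [J|] p /=; last first.
    by split=> //; left.
  have [cJ fJ _ pr] := augstep_common c eJ; split=> //; first by rewrite fJ.
  by case: p => // p; right; apply: leq_ltn_trans pr.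
have [c e p] := inv (n.+1 ^ 2); split=> // J cJ; rewrite -e => eJ.
case: p => [p|]; last by rewrite leqNgt progress_lt.
by case: (augstepP F c) p => // _ h _; apply: h.
Qed.

Definition complete I :=
  foldl (fun J x => if common (x |: J) then x |: J else J) I (enum T).

Lemma commonS I J : I \subset J -> common J -> common I.
Proof. by move=> s /andP[h1 h2]; rewrite /common_indep !(indep_sub s). Qed.

Lemma completeP I : common I -> [/\ I \subset complete I, common (complete I)
  & forall x, x \notin complete I -> ~~ common (x |: complete I)].
Proof.
move=> cI; set g := fun J x => if common (x |: J) then x |: J else J.
suff: [/\ I \subset complete I, common (complete I) & {in enum T, forall x,
  x \notin complete I -> ~~ common (x |: complete I)}].
  by case=> h1 h2 h3; split=> // x; apply: h3; rewrite mem_enum.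
rewrite /complete; elim/last_ind: (enum T) => [|s x [s1 c m]] //=.
rewrite foldl_rcons; set J := foldl _ _ _ in s1 c m *.
case: ifP => cx; split=> //; first exact: subset_trans s1 (subsetUr _ _).
  move=> y; rewrite mem_rcons inE => /orP[/eqP->|ys]; first by rewrite setU11.
  rewrite in_setU1 negb_or => /andP[_ /(m y ys)]; apply: contra.
  by apply: commonS; rewrite setUS // subsetUr.
by move=> y; rewrite mem_rcons inE => /orP[/eqP->|/m] //; rewrite cx.
Qed.

Lemma maxcommonP I :
  reflect (common I /\ forall x, x \notin I -> ~~ common (x |: I))
          (maxset common I).
Proof.
apply: (iffP maxsetP) => -[cI m]; split=> //.
  by move=> x xI; apply: contra xI => /m <-; rewrite ?subsetUr // setU11.
move=> J cJ sIJ; apply/eqP; rewrite eqEsubset sIJ andbT.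
apply/subsetP => x xJ; apply: contraLR cJ => /m; apply: contra.
by apply: commonS; rewrite subUset sub1set xJ.
Qed.

Lemma complete_max I : common I -> maxset common (complete I).
Proof. by move=> /completeP[_ c m]; apply/maxcommonP. Qed.

Definition parent I := omap complete (augstep set0 I).

Lemma parentE I : parent I = omap complete (augstep set0 I).
Proof. by []. Qed.

Lemma parentP I P' : maxset common I -> parent I = Some P' ->
  [/\ maxset common P', #|I| <= #|P'|, progress set0 I < progress set0 P'
    & exists e f1 f2, I = ((e |: P') :\ f1) :\ f2].
Proof.
move=> mI; rewrite /parent; have [cI mx] := maxcommonP _ mI.
case: (augstepP set0 cI) => //= [v vI c _ _|v w vI wI c cc _ eg pr _].
  by have := mx v vI; rewrite c.
set I1 := _ :\ w in c cc pr *; have [sP cP mP] := completeP c.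
have mxP := complete_max c.
set P := complete I1 in sP cP mP mxP * => -[<-{P'}].
have le : #|I| <= #|P| by rewrite -cc; apply: subset_leq_card.
have prP : progress set0 I < progress set0 P.
  have := sP; rewrite subEproper => /predU1P[<- //|/proper_card lt].
  by apply: eg => //; rewrite -cc.
split=> //.
have wP : w \notin P.
  (* If [w] came back, [P] would contain all of [I], and maximality of [I] would give [P = I],
     contrary to the growth of progress. *)
  apply: contraTN prP => wP; suff ->: P = I by rewrite ltnn.
  have/maxsetP[_ mI'] := mI; apply: mI' => //; apply/subsetP => x xI.
  have [-> //|xw] := eqVneq x w; apply: (subsetP sP).
  by rewrite !inE xw xI orbT.
have IP : I \subset w |: P.
  apply/subsetP => x xI; rewrite in_setU1; have [//|xw] := eqVneq x w.
  by apply: (subsetP sP); rewrite !inE xw xI orbT.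
(* Extend [I] from [P] to an [M]-independent [K] of the size of [P]. It lives in [w |: P], which has
   one element more, so a single element [f] is left out; the rest of [P] is in [K] together with
   [I]. The default [w] in the choice of [f] is not reached. *)
have miss (M : matroid T) : indep M I -> indep M P ->
    exists f, forall x, x \in P -> x != f -> x \in I \/ indep M (x |: I).
  move=> iI iP; have [K [sIK sK iK cK]] := indep_extend iI iP le.
  have sK' : K \subset w |: P by apply: subset_trans sK _; rewrite subUset IP subsetUr.
  have : #|(w |: P) :\: K| <= 1.
    by rewrite cardsD (setIidPr sK') cK cardsU1 wP add1n subSnn.
  move=> /card_le1_eqP one; pose f := odflt w [pick x in (w |: P) :\: K].
  exists f => x xP xf.
  have xK : x \in K.
    apply: contraNT xf => xK.
    have xD : x \in (w |: P) :\: K by rewrite inE xK in_setU1 xP orbT.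
    rewrite /f; case: pickP => [y yD|/(_ x)]; last by rewrite xD.
    by apply/eqP; apply: one.
  by right; apply: indep_sub iK; rewrite subUset sub1set xK.
have [I1' I2'] := andP cI; have [P1 P2] := andP cP.
have [f1 h1] := miss _ I1' P1; have [f2 h2] := miss _ I2' P2.
have vP : v \in P.
  apply: (subsetP sP); rewrite !inE eqxx andbT.
  by apply: contraNneq vI => ->.
have sub x : x \in P -> x != f1 -> x != f2 -> x \in I.
  move=> xP x1 x2; case: (boolP (x \in I)) => // xI; have := mx x xI.
  case: (h1 x xP x1) => [hx|i1]; first by rewrite hx in xI.
  case: (h2 x xP x2) => [hx|i2]; first by rewrite hx in xI.
  by rewrite /common_indep i1 i2.
(* [miss] does not say that [f] is outside [I]. If it is inside, [v] takes its place: [v] is not in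
   [I], so removing it does no harm. *)
pose g f := if f \in I then v else f.
exists w, (g f1), (g f2); apply/setP => x; rewrite !inE.
have gI f : g f \notin I by rewrite /g; case: ifP => [_|/negbT].
have [xI|xI] := boolP (x \in I).
  have xg f : x != g f by apply: contraTneq xI => ->.
  by rewrite !xg /=; move: (subsetP IP x xI); rewrite in_setU1.
apply/esym/negbTE; rewrite !negb_and !negbK.
have [xP|xP] := boolP (x \in P); last first.
  rewrite orbF; apply/orP; right; apply/orP; right.
  by apply: contraNneq xI => ->.
case: (eqVneq x f1) => [<-|x1]; first by rewrite /g (negPf xI) eqxx !orbT.
case: (eqVneq x f2) => [<-|x2]; first by rewrite /g (negPf xI) eqxx.
by rewrite sub in xI.
Qed.

End Step.

(** * Depth-first traversal of a forest given by its parent map *)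

Section Walk.
Variables (V : finType) (code : V -> nat) (S : {set V}).
Variables (par : V -> option V) (height : V -> nat).
Hypothesis code_inj : injective code.
Hypothesis par_S : forall I P, I \in S -> par I = Some P ->
  P \in S /\ height I < height P.
Implicit Types (I J K P : V) (o : option V) (q : bool).

(** [None] acts as a virtual parent of the roots, so that the list of roots and the lists of
    children are traversed alike. *)
Definition kids o := [set K in S | par K == o].

Definition nextkid o b := [pick K in kids o |
  (b <= code K) && [forall K' in kids o, (b <= code K') ==> (code K <= code K')]].

Variant nextkid_spec o b : option V -> Prop :=
  | NoKid of (forall K, K \in kids o -> code K < b) : nextkid_spec o b None
  | Kid K of K \in kids o & b <= code K
      & (forall K', K' \in kids o -> b <= code K' -> code K <= code K') :
      nextkid_spec o b (Some K).

Lemma nextkidP o b : nextkid_spec o b (nextkid o b).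
Proof.
rewrite /nextkid; case: pickP => [K /and3P[oK bK /forall_inP minK]|no].
  by constructor=> // K' oK'; apply/implyP/minK.
constructor => K oK; rewrite ltnNge; apply/negP => bK.
have PK : (K \in kids o) && (b <= code K) by rewrite oK.
case: (@arg_minnP _ K (fun K => (K \in kids o) && (b <= code K)) code PK) => K' /andP[oK' bK'] m.
have := no K'; rewrite oK' bK' /= => /negP[]; apply/forall_inP => K2 oK2.
by apply/implyP => bK2; apply: m; rewrite oK2.
Qed.

Lemma nextkid_uniq o b r : nextkid_spec o b r -> nextkid o b = r.
Proof.
case: nextkidP => [no|K oK bK m] [no'|K' oK' bK' m'] //.
- by have := no _ oK'; rewrite ltnNge bK'.
- by have := no' _ oK; rewrite ltnNge bK.
by congr Some; apply: code_inj; apply/eqP; rewrite eqn_leq m // m'.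
Qed.

(* A state of the traversal: a node, whether it is being left, and the parity
   of its depth.  A node of even depth is output when it is entered and a node
   of odd depth when it is left, so that of two consecutive states at least
   one makes an output. *)
Definition state := (V * bool * bool)%type.

(** The bound [b] replaces a stack: the position among the siblings is recovered from the code of
    the child just left. *)
Definition after o b q : option state :=
  if nextkid o b is Some K then Some (K, false, q)
  else omap (fun P => (P, true, ~~ q)) o.

Lemma afterE o b q : after o b q = if nextkid o b is Some K then Some (K, false, q)
  else omap (fun P => (P, true, ~~ q)) o.
Proof. by []. Qed.

Definition next (s : state) : option state :=
  let: (J, leaving, q) := s in
  if leaving then after (par J) (code J).+1 q else after (Some J) 0 (~~ q).

Definition emit (s : state) : option V :=
  let: (J, leaving, q) := s in if leaving == q then Some J else None.

(** Every move flips exactly one of the two bits of a state: to a first child or up to the parent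
    the parity, to a sibling or from entering to leaving the same node the direction. Whether they
    are equal therefore alternates. *)
Lemma next_emit s s' : next s = Some s' -> emit s = None -> emit s' <> None.
Proof.
case: s => [[J [] []]] //=; rewrite /after; case: nextkid => [K [<-]|] //=.
- by case: par => [P [<-]|].
- by case=> <-.
Qed.

Fixpoint trek (s : option state) (ss : seq state) (t : option state) : Prop :=
  if ss is x :: ss' then s = Some x /\ trek (next x) ss' t else s = t.

Lemma trek_cat s ss1 t ss2 u : trek s ss1 t -> trek t ss2 u -> trek s (ss1 ++ ss2) u.
Proof. by elim: ss1 s => [s ->|x ss IH s [-> /IH h /h]]. Qed.

Inductive desc J : V -> Prop :=
  | DescRefl : desc J J
  | DescStep I P of par I = Some P & desc J P : desc J I.

Lemma desc_S J I : desc J I -> I \in S -> J \in S /\ height I <= height J.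
Proof.
elim=> // {}I P eP _ IH IS; have [/IH[-> le] lt] := par_S IS eP.
by split=> //; apply: leq_trans (ltnW lt) le.
Qed.

Lemma desc_parent K J I : par K = Some J -> desc K I -> desc J I.
Proof.
move=> eK; elim=> [|{}I P eP _]; first exact: DescStep eK (DescRefl _).
exact: DescStep.
Qed.

Lemma desc_kid J I : desc J I -> I \in S -> I <> J ->
  exists2 K, K \in kids (Some J) & desc K I.
Proof.
elim=> // {}I P eP _ IH IS _; have [PS _] := par_S IS eP.
have [eJ|/eqP /(IH PS)[K oK dK]] := eqVneq P J.
  by exists I; [rewrite inE IS eP eJ eqxx | apply: DescRefl].
by exists K => //; apply: DescStep eP dK.
Qed.

(** The ancestors of [I] form a chain. Two different siblings on it would put one of them above the
    common parent or, for roots, below another node; the first contradicts the growth of [height],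
    the second that a root has no parent. So no node is visited in two subtrees. *)
Lemma desc_disjoint o K1 K2 I : I \in S -> par K1 = o -> par K2 = o ->
  desc K1 I -> desc K2 I -> K1 = K2.
Proof.
have aux K K' P : P \in S -> par K' = Some P -> par K = Some P -> ~ desc K P.
  move=> PS _ eK /desc_S/(_ PS)[KS le]; have [_] := par_S KS eK.
  by rewrite ltnNge le.
move=> IS e1 e2 d1; elim: d1 IS => [|{}I P eP d1 IH] IS d2.
  case: d2 IS e1 => // I' P eP d2 IS e1.
  by have [PS _] := par_S IS eP; case: (aux K2 I' P); rewrite ?e2 -?e1.
have [PS _] := par_S IS eP.
case: d2 eP IS => [|I' P' eP' d2] eP IS.
  by case: (aux K1 K2 P); rewrite ?e1 -?e2.
by apply: IH => //; move: eP'; rewrite eP => -[->].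
Qed.

(** Climbing raises the height, which is bounded on a finite type, so it ends at a root. *)
Lemma desc_root I : I \in S -> exists2 K, K \in kids None & desc K I.
Proof.
move: {2}_.+1 (ltnSn (\max_J height J - height I)) => k.
elim: k I => // k IH I ltk IS; case e: (par I) => [P|]; last first.
  by exists I; [rewrite inE IS e eqxx | apply: DescRefl].
have [PS lt] := par_S IS e; have leP := @leq_bigmax V height P.
have [|//|K oK dK] := IH P; last by exists K => //; apply: DescStep e dK.
by rewrite (leq_trans _ (ltnSE ltk)) // ltn_sub2l // (leq_trans lt).
Qed.

Definition outs ss := pmap emit ss.

Lemma outs_cat ss1 ss2 : outs (ss1 ++ ss2) = outs ss1 ++ outs ss2.
Proof. exact: pmap_cat. Qed.

Definition visits (s : option state) (t : option state) (D : V -> Prop) :=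
  exists ss, [/\ trek s ss t, uniq (outs ss) & forall I, I \in outs ss <-> D I].

Lemma visit_kids o q b :
  (forall K, K \in kids o ->
     visits (Some (K, false, q)) (next (K, true, q)) (fun I => I \in S /\ desc K I)) ->
  visits (after o b q) (omap (fun P => (P, true, ~~ q)) o)
    (fun I => I \in S /\ exists K, [/\ K \in kids o, b <= code K & desc K I]).
Proof.
(* Induction on the number of children whose code is at least [b]. *)
move=> vK; move: {2}_.+1 (ltnSn #|[set K in kids o | b <= code K]|) => k.
elim: k b => // k IH b ltk; rewrite /after; case: nextkidP => [no|K oK bK m].
  exists [::]; split=> // I; split=> // -[_ [K [oK bK _]]].
  by have := no K oK; rewrite ltnNge bK.
have [ss1 [t1 u1 m1]] := vK K oK.
have eK : par K = o by move: oK; rewrite inE => /andP[_ /eqP].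
have [|ss2 [t2 u2 m2]] := IH (code K).+1.
  rewrite -ltnS; apply: leq_trans ltk; rewrite ltnS; apply: proper_card.
  apply/properP; split; last by exists K; rewrite inE ?oK // ltnn andbF.
  by apply/subsetP => K'; rewrite !inE => /andP[-> /ltnW/(leq_trans bK)].
exists (ss1 ++ ss2); rewrite outs_cat; split.
- apply: trek_cat t1 _; move: t2; by rewrite /= eK.
- rewrite cat_uniq u1 u2 andbT; apply/hasPn => I /m2[IS [K' [oK' lt dK']]].
  apply/negP => /m1[_ dK].
  have e : K = K'.
    apply: desc_disjoint IS eK _ dK dK'.
    by move: oK'; rewrite inE => /andP[_ /eqP].
  by rewrite e ltnn in lt.
move=> I; rewrite mem_cat; split.
  case/orP => [/m1[IS dK]|/m2[IS [K' [oK' lt dK']]]]; split=> //; first by exists K.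
  by exists K'; split=> //; apply: leq_trans bK (ltnW lt).
case=> IS [K' [oK' bK' dK']]; have [e|ne] := eqVneq K' K.
  by apply/orP; left; apply/m1; rewrite -e.
apply/orP; right; apply/m2; split=> //; exists K'; split=> //.
by rewrite ltn_neqAle m // andbT (inj_eq code_inj) eq_sym.
Qed.

(** A visit adds two states for [J] itself, around those of its children. Whatever the parity,
    exactly one of the two outputs [J]. *)
Lemma visit_node J q : J \in S ->
  visits (Some (J, false, q)) (next (J, true, q)) (fun I => I \in S /\ desc J I).
Proof.
move: {2}_.+1 (ltnSn (height J)) => k; elim: k J q => // k IH J q ltk JS.
have [|ss [t u m]] := @visit_kids (Some J) (~~ q) 0.
  move=> K; rewrite inE => /andP[KS /eqP eK]; apply: IH => //.
  by have [_ lt] := par_S KS eK; apply: leq_trans lt _.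
have nJ : J \notin outs ss.
  apply/negP => /m[_ [K []]]; rewrite inE => /andP[KS /eqP eK] _.
  have [_ lt] := par_S KS eK; case/desc_S/(_ JS) => _.
  by rewrite leqNgt lt.
exists ((J, false, q) :: ss ++ [:: (J, true, q)]); split.
- by split=> //; apply: trek_cat t _; rewrite /= negbK.
- rewrite /outs /= pmap_cat /= -/(outs ss).
  by case: q {t} => /=; rewrite ?cats0 ?cats1 ?rcons_uniq u nJ.
move=> I.
have -> : (I \in outs ((J, false, q) :: ss ++ [:: (J, true, q)])) = (I == J) || (I \in outs ss).
  rewrite /outs /= pmap_cat /= -/(outs ss).
  by case: q {t} => /=; rewrite ?cats0 ?cats1 ?mem_rcons inE.
split.
  case/orP => [/eqP->|/m[IS [K [oK _ dK]]]]; first by split=> //; apply: DescRefl.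
  split=> //; apply: desc_parent dK; by move: oK; rewrite inE => /andP[_ /eqP].
case=> IS dJ; have [//|/eqP ne] := eqVneq I J; apply/m; split=> //.
by have [K oK dK] := desc_kid dJ IS ne; exists K.
Qed.

Lemma visit_all : exists ss, [/\ trek (after None 0 false) ss None,
  uniq (outs ss) & outs ss =i S].
Proof.
have [|ss [t u m]] := @visit_kids None false 0.
  by move=> K; rewrite inE => /andP[KS _]; apply: visit_node.
exists ss; split=> // I; apply/idP/idP => [/m[]//|IS]; apply/m; split=> //.
by have [K oK dK] := desc_root IS; exists K.
Qed.

End Walk.

(** * Maximum sets in lexicographic order *)

Section Roots.
Variables (T : finType) (M1 M2 : matroid T).
Implicit Types (I J K P R A B F : {set T}) (u v x y : T).
Local Notation common := (common_indep M1 M2).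
Local Notation augstep := (augstep M1 M2).
Local Notation maximize := (maximize M1 M2).
Local Notation parent := (parent M1 M2).
Local Notation progress := (progress M1 M2).
Local Notation n := #|T|.

Definition nu := #|maximize set0 set0|.

Definition maximum B := common B && (#|B| == nu).

Lemma common0 : common set0.
Proof. by rewrite /common_indep !indep_set0. Qed.

Lemma card_le_nu J : common J -> #|J| <= nu.
Proof.
by move=> cJ; have [_ _] := maximizeP set0 common0; apply; rewrite ?setI0.
Qed.

(** Growing is impossible by size. An exchange would yield another maximum set of larger progress
    that still has an augmenting path; by induction on the remaining progress that set admits no
    step, and so no path. *)
Lemma augstep_maximum B : maximum B -> augstep set0 B = None.
Proof.
move: {2}_.+1 (ltnSn (n.+1 ^ 2 - progress set0 B)) => k.
elim: k B => // k IH B ltk /andP[cB /eqP eB].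
case: (augstepP set0 cB) => // [v vB c _ _|v w _ _ c e _ _ pr st].
  by have := card_le_nu c; rewrite cardsU1 vB eB ltnn.
have mB : maximum ((v |: B) :\ w) by rewrite /maximum c e eB /=.
have : augstep set0 ((v |: B) :\ w) = None.
  by apply: IH mB; rewrite (leq_trans _ (ltnSE ltk)) // ltn_sub2l // (ltn_trans pr) ?progress_lt.
by case: (augstepP set0 c).
Qed.

Lemma parent_none B : maxset common B -> (parent B == None) = maximum B.
Proof.
case/maxsetP=> cB _; apply/eqP/idP => [|mB].
  rewrite /parent; case: (augstepP set0 cB) => // _ mx _.
  rewrite /maximum cB eqn_leq card_le_nu //=.
  have [c _ _] := maximizeP set0 common0.
  by apply: mx; rewrite ?setI0.
by rewrite /parent augstep_maximum.
Qed.

Lemma maximum_maxset B : maximum B -> maxset common B.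
Proof.
case/andP=> cB /eqP eB; apply/maxcommonP; split=> // x xB.
by apply/negP => /card_le_nu; rewrite cardsU1 xB eB ltnn.
Qed.

Definition extendable F A := common A && (#|maximize F A| == nu).

Lemma extendableP F A : A \subset F ->
  reflect (exists2 B, maximum B & B :&: F = A) (extendable F A).
Proof.
move=> sAF; apply: (iffP andP) => [[cA eA]|[B /andP[cB /eqP eB] BF]].
  have [cB BF _] := maximizeP F cA; exists (maximize F A).
    by rewrite /maximum cB.
  by rewrite BF; apply/setIidPl.
have cA : common A by apply: commonS cB; rewrite -BF subsetIl.
have [c AF mx] := maximizeP F cA; split=> //.
rewrite eqn_leq card_le_nu //= -eB mx // BF.
by apply/esym/setIidPl.
Qed.

Definition greedy_step (s : {set T} * {set T}) x :=
  let: (F, A) := s in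
  if x \in F then s
  else let F' := x |: F in if extendable F' A then (F', A) else (F', x |: A).

Definition greedy F A := (foldl greedy_step (F, A) (enum T)).2.

(** Leaving an element out gives the smaller code, so [x] is put in only when no maximum set with
    the intersection prescribed so far avoids it. The invariant keeps some maximum set with that
    intersection. *)
Lemma greedyP F A : A \subset F -> extendable F A ->
  [/\ maximum (greedy F A), greedy F A :&: F = A
   & forall B, maximum B -> B :&: F = A -> code (greedy F A) <= code B].
Proof.
move=> sAF exA; rewrite /greedy /code.
suff inv s : uniq s -> let: (F', A') := foldl greedy_step (F, A) s in
  [/\ A' \subset F', F' = F :|: [set x in s], A' :&: F = A,
      exists2 B, maximum B & B :&: F' = A'
   & forall B, maximum B -> B :&: F = A -> pcode A' s <= pcode B s].
  move: (inv _ (enum_uniq T)); case: foldl => F' A' [_ eF' A'F [B mB BF'] le].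
  have F'T : F' = setT by apply/setP => x; rewrite eF' !inE mem_enum orbT.
  by move: BF'; rewrite F'T setIT => eB; rewrite -eB in A'F le *.
elim/last_ind: s => [|s x IH].
  move=> _ /=; split=> //.
  - by apply/setP => x; rewrite !inE orbF.
  - exact/setIidPl.
  - exact/(extendableP sAF).
rewrite rcons_uniq => /andP[xs /IH]; rewrite foldl_rcons.
case: foldl => F' A' [sAF' eF' A'F [B mB BF'] le]; rewrite {1}/greedy_step.
have F'x : x |: F' = F :|: [set y in rcons s x].
  by apply/setP => y; rewrite eF' !inE mem_rcons inE orbCA.
have agree B' : maximum B' -> B' :&: F = A -> pcode A' s = pcode B' s -> B' :&: F' = A'.
  move=> _ B'F /pcode_inj e; apply/setP => y; rewrite inE.
  case: (boolP (y \in F')) => [|yF']; last first.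
    by rewrite andbF; apply/esym/negbTE; apply: contra yF'; apply: (subsetP sAF').
  rewrite andbT eF' in_setU inE; case: (boolP (y \in s)) => [ys _|_].
    by rewrite e.
  rewrite orbF => yF; move/setP/(_ y): A'F; move/setP/(_ y): B'F.
  by rewrite !inE yF !andbT => -> ->.
case: ifP => xF'.
  have xF : x \in F by move: xF'; rewrite eF' in_setU inE (negPf xs) orbF.
  split=> //.
  - by rewrite -F'x; apply/setP => y; rewrite in_setU1; case: eqP => [->|].
  - by exists B.
  move=> B' mB' B'F; rewrite !pcode_rcons.
  have -> : (x \in A') = (x \in B').
    move/setP/(_ x): A'F; move/setP/(_ x): B'F.
    by rewrite !inE xF !andbT => -> ->.
  by rewrite leq_add2r leq_double le.
have xA' : x \notin A' by apply: contraFN xF'; apply: (subsetP sAF').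
have sAF'x : A' \subset x |: F' by apply: subset_trans sAF' (subsetUr _ _).
case: extendableP => // ex.
  split=> // B' mB' B'F; rewrite !pcode_rcons (negPf xA') addn0.
  by apply: leq_trans (leq_addr _ _); rewrite leq_double le.
have must B' : maximum B' -> B' :&: F' = A' -> x \in B'.
  move=> mB' B'F'; apply/negPn/negP => xB'; apply: ex; exists B' => //.
  by rewrite setIUr B'F'; apply/setP => y; rewrite !inE; case: eqP => [->|_]; rewrite ?(negPf xB') ?andbF.
split=> //; first exact: setUS.
- rewrite setIUl A'F; apply/setP => y; rewrite !inE; case: eqP => [->|//].
  by move: xF'; rewrite eF' in_setU => /norP[/negPf-> _].
- exists B => //; rewrite setIUr BF'; congr (_ :|: _).
  by apply/setIidPr; rewrite sub1set must.
move=> B' mB' B'F; rewrite !pcode_rcons setU11.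
have -> : pcode (x |: A') s = pcode A' s.
  apply: eq_pcode => y ys; rewrite in_setU1; case: eqP => // eyx.
  by rewrite -eyx ys in xs.
(* On a tie so far, [B'] has the prescribed intersection and must contain [x] too; otherwise it is
   already larger at an earlier digit, which later digits cannot offset. *)
have := le B' mB' B'F; rewrite leq_eqVlt => /predU1P[e|lt].
  by rewrite e (must B') // agree.
by case: (x \in B'); lia.
Qed.

Definition upto x := [set y : T | rk y <= rk x].
Definition flip J x := x |: [set y in J | rk y < rk x].

Definition flippable J := foldl
  (fun o x => if (x \notin J) && extendable (upto x) (flip J x) then Some x else o)
  None (enum T).

Lemma flippableP J :
  if flippable J is Some x then
    [/\ x \notin J, extendable (upto x) (flip J x)
     & forall y, y \notin J -> extendable (upto y) (flip J y) -> rk y <= rk x]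
  else forall y, y \notin J -> ~~ extendable (upto y) (flip J y).
Proof.
rewrite /flippable; set g := fun o x => _.
suff: forall s1 s2, enum T = s1 ++ s2 -> if foldl g None s1 is Some x then
    [/\ x \notin J, extendable (upto x) (flip J x)
     & {in s1, forall y, y \notin J -> extendable (upto y) (flip J y) -> rk y <= rk x}]
  else {in s1, forall y, y \notin J -> ~~ extendable (upto y) (flip J y)}.
  move/(_ (enum T) [::]); rewrite cats0 => /(_ erefl).
  case: foldl => [x [xJ ex m]|no]; first by split=> // y; apply: m; rewrite mem_enum.
  by move=> y; apply: no; rewrite mem_enum.
elim/last_ind => [//|s1 x IH] s2; rewrite cat_rcons => e.
move: (IH _ e); rewrite foldl_rcons; set o := foldl _ _ _; rewrite /g => {}IH.
case: ifP => [/andP[xJ ex]|no].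
  split=> // y; rewrite mem_rcons inE => /predU1P[->//|].
  by rewrite (rk_split _ e) => /ltnW.
have noy y : y = x -> y \notin J -> ~~ extendable (upto y) (flip J y).
  by move=> -> xJ; move: no; rewrite xJ /= => ->.
case: o IH => [z [zJ ez m]|no'].
  split=> // y; rewrite mem_rcons inE => /predU1P[/noy h yJ|/m//].
  by rewrite (negPf (h yJ)).
by move=> y; rewrite mem_rcons inE => /predU1P[/noy|/no'].
Qed.

Lemma flip_upto J x : flip J x \subset upto x.
Proof.
by apply/subsetP => y; rewrite !inE => /predU1P[->//|/andP[_ /ltnW]].
Qed.

Lemma flipE J B x : x \in B -> (forall y, rk y < rk x -> (y \in J) = (y \in B)) ->
  B :&: upto x = flip J x.
Proof.
move=> xB agree; apply/setP => y; rewrite !inE leq_eqVlt (inj_eq (@rk_inj _)).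
have [->|ne] /= := eqVneq y x; first by rewrite xB.
by case: (ltnP (rk y) (rk x)) => [/agree->|]; rewrite ?andbT ?andbF.
Qed.

Lemma flip_agree J B x : B :&: upto x = flip J x ->
  x \in B /\ forall y, rk y < rk x -> (y \in J) = (y \in B).
Proof.
move=> /setP e; split; first by move: (e x); rewrite !inE leqnn eqxx andbT.
move=> y lt; move: (e y); rewrite !inE lt (ltnW lt) !andbT => ->.
by case: eqVneq => // eyx; rewrite eyx ltnn in lt.
Qed.

(* The lexicographic successor of J: switch on the last possible element x that
   J does not contain, keep everything before x, and complete greedily. *)
Definition nextroot J := omap (fun x => greedy (upto x) (flip J x)) (flippable J).

Lemma nextrootP J : if nextroot J is Some R then
    [/\ maximum R, code J < code R
     & forall B, maximum B -> code J < code B -> code R <= code B]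
  else forall B, maximum B -> code B <= code J.
Proof.
have ex_diff B : maximum B -> code J < code B -> exists x,
    [/\ x \notin J, extendable (upto x) (flip J x) & B :&: upto x = flip J x].
  move=> mB /code_ltP[x [xJ xB agree]]; exists x; have e := flipE xB agree.
  by split=> //; apply/(extendableP (flip_upto J x)); exists B.
rewrite /nextroot; move: (flippableP J); case: flippable => [x [xJ ex m]|no] /=.
  have [mR RF le] := greedyP (flip_upto J x) ex.
  set R := greedy _ _ in mR RF le *; have [xR agree] := flip_agree RF.
  have ltJR : code J < code R by apply: code_lt agree xJ xR.
  split=> // B mB /(ex_diff B mB)[y [yJ ey By]].
  (* [y] is where [B] first differs from [J]. If it is [x], then [R] is least by greediness; if it
     comes earlier, [R] still agrees with [J] there and [B] is larger. *)
  have := m y yJ ey; rewrite leq_eqVlt (inj_eq (@rk_inj _)) => /predU1P[eyx|lt].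
    by apply: le; rewrite // -eyx.
  have [yB agB] := flip_agree By; apply: ltnW.
  apply: (@code_lt _ _ _ y) => // [z ltz|]; last by rewrite -agree.
  by rewrite -agree ?agB // (ltn_trans ltz).
move=> B mB; rewrite leqNgt; apply/negP => /(ex_diff B mB)[y [yJ ey _]].
by have := no y yJ; rewrite ey.
Qed.

Definition firstroot := greedy set0 set0.

Lemma firstrootP : maximum firstroot /\ forall B, maximum B -> code firstroot <= code B.
Proof.
have ex : extendable set0 set0 by rewrite /extendable common0 /nu eqxx.
have [mR _ le] := greedyP (sub0set set0) ex.
by split=> // B mB; apply: le; rewrite ?setI0.
Qed.

Variable tau : int.

Definition large I := (tau <= Posz #|I|)%R.
Definition solutions := [set I | maxset common I && large I].

Lemma parent_solutions I P : I \in solutions -> parent I = Some P ->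
  P \in solutions /\ progress set0 I < progress set0 P.
Proof.
rewrite !inE => /andP[mI lI] /(parentP mI)[mP le pr _]; split=> //.
by rewrite mP; apply: Order.POrderTheory.le_trans lI _; rewrite lez_nat.
Qed.

Local Notation kids := (kids solutions parent).
Local Notation nextkid := (nextkid (@code T) solutions parent).

(** All maximum sets have size [nu], so the threshold admits all of them or none. One test of [tau]
    against [nu] therefore settles the roots. *)
Lemma in_kids_root B : (B \in kids None) = maximum B && (tau <= Posz nu)%R.
Proof.
rewrite !inE; have [mB|] := boolP (maxset common B); last first.
  by move=> nB; apply/esym/negbTE; apply: contra nB => /andP[/maximum_maxset].
rewrite parent_none //= andbC /maximum.
by case: maxsetP mB => // -[-> _] _ /=; rewrite /large; case: eqP => // ->.
Qed.

Lemma nextkid_first : (tau <= Posz nu)%R -> nextkid None 0 = Some firstroot.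
Proof.
move=> le; apply: (nextkid_uniq (@code_inj T)); have [m mn] := firstrootP.
by constructor => // [|B]; rewrite in_kids_root le andbT // => /mn.
Qed.

Lemma nextkid_no_root b : ~~ (tau <= Posz nu)%R -> nextkid None b = None.
Proof.
move=> gt; apply: (nextkid_uniq (@code_inj T)); constructor => B.
by rewrite in_kids_root (negPf gt) andbF.
Qed.

Lemma nextkid_nextroot J : (tau <= Posz nu)%R ->
  nextkid None (code J).+1 = nextroot J.
Proof.
move=> le; apply: (nextkid_uniq (@code_inj T)); move: (nextrootP J).
case: nextroot => [R [mR lt m]|no]; constructor => //.
- by rewrite in_kids_root le mR.
- by move=> B; rewrite in_kids_root => /andP[/m].
by move=> B; rewrite in_kids_root => /andP[/no]; rewrite ltnS.
Qed.

End Roots.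

(** * A language of bounded loops and its compilation *)

(* Programs of this language only loop over the elements of the ground set (or
   n + 1 times), so they have a total interpreter sem, and their running time is
   bounded by their nesting depth.  CTest b a u v k stores in variable k whether
   the set in array a, plus element u, minus element v, is independent; it
   modifies array a in place and restores it.  ES is a successor that saturates
   at n + 1 and array accesses are guarded by an index test, so that a compiled
   program never overflows a word or leaves its memory.  Cells 0 to 2 hold the
   input and cells 3 and 4 are scratch. *)
Inductive hexp :=
  | EB of bool
  | EN
  | EV of nat
  | EA of nat & nat
  | ES of hexp
  | EEq of hexp & hexp
  | ELt of hexp & hexp
  | EAnd of hexp & hexp
  | ENot of hexp
  | ETau of hexp.

Inductive hcmd :=
  | CSkip
  | CSeq of hcmd & hcmd
  | CSet of nat & hexp
  | CPut of nat & nat & hexp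
  | CIf of hexp & hcmd & hcmd
  | CFor of bool & nat & hcmd
  | CTest of bool & nat & option nat & option nat & nat.

Definition nv := 30.
Definition na := 8.
Definition avar k := 5 + k.
Definition abase := 5 + nv.

Definition eN := Read (Const 0).
Definition evar k := Read (Const (avar k)).
Definition eaddr a i := Bin Add (Bin Add (Const abase) (Bin Mul (Const a) eN)) i.
Definition eread a i := Bin Mul (Bin Ltb i eN) (Read (eaddr a i)).

Fixpoint compe (e : hexp) : expr :=
  match e with
  | EB b => Const b
  | EN => eN
  | EV k => evar k
  | EA a k => eread a (evar k)
  | ES e => Bin Add (compe e) (Bin Ltb (compe e) (Bin Add eN (Const 1)))
  | EEq e f => Bin Eqb (compe e) (compe f)
  | ELt e f => Bin Ltb (compe e) (compe f)
  | EAnd e f => Bin Mul (Bin Ltb (Const 0) (compe e)) (Bin Ltb (Const 0) (compe f))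
  | ENot e => Bin Eqb (compe e) (Const 0)
  | ETau e => Bin Eqb (Bin Ltb (compe e)
      (Bin Mul (Read (Const 1)) (Bin Defs.Sub (Const 1) (Read (Const 2))))) (Const 0)
  end.

(** An absent element gets index [n]: guarded writes at [n] do nothing, and [sing n] is empty. *)
Definition eix (o : option nat) := if o is Some k then evar k else eN.

Definition cput a i e := If (Bin Ltb i eN) [:: Store (eaddr a i) e] [::].

Fixpoint comp (c : hcmd) : seq cmd :=
  match c with
  | CSkip => [::]
  | CSeq p q => comp p ++ comp q
  | CSet k e => [:: Store (Const (avar k)) (compe e)]
  | CPut a k e => [:: cput a (evar k) (compe e)]
  | CIf e p q => [:: If (compe e) (comp p) (comp q)]
  | CFor b k p =>
      [:: Store (Const (avar k)) (Const 0);
          While (Bin Ltb (evar k) (Bin Add eN (Const b)))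
            (comp p ++ [:: Store (Const (avar k)) (Bin Add (evar k) (Const 1))])]
  | CTest b a u v k =>
      [:: Store (Const 3) (eread a (eix u)); cput a (eix u) (Const 1);
          Store (Const 4) (eread a (eix v)); cput a (eix v) (Const 0);
          Query b (eaddr a (Const 0)) (Const (avar k));
          cput a (eix v) (Read (Const 4)); cput a (eix u) (Read (Const 3))]
  end.

Fixpoint modv (c : hcmd) : seq nat :=
  match c with
  | CSeq p q => modv p ++ modv q
  | CSet k _ => [:: k]
  | CIf _ p q => modv p ++ modv q
  | CFor _ k p => k :: modv p
  | CTest _ _ _ _ k => [:: k]
  | _ => [::]
  end.

Fixpoint moda (c : hcmd) : seq nat :=
  match c with
  | CSeq p q => moda p ++ moda q
  | CPut a _ _ => [:: a]
  | CIf _ p q => moda p ++ moda q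
  | CFor _ _ p => moda p
  | _ => [::]
  end.

Fixpoint wfe (e : hexp) : bool :=
  match e with
  | EB _ | EN => true
  | EV k => k < nv
  | EA a k => (a < na) && (k < nv)
  | ES e | ENot e | ETau e => wfe e
  | EEq e f | ELt e f | EAnd e f => wfe e && wfe f
  end.

Definition wfo (k : nat) (o : option nat) := if o is Some j then (j < nv) && (j != k) else true.

Fixpoint wf (c : hcmd) : bool :=
  match c with
  | CSkip => true
  | CSeq p q => wf p && wf q
  | CSet k e => (k < nv) && wfe e
  | CPut a k e => [&& a < na, k < nv & wfe e]
  | CIf e p q => [&& wfe e, wf p & wf q]
  | CFor _ k p => [&& k < nv, k \notin modv p & wf p]
  | CTest _ a u v k => [&& a < na, k < nv, wfo k u & wfo k v]
  end.

Fixpoint depth (c : hcmd) : nat :=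
  match c with
  | CSeq p q | CIf _ p q => maxn (depth p) (depth q)
  | CFor _ _ p => (depth p).+1
  | _ => 0
  end.

Definition cput_time i e := (expr_time i + 3).+1.+1 + (1 + expr_time (eaddr 0 i) + expr_time e).

Fixpoint weight (c : hcmd) : nat :=
  match c with
  | CSkip => 0
  | CSeq p q => weight p + weight q
  | CSet k e => 2 + expr_time (compe e)
  | CPut a k e => cput_time (evar k) (compe e)
  | CIf e p q => 1 + expr_time (compe e) + (weight p + weight q)
  | CFor b k p => weight p + 50
  | CTest b a u v k => 201
  end.

Record store := St { vs : nat -> nat; ar : nat -> nat -> nat }.

Definition upd (A : Type) (f : nat -> A) k x := fun j => if j == k then x else f j.

Definition setv s k x := St (upd (vs s) k x) (ar s).
Definition puta s a i x := St (vs s) (upd (ar s) a (upd (ar s a) i x)).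

(** * Semantics of the loop language *)

Section Semantics.
Variables (T : finType) (orc : bool -> pred {set T}) (tau : int).
Local Notation n := #|T|.

Definition putg s a i x := if i < n then puta s a i x else s.

Definition ixv s (o : option nat) := if o is Some k then vs s k else n.

Definition sing i : {set T} := [set x | rk x == i].
Definition aset s a : {set T} := [set x | ar s a (rk x) != 0].

Lemma eq_aset s s' a : ar s a = ar s' a -> aset s a = aset s' a.
Proof. by rewrite /aset => ->. Qed.

Fixpoint ev (s : store) (e : hexp) : nat :=
  match e with
  | EB b => b
  | EN => n
  | EV k => vs s k
  | EA a k => if vs s k < n then ar s a (vs s k) else 0
  | ES e => ev s e + (ev s e < n.+1)
  | EEq e f => ev s e == ev s f
  | ELt e f => ev s e < ev s f
  | EAnd e f => (ev s e != 0) && (ev s f != 0)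
  | ENot e => ev s e == 0
  | ETau e => (tau <= Posz (ev s e))%R
  end.

Fixpoint sem (c : hcmd) (s : store) : store :=
  match c with
  | CSkip => s
  | CSeq p q => sem q (sem p s)
  | CSet k e => setv s k (ev s e)
  | CPut a k e => putg s a (vs s k) (ev s e)
  | CIf e p q => if ev s e != 0 then sem p s else sem q s
  | CFor b k p =>
      setv (foldl (fun s i => sem p (setv s k i)) s (iota 0 (n + b))) k (n + b)
  | CTest b a u v k =>
      setv s k (orc b ((aset s a :|: sing (ixv s u)) :\: sing (ixv s v)))
  end.

Lemma sem_vs c s k : k \notin modv c -> vs (sem c s) k = vs s k.
Proof.
have updE (A : Type) (f : nat -> A) j (x : A) : k != j -> upd f j x k = f k.
  by rewrite /upd => /negPf->.
elim: c s => //= [p IHp q IHq|j e|a j e|e p IHp q IHq|b j p IH|b a u v j] s.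
- by rewrite mem_cat negb_or => /andP[kp kq]; rewrite IHq // IHp.
- by rewrite inE => kj; apply: updE.
- by rewrite /putg; case: ifP.
- by rewrite mem_cat negb_or => /andP[kp kq]; case: ifP => _; [apply: IHp | apply: IHq].
- rewrite inE negb_or => /andP[kj kp]; rewrite updE //.
  by elim: (iota _ _) s => //= i l IHl s; rewrite IHl IH //= updE.
by rewrite inE => kj; apply: updE.
Qed.

Lemma sem_ar c s a : a \notin moda c -> ar (sem c s) a = ar s a.
Proof.
elim: c s => //= [p IHp q IHq|b j e|e p IHp q IHq|b j p IH] s.
- by rewrite mem_cat negb_or => /andP[kp kq]; rewrite IHq // IHp.
- by rewrite /putg; case: ifP => //= _; rewrite inE /upd => /negPf->.
- by rewrite mem_cat negb_or => /andP[kp kq]; case: ifP => _; [apply: IHp | apply: IHq].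
by move=> ap; elim: (iota _ _) s => //= i l IHl s; rewrite IHl IH.
Qed.

Lemma sem_aset c s a : a \notin moda c -> aset (sem c s) a = aset s a.
Proof. by move=> h; rewrite /aset sem_ar. Qed.

(** * Correctness and cost of the compiled programs *)

Section Correct.
Variables (Q Qs W : nat).

Definition msize := abase + na * n.

(** The bounds by [n.+1], the value that a counter of a [CFor true] loop reaches, keep every write
    within a word; [enc_size] keeps the space linear in [n]. *)
Record enc (m : memory) (s : store) : Prop := Enc {
  enc_size : size m <= msize;
  enc_n : nth 0 m 0 = n;
  enc_tau : nth 0 m 1 = absz tau;
  enc_sgn : nth 0 m 2 = (tau < 0)%R;
  enc_v : forall k, k < nv -> nth 0 m (avar k) = vs s k;
  enc_a : forall a i, a < na -> i < n -> nth 0 m (abase + a * n + i) = ar s a i;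
  enc_vle : forall k, k < nv -> vs s k <= n.+1;
  enc_ale : forall a i, a < na -> i < n -> ar s a i <= n.+1 }.

Lemma enc_ext m s s' : (forall k, k < nv -> vs s k = vs s' k) ->
  (forall a i, a < na -> i < n -> ar s a i = ar s' a i) -> enc m s -> enc m s'.
Proof.
move=> ev ea [h1 h2 h3 h4 h5 h6 h7 h8].
split=> //; [move=> k lt|move=> a i lta lti|move=> k lt|move=> a i lta lti].
all: rewrite -?ev -?ea //; eauto.
Qed.

Lemma ev_le m s e : enc m s -> wfe e -> ev s e <= n.+1.
Proof.
have leb (b : bool) : b <= n.+1 by case: b.
move=> E; elim: e => //= [k|a k|e IH] w; first exact: (enc_vle E).
  by case/andP: w => la lk; case: ifP => // lt; apply: (enc_ale E).
by case: (ltnP (ev s e) n.+1) => lt; rewrite ?addn1 // addn0 IH.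
Qed.

Lemma eval_compe m s e : enc m s -> wfe e -> eval m (compe e) = ev s e.
Proof.
move=> E; elim: e => //=.
- by rewrite (enc_n E).
- by move=> k lk; rewrite (enc_v E).
- move=> a k /andP[la lk]; rewrite (enc_n E) (enc_v E) //.
  by case: ifP => lt; rewrite ?mul0n // mul1n (enc_a E).
- by move=> e IH w; rewrite IH // (enc_n E) addn1.
- by move=> e IHe f IHf /andP[we wf]; rewrite IHe // IHf.
- by move=> e IHe f IHf /andP[we wf]; rewrite IHe // IHf.
- by move=> e IHe f IHf /andP[we wf]; rewrite IHe // IHf // !lt0n mulnb.
- by move=> e IH w; rewrite IH.
move=> e IH w; rewrite IH // (enc_tau E) (enc_sgn E).
(* For negative [tau] the factor [1 - sign] turns the threshold into 0, which every size reaches. *)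
case: (boolP (tau < 0)%R) => sg /=.
  by rewrite muln0 ltn0 eqxx; congr nat_of_bool; lia.
by rewrite muln1; congr nat_of_bool; lia.
Qed.

Lemma addr_inj a i a' i' : i < n -> i' < n -> a * n + i = a' * n + i' ->
  a = a' /\ i = i'.
Proof.
move=> li li' e; have e1 := congr1 (divn^~ n) e; have e2 := congr1 (modn^~ n) e.
move: e1 e2; rewrite !modnMDl !modn_small // !divnMDl ?(leq_ltn_trans _ li) //.
by rewrite !divn_small // !addn0.
Qed.

Lemma addr_lt a i : a < na -> i < n -> abase + a * n + i < msize.
Proof.
move=> la li; rewrite /msize -addnA ltn_add2l; apply: (@leq_trans (a.+1 * n)).
  by rewrite mulSn addnC ltn_add2r.
by rewrite leq_mul2r la orbT.
Qed.

Lemma size_store m j x : size m <= msize -> j < msize -> size (set_nth 0 m j x) <= msize.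
Proof. by move=> h1 h2; rewrite size_set_nth geq_max h1 h2. Qed.

Lemma avar_lt k : k < nv -> avar k < msize.
Proof. by move=> lk; rewrite /msize /avar /abase -addnA ltn_add2l ltn_addr. Qed.

Lemma enc_setv m s k x : enc m s -> k < nv -> x <= n.+1 ->
  enc (set_nth 0 m (avar k) x) (setv s k x).
Proof.
move=> [h1 h2 h3 h4 h5 h6 h7 h8] lk lx; split=> //.
- exact: size_store (avar_lt lk).
- by rewrite nth_set_nth.
- by rewrite nth_set_nth.
- by rewrite nth_set_nth.
- by move=> j lj; rewrite nth_set_nth /= eqn_add2l /upd; case: eqP => // _; apply: h5.
- move=> a i la li; rewrite nth_set_nth /= gtn_eqF ?h6 //.
  by rewrite -!addnA ltn_add2l ltn_addr.
by move=> j lj; rewrite /= /upd; case: eqP => // _; apply: h7.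
Qed.

Lemma enc_scratch m s j x : enc m s -> (j == 3) || (j == 4) -> enc (set_nth 0 m j x) s.
Proof.
move=> [h1 h2 h3 h4 h5 h6 h7 h8] j34; split=> //.
- by apply: size_store => //; apply: (@leq_trans abase); [case/orP: j34 => /eqP->|exact: leq_addr].
- by rewrite nth_set_nth /=; case/orP: j34 => /eqP->.
- by rewrite nth_set_nth /=; case/orP: j34 => /eqP->.
- by rewrite nth_set_nth /=; case/orP: j34 => /eqP->.
- by move=> k lk; rewrite nth_set_nth /=; case/orP: j34 => /eqP->; apply: h5.
by move=> a i la li; rewrite nth_set_nth /=; case/orP: j34 => /eqP->; apply: h6.
Qed.

Lemma enc_puta m s a i x : enc m s -> a < na -> i < n -> x <= n.+1 ->
  enc (set_nth 0 m (abase + a * n + i) x) (puta s a i x).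
Proof.
move=> [h1 h2 h3 h4 h5 h6 h7 h8] la li lx; split=> //.
- exact: size_store (addr_lt la li).
- by rewrite nth_set_nth.
- by rewrite nth_set_nth.
- by rewrite nth_set_nth.
- move=> k lk; rewrite nth_set_nth /= ltn_eqF ?h5 //.
  by rewrite -!addnA ltn_add2l ltn_addr.
- move=> b j lb lj; rewrite nth_set_nth /= -(addnA _ (b * n)) -(addnA _ (a * n)) eqn_add2l /upd.
  case: eqP => [/addr_inj[] // -> ->|ne]; first by rewrite !eqxx.
  rewrite addnA h6 //; case: (b =P a) => // eb; case: (j =P i) => // ej.
    by case: ne; rewrite eb ej.
  by rewrite eb.
move=> b j lb lj; rewrite /= /upd; case: (b =P a) => _; last exact: h8.
by case: (j =P i) => // _; apply: h8.
Qed.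

Definition ttime (tr : seq (event T)) := \sum_(e <- tr) ev_time e.
Definition quiet (e : event T) := ~~ isSome (ev_out e) && (ev_space e <= msize + Qs).

Local Notation run := (run orc Q Qs W).

(** Quantified over the rest [k] of the program and its trace, as a configuration lists all
    remaining commands; executions then compose by concatenation. *)
Definition exec p m t m' := exists tr, [/\ all quiet tr, ttime tr <= t
  & forall k tr', run (k, m') tr' -> run (p ++ k, m) (tr ++ tr')].

Lemma exec_nil m : exec [::] m 0 m.
Proof. by exists [::]; rewrite /ttime big_nil. Qed.

Lemma exec_le p m t t' m' : exec p m t m' -> t <= t' -> exec p m t' m'.
Proof. by case=> tr [h1 h2 h3] le; exists tr; split=> //; apply: leq_trans le. Qed.

Lemma exec_cat p q m t m' t' m'' : exec p m t m' -> exec q m' t' m'' ->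
  exec (p ++ q) m (t + t') m''.
Proof.
case=> tr [q1 t1 r1] [tr2 [q2 t2 r2]]; exists (tr ++ tr2); split.
- by rewrite all_cat q1 q2.
- by rewrite /ttime big_cat; apply: leq_add.
by move=> k tr' /r2/r1; rewrite !catA.
Qed.

Lemma exec_step c e m m' t (p : seq cmd) k' m0 :
  (forall k, step orc Q Qs W (c :: k, m) = Some (e, (p ++ k, m'))) ->
  quiet e -> exec p m' t m0 -> k' = [:: c] -> exec k' m (ev_time e + t) m0.
Proof.
move=> st qe [tr [q1 t1 r1]] ->; exists (e :: tr); split; first by rewrite /= qe.
  by rewrite /ttime big_cons leq_add2l.
by move=> k tr' /r1; apply: RunStep (st k).
Qed.

Hypothesis leW : n.+1 <= W.

Lemma exec_store m s a x e j y : enc m s -> eval m a = j -> eval m e = y -> j < msize ->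
  y <= n.+1 -> x = 1 + expr_time a + expr_time e ->
  exec [:: Store a e] m x (set_nth 0 m j y).
Proof.
move=> E ea ee lj ly ->; rewrite -[X in exec _ _ X _]addn0.
apply: (@exec_step (Store a e) (Event _ _ _) _ _ _ [::]) => //; last exact: exec_nil.
  by move=> k /=; rewrite ea ee (leq_trans ly leW).
rewrite /quiet /= (leq_trans (size_store _ (enc_size E) lj)) //.
exact: leq_addr.
Qed.

Lemma exec_if m s e p q t m' : enc m s ->
  exec (if eval m e != 0 then p else q) m t m' ->
  exec [:: If e p q] m (1 + expr_time e + t) m'.
Proof.
move=> E ex; apply: (@exec_step (If e p q) (Event _ _ _) _ _ _ _) ex _ => //.
by rewrite /quiet /= (leq_trans (enc_size E)) // leq_addr.
Qed.

Lemma exec_while0 m s e p : enc m s -> eval m e = 0 ->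
  exec [:: While e p] m (1 + expr_time e) m.
Proof.
move=> E e0; rewrite -[X in exec _ _ X _]addn0.
apply: (@exec_step (While e p) (Event _ _ _) _ _ _ [::]) => //; last exact: exec_nil.
  by move=> k /=; rewrite e0.
by rewrite /quiet /= (leq_trans (enc_size E)) // leq_addr.
Qed.

Lemma exec_while m s e p t m' : enc m s -> eval m e != 0 ->
  exec (p ++ [:: While e p]) m t m' ->
  exec [:: While e p] m (1 + expr_time e + t) m'.
Proof.
move=> E e0 ex; apply: (@exec_step (While e p) (Event _ _ _) _ _ _ _) ex _ => //.
  by move=> k /=; rewrite e0 -catA.
by rewrite /quiet /= (leq_trans (enc_size E)) // leq_addr.
Qed.

Lemma exec_query m s b a r j k : enc m s -> eval m a = j -> eval m r = k -> k < msize ->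
  exec [:: Query b a r] m (1 + expr_time a + expr_time r + Q)
    (set_nth 0 m k (orc b (set_at T m j))).
Proof.
move=> E <- <- lk; rewrite -[X in exec _ _ X _]addn0.
apply: (@exec_step (Query b a r) (Event _ _ _) _ _ _ [::]) => //; last exact: exec_nil.
by rewrite /quiet /= leq_add2r size_store // (enc_size E).
Qed.

Lemma exec_cput m s a ie e i x : enc m s -> a < na -> eval m ie = i -> eval m e = x ->
  x <= n.+1 ->
  exists m', [/\ enc m' (putg s a i x), exec [:: cput a ie e] m (cput_time ie e) m'
    & forall j, j < 5 -> nth 0 m' j = nth 0 m j].
Proof.
move=> E la ei ee lx; rewrite /putg /cput /cput_time.
have [li|ge] := ltnP i n.
  exists (set_nth 0 m (abase + a * n + i) x); split; first exact: enc_puta.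
    apply: exec_le (exec_if (t := 1 + expr_time (eaddr 0 ie) + expr_time e) E _) _; last first.
      by rewrite leq_add2r /=; lia.
    rewrite /= ei (enc_n E) li.
    by apply: (exec_store E) => //=; rewrite ?ei ?(enc_n E) //; apply: addr_lt.
  by move=> j lj; rewrite nth_set_nth /= ltn_eqF // -!addnA ltn_addr.
exists m; split=> //; apply: exec_le (exec_if (t := 0) E _) _.
  by rewrite /= ei (enc_n E) ltnNge ge /=; apply: exec_nil.
by rewrite addn0 /=; lia.
Qed.


Fixpoint tc (c : hcmd) : nat :=
  match c with
  | CSkip => 0
  | CSeq p q => tc p + tc q
  | CSet k e => 2 + expr_time (compe e)
  | CPut a k e => cput_time (evar k) (compe e)
  | CIf e p q => 1 + expr_time (compe e) + (tc p + tc q)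
  | CFor b k p => 3 + ((n + b) * (14 + tc p) + 8)
  | CTest b a u v k => 200 + Q
  end.

Lemma eval_eix m s o k : enc m s -> wfo k o -> eval m (eix o) = ixv s o.
Proof.
move=> E; case: o => [j /andP[lj _]|_] /=; last exact: enc_n E.
exact: enc_v E _ lj.
Qed.

Lemma eval_eread m s a e i : enc m s -> a < na -> eval m e = i ->
  eval m (eread a e) = if i < n then ar s a i else 0.
Proof.
by move=> E la /= ->; rewrite (enc_n E); case: ifP => li; rewrite ?mul0n // mul1n (enc_a E).
Qed.

Lemma set_at_enc m s a : enc m s -> a < na -> set_at T m (abase + a * n) = aset s a.
Proof. by move=> E la; apply/setP => x; rewrite !inE (enc_a E) // rk_lt. Qed.

Lemma vs_putg s a i x : vs (putg s a i x) = vs s.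
Proof. by rewrite /putg; case: ifP. Qed.

Lemma ar_putg s a i x b j : j < n ->
  ar (putg s a i x) b j = if (b == a) && (j == i) then x else ar s b j.
Proof.
rewrite /putg => lj; case: ifP => [_|li] /=.
  by rewrite /upd; case: (b =P a) => [->|].
by case: (j =P i) => [eji|]; rewrite ?andbF //; move: li; rewrite -eji lj.
Qed.

Lemma aset_put1 s a i : aset (putg s a i 1) a = aset s a :|: sing i.
Proof.
apply/setP => x; rewrite !inE ar_putg ?rk_lt // eqxx /=.
by case: ifP; rewrite ?orbT ?orbF.
Qed.

Lemma aset_put0 s a i : aset (putg s a i 0) a = aset s a :\: sing i.
Proof. by apply/setP => x; rewrite !inE ar_putg ?rk_lt // eqxx /=; case: ifP. Qed.

Lemma exec_test m s b a u v k : wf (CTest b a u v k) -> enc m s ->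
  exists2 m', enc m' (sem (CTest b a u v k) s)
    & exec (comp (CTest b a u v k)) m (200 + Q) m'.
Proof.
case/and4P=> la lk wu wv E0.
have ixP m1 s1 o : wfo k o -> enc m1 s1 -> (forall j, j != k -> vs s1 j = vs s j) ->
    eval m1 (eix o) = ixv s o.
  move=> wo E1 e1; rewrite (eval_eix E1 wo); case: o wo => //= j /andP[_ ne].
  by rewrite e1.
have eu0 := ixP m s u wu E0 (fun _ _ => erefl).
pose x := if ixv s u < n then ar s a (ixv s u) else 0.
have lx : x <= n.+1 by rewrite /x; case: ifP => // li; apply: (enc_ale E0).
have ex := eval_eread E0 la eu0.
have s3 : 3 < msize by rewrite /msize ltn_addr.
have s4 : 4 < msize by rewrite /msize ltn_addr.
have X1 := exec_store E0 (erefl : eval m (Const 3) = 3) ex s3 lx erefl.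
set m1 := set_nth 0 m 3 _ in X1; have E1 : enc m1 s by apply: enc_scratch.
have m13 : nth 0 m1 3 = x by rewrite nth_set_nth.
have eu1 := ixP m1 s u wu E1 (fun _ _ => erefl).
have [m2 [E2 X2 k2]] := exec_cput E1 la eu1 (erefl : eval m1 (Const 1) = 1) isT.
set st1 := putg s a _ 1 in E2.
have v1 : vs st1 = vs s by exact: vs_putg.
have ev2 := ixP m2 st1 v wv E2 (fun j _ => congr1 (fun f => f j) v1).
pose y := if ixv s v < n then ar st1 a (ixv s v) else 0.
have ly : y <= n.+1 by rewrite /y; case: ifP => // li; apply: (enc_ale E2).
have ey := eval_eread E2 la ev2.
have X3 := exec_store E2 (erefl : eval m2 (Const 4) = 4) ey s4 ly erefl.
set m3 := set_nth 0 m2 4 _ in X3; have E3 : enc m3 st1 by apply: enc_scratch.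
have ev3 := ixP m3 st1 v wv E3 (fun j _ => congr1 (fun f => f j) v1).
have [m4 [E4 X4 k4]] := exec_cput E3 la ev3 (erefl : eval m3 (Const 0) = 0) isT.
set st2 := putg st1 a _ 0 in E4.
have v2 : vs st2 = vs s by rewrite /st2 vs_putg.
have ea4 : eval m4 (eaddr a (Const 0)) = abase + a * n.
  by rewrite /= (enc_n E4) addn0.
have X5 := exec_query b E4 ea4 (erefl : eval m4 (Const (avar k)) = avar k) (avar_lt lk).
rewrite (set_at_enc E4 la) in X5.
have eset : aset st2 a = (aset s a :|: sing (ixv s u)) :\: sing (ixv s v).
  by rewrite aset_put0 aset_put1.
rewrite eset in X5; set r := orc b _ in X5; set m5 := set_nth 0 m4 _ _ in X5.
have E5 : enc m5 (setv st2 k r).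
  by apply: enc_setv => //; case: (r).
have v5 j : j != k -> vs (setv st2 k r) j = vs s j.
  by move=> ne; rewrite /= /upd (negPf ne) v2.
have m54 : eval m5 (Read (Const 4)) = y.
  by rewrite /= nth_set_nth /= k4 // nth_set_nth.
have [m6 [E6 X6 k6]] := exec_cput E5 la (ixP m5 _ v wv E5 v5) m54 ly.
have m63 : eval m6 (Read (Const 3)) = x.
  by rewrite /= k6 // nth_set_nth /= k4 // nth_set_nth /= k2.
have v6 j : j != k -> vs (putg (setv st2 k r) a (ixv s v) y) j = vs s j.
  by move=> ne; rewrite vs_putg v5.
have [m7 [E7 X7 _]] := exec_cput E6 la (ixP m6 _ u wu E6 v6) m63 lx.
exists m7.
  (* The two entries are restored in reverse order. If [u] and [v] denote the same element, the
     value saved for [v] is the modified 1, and the later write of [x] still restores the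
     original. *)
  apply: enc_ext E7 => [j lj|c j lc lj]; first by rewrite vs_putg vs_putg /= /upd v2.
  rewrite ar_putg // ar_putg // [ar (setv _ _ _)]/= ar_putg // ar_putg // /x /y.
  case: (c =P a) => [->|//] /=; case: (j =P ixv s u) => [<-|ne]; first by rewrite lj.
  case: (j =P ixv s v) => [<-|//]; rewrite lj ar_putg // eqxx /=.
  by case: eqP.
have X := exec_cat X1 (exec_cat X2 (exec_cat X3 (exec_cat X4 (exec_cat X5 (exec_cat X6 X7))))).
apply: exec_le X _; rewrite /cput_time /=.
have eo o : expr_time (eix o) = 2 by case: o.
by rewrite !eo /=; lia.
Qed.

Theorem comp_exec c m s : wf c -> enc m s ->
  exists2 m', enc m' (sem c s) & exec (comp c) m (tc c) m'.
Proof.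
elim: c m s => [|p IHp q IHq|k e|a k e|e p IHp q IHq|b k p IH|b a u v k] m s.
- by move=> _ E; exists m => //; apply: exec_nil.
- move=> /andP[wp wq] E; have [m1 E1 X1] := IHp _ _ wp E.
  by have [m2 E2 X2] := IHq _ _ wq E1; exists m2 => //; apply: exec_cat X1 X2.
- move=> /andP[lk we] E; exists (set_nth 0 m (avar k) (ev s e)).
    by apply: enc_setv => //; apply: ev_le E we.
  apply: (exec_store E) => //; rewrite ?(eval_compe E) //; first exact: avar_lt.
  exact: ev_le E we.
- move=> /and3P[la lk we] E.
  have ek : eval m (evar k) = vs s k by rewrite /= (enc_v E).
  by have [m' [E' X _]] := exec_cput E la ek (eval_compe E we) (ev_le E we); exists m'.
- move=> /and3P[we wp wq] E; rewrite [sem _ _]/=.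
  have [m' E' X] : exists2 m', enc m' (if ev s e != 0 then sem p s else sem q s)
      & exec (if ev s e != 0 then comp p else comp q) m (tc p + tc q) m'.
    case: ifP => _; [have [m' E' X] := IHp _ _ wp E | have [m' E' X] := IHq _ _ wq E];
      exists m' => //; apply: exec_le X _; [exact: leq_addr | exact: leq_addl].
  by exists m' => //; apply: (exec_if E); rewrite (eval_compe E).
- move=> /and3P[lk nk wp] E; rewrite [sem _ _]/=; set g := (X in foldl X).
  pose w := While (Bin Ltb (evar k) (Bin Add eN (Const b)))
    (comp p ++ [:: Store (Const (avar k)) (Bin Add (evar k) (Const 1))]).
  (* Here [j] passes are left. Memory already holds the counter of the coming pass, which [sem] sets
     only when that pass starts; hence [setv s0 k i]. *)
  have loop j i s0 m0 : i + j = n + b -> enc m0 (setv s0 k i) ->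
      exists2 m', enc m' (setv (foldl g s0 (iota i j)) k (n + b))
        & exec [:: w] m0 (j * (14 + tc p) + 8) m'.
    elim: j i s0 m0 => [|j IHj] i s0 m0 e E0.
      rewrite addn0 in e; rewrite -e; exists m0 => //.
      apply: exec_le (exec_while0 _ E0 _) _ => //.
      by rewrite /= (enc_n E0) (enc_v E0) // /= /upd eqxx e ltnn.
    have lti : i < n + b by rewrite -e addnS ltnS leq_addr.
    have [m1 E1 X1] := IH _ _ wp E0; rewrite -/(g s0 i) in E1.
    have vk : vs (g s0 i) k = i by rewrite sem_vs //= /upd eqxx.
    have li : i.+1 <= n.+1.
      by apply: leq_trans lti _; rewrite -addn1 leq_add2l; case: (b).
    have ek : eval m1 (Bin Add (evar k) (Const 1)) = i.+1.
      by rewrite /= (enc_v E1) // vk addn1.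
    have X2 := exec_store E1 (erefl : eval m1 (Const (avar k)) = avar k) ek (avar_lt lk) li erefl.
    have E2 := enc_setv E1 lk li.
    have [|m' E' X'] := IHj i.+1 (g s0 i) _ _ E2; first by rewrite addSn -addnS.
    exists m' => //; rewrite mulSn.
    have cond : eval m0 (Bin Ltb (evar k) (Bin Add eN (Const b))) != 0.
      rewrite /= (enc_n E0) (enc_v E0) //= /upd eqxx.
      by rewrite lti.
    have X := exec_cat (exec_cat X1 X2) X'.
    apply: exec_le (exec_while E0 cond X) _.
    by rewrite /=; lia.
  have E0 : enc (set_nth 0 m (avar k) 0) (setv s k 0) by apply: enc_setv.
  have [|m' E' X'] := loop (n + b) 0 s _ _ E0; first by rewrite add0n.
  exists m' => //=.
  by apply: exec_cat (exec_store E _ _ _ _ _) X' => //; apply: avar_lt.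
by move=> w E; apply: exec_test.
Qed.

(** Sequencing adds weights; a loop multiplies the cost by at most [n.+1] and so adds one power.
    Since the power times [Q] is positive, constant overheads are absorbed into the weight. *)
Lemma tc_le c : 0 < Q -> tc c <= weight c * (n.+1 ^ depth c * Q).
Proof.
clear leW => Q0; have pos d : 0 < n.+1 ^ d * Q by rewrite muln_gt0 expn_gt0.
have mono d d' : d <= d' -> n.+1 ^ d * Q <= n.+1 ^ d' * Q.
  by move=> le; rewrite leq_mul2r leq_pexp2l ?orbT.
elim: c => //= [p IHp q IHq|k e|a k e|e p IHp q IHq|b k p IH|b a u v k].
- rewrite mulnDl leq_add //; [apply: leq_trans IHp _ | apply: leq_trans IHq _];
    by rewrite leq_mul2l mono ?orbT // ?leq_maxl ?leq_maxr.
- by rewrite expn0 mul1n leq_pmulr.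
- by rewrite expn0 mul1n leq_pmulr.
- rewrite mulnDl leq_add ?leq_pmulr //.
  rewrite mulnDl leq_add //; [apply: leq_trans IHp _ | apply: leq_trans IHq _];
    by rewrite leq_mul2l mono ?orbT // ?leq_maxl ?leq_maxr.
- rewrite expnS -mulnA; set X := _ ^ _ * Q in IH *.
  have X0 : 0 < X by exact: pos.
  have le1 : n + b <= n.+1 by rewrite -addn1 leq_add2l; case: (b).
  have le2 : (n + b) * (14 + tc p) <= n.+1 * (14 + weight p * X).
    by rewrite leq_mul // leq_add2l.
  have le3 : n.+1 <= n.+1 * X by rewrite leq_pmulr.
  have -> : (weight p + 50) * (n.+1 * X) = n.+1 * (weight p * X) + 50 * (n.+1 * X).
    by rewrite mulnDl mulnCA.
  move: le2; rewrite mulnDr; set A := n.+1 * (_ * X); lia.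
rewrite expn0 mul1n; lia.
Qed.

End Correct.
End Semantics.

(** * The enumeration program *)

Notation "p ;; q" := (CSeq p q) (at level 60, right associativity).

(* J is the current solution, P the one whose kids are searched, K a candidate
   kid and B the least kid found so far.  X is the set being augmented, F the
   frozen elements, D the distances to a sink, and A the intersection with F
   prescribed to a maximum set. *)
Notation aJ := 0 (only parsing).
Notation aP := 1 (only parsing).
Notation aX := 2 (only parsing).
Notation aF := 3 (only parsing).
Notation aD := 4 (only parsing).
Notation aB := 5 (only parsing).
Notation aK := 6 (only parsing).
Notation aA := 7 (only parsing).

Notation v_d := 0 (only parsing).
Notation v_v := 1 (only parsing).
Notation v_u := 2 (only parsing).
Notation v_t1 := 3 (only parsing).
Notation v_t2 := 4 (only parsing).
Notation v_sf := 5 (only parsing).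
Notation v_st := 6 (only parsing).
Notation v_pf := 7 (only parsing).
Notation v_pv := 8 (only parsing).
Notation v_i := 9 (only parsing).
Notation v_cnt := 10 (only parsing).
Notation v_nu := 11 (only parsing).
Notation v_done := 12 (only parsing).
Notation v_ex := 13 (only parsing).
Notation v_pr := 14 (only parsing).
Notation v_q := 15 (only parsing).
Notation v_e := 16 (only parsing).
Notation v_f1 := 17 (only parsing).
Notation v_f2 := 18 (only parsing).
Notation v_found := 19 (only parsing).
Notation v_lt := 20 (only parsing).
Notation v_eq := 21 (only parsing).
Notation v_ok := 22 (only parsing).
Notation v_r1 := 23 (only parsing).
Notation v_r2 := 24 (only parsing).
Notation v_x := 25 (only parsing).
Notation v_pos := 26 (only parsing).
Notation v_posf := 27 (only parsing).
Notation v_rt := 28 (only parsing).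
Notation v_h := 29 (only parsing).

Definition EOr e f := ENot (EAnd (ENot e) (ENot f)).
Definition CGuard e b a u v k := CIf e (CTest b a u v k) (CSet k (EB false)).
Definition CWhen e p := CIf e p CSkip.
Definition CEach k p := CFor false k p.

Definition cCopy a b := CEach v_i (CPut a v_i (EA b v_i)).
Definition cClear a := CEach v_i (CPut a v_i (EB false)).

Definition cCount a :=
  CSet v_cnt (EB false) ;;
  CEach v_i (CWhen (EA a v_i) (CSet v_cnt (ES (EV v_cnt)))).

Definition cCmp a b :=
  CSet v_lt (EB false) ;; CSet v_eq (EB true) ;;
  CEach v_i (
    CSet v_lt (EOr (EV v_lt) (EAnd (EV v_eq) (EAnd (ENot (EA a v_i)) (EA b v_i)))) ;;
    CSet v_eq (EAnd (EV v_eq) (EEq (ENot (EA a v_i)) (ENot (EA b v_i))))).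

Definition cDist0 :=
  CEach v_u (
    CGuard (EAnd (ENot (EA aX v_u)) (ENot (EA aF v_u))) true aX (Some v_u) None v_t1 ;;
    CPut aD v_u (EV v_t1)).

Definition cArc :=
  CIf (EA aX v_v)
    (CGuard (EAnd (ENot (EA aX v_u)) (EAnd (ENot (EA aF v_u)) (ENot (EA aF v_v))))
       true aX (Some v_u) (Some v_v) v_t1)
    (CGuard (EAnd (EA aX v_u) (EAnd (ENot (EA aF v_u)) (ENot (EA aF v_v))))
       false aX (Some v_v) (Some v_u) v_t1).

Definition cRound :=
  CEach v_u (CWhen (ENot (EA aD v_u)) (
    CSet v_h (EB false) ;;
    CEach v_v (CWhen (EEq (EA aD v_v) (ES (EV v_d))) (
      cArc ;; CSet v_h (EOr (EV v_h) (EV v_t1)))) ;;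
    CWhen (EV v_h) (CPut aD v_u (ES (ES (EV v_d)))))).

Definition cDist := cDist0 ;; CEach v_d cRound.

Definition cStart :=
  CSet v_sf (EB false) ;;
  CEach v_u (
    CGuard (EAnd (EA aD v_u) (EAnd (ENot (EA aX v_u)) (ENot (EA aF v_u))))
      false aX (Some v_u) None v_t1 ;;
    CWhen (EAnd (EV v_t1) (EOr (ENot (EV v_sf)) (ELt (EA aD v_u) (EA aD v_st))))
      (CSet v_sf (EB true) ;; CSet v_st (EV v_u))).

Definition cPivot :=
  CSet v_pf (EB false) ;;
  CEach v_v (
    CGuard (EAnd (EEq (ES (EA aD v_v)) (EA aD v_st)) (EAnd (EA aX v_v) (ENot (EA aF v_v))))
      true aX (Some v_st) (Some v_v) v_t1 ;;
    CWhen (EAnd (EV v_t1) (ENot (EV v_pf))) (CSet v_pf (EB true) ;; CSet v_pv (EV v_v))).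

Definition cStep :=
  cDist ;; cStart ;;
  CWhen (EV v_sf) (
    CIf (EEq (EA aD v_st) (EB true)) (CPut aX v_st (EB true))
      (cPivot ;; CPut aX v_st (EB true) ;; CPut aX v_pv (EB false))).

Definition cComplete :=
  CEach v_u (
    CTest false aX (Some v_u) None v_t1 ;; CTest true aX (Some v_u) None v_t2 ;;
    CWhen (EAnd (EV v_t1) (EV v_t2)) (CPut aX v_u (EB true))).

Definition cCommon a :=
  CTest false a None None v_t1 ;; CTest true a None None v_t2.

Definition cSolution :=
  CSet v_h (EB false) ;;
  CEach v_u (
    CGuard (ENot (EA aK v_u)) false aK (Some v_u) None v_t1 ;;
    CGuard (EV v_t1) true aK (Some v_u) None v_t2 ;;
    CSet v_h (EOr (EV v_h) (EV v_t2))) ;;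
  cCount aK ;; cCommon aK ;;
  CSet v_ok (EAnd (EAnd (EAnd (EV v_t1) (EV v_t2)) (ENot (EV v_h))) (ETau (EV v_cnt))).

Definition cParent a := cClear aF ;; cCopy aX a ;; cStep ;; cComplete.

Definition cIsKid :=
  cSolution ;;
  CWhen (EV v_ok) (cParent aK ;; cCmp aX aP ;; CSet v_ok (EAnd (EV v_sf) (EV v_eq))).

Definition cUpdate :=
  cCmp aJ aK ;; CSet v_ok (EAnd (EV v_ok) (EOr (ENot (EV v_ex)) (EV v_lt))) ;;
  cCmp aK aB ;; CSet v_ok (EAnd (EV v_ok) (EOr (ENot (EV v_found)) (EV v_lt))) ;;
  CWhen (EV v_ok) (cCopy aB aK ;; CSet v_found (EB true)).

Definition cCandidate :=
  (cCopy aK aP ;; CPut aK v_e (EB true) ;; CPut aK v_f1 (EB false) ;; CPut aK v_f2 (EB false)) ;;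
  cIsKid ;; cUpdate.

(** Triples yield children in no useful order, possibly repeatedly, so each scan keeps only the
    least child above the bound. This needs one array instead of a list. *)
Definition cScan :=
  CSet v_found (EB false) ;;
  CEach v_e (CEach v_f1 (CEach v_f2 cCandidate)).

(** Two nested loops of [n + 1] passes make the [(n + 1)^2] iterations of [maximize]. *)
Definition cMaximize := CFor true v_r1 (CFor true v_r2 cStep).

Definition cExtendable :=
  cCopy aX aA ;; cCommon aX ;;
  CIf (EAnd (EV v_t1) (EV v_t2))
    (cMaximize ;; cCount aX ;; CSet v_ok (EEq (EV v_cnt) (EV v_nu)))
    (CSet v_ok (EB false)).

Definition cGreedy :=
  CEach v_x (CIf (EA aF v_x) CSkip (
    CPut aF v_x (EB true) ;; cExtendable ;;
    CIf (EV v_ok) CSkip (CPut aA v_x (EB true)))).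

Definition cFlip z :=
  CEach v_i (
    CPut aF v_i (ENot (ELt (EV z) (EV v_i))) ;;
    CPut aA v_i (EOr (EEq (EV v_i) (EV z)) (EAnd (EA aJ v_i) (ELt (EV v_i) (EV z))))).

Definition cFlippable :=
  CSet v_posf (EB false) ;;
  CEach v_x (CIf (EA aJ v_x) CSkip (
    cFlip v_x ;; cExtendable ;;
    CWhen (EV v_ok) (CSet v_posf (EB true) ;; CSet v_pos (EV v_x)))).

Definition cNextRoot := cFlippable ;; CWhen (EV v_posf) (cFlip v_pos ;; cGreedy).

Definition cInit :=
  cMaximize ;; cCount aX ;; CSet v_nu (EV v_cnt) ;;
  CIf (ETau (EV v_nu)) (cGreedy ;; cCopy aJ aA) (CSet v_done (EB true)).

Definition cBody :=
  CSet v_rt (EB false) ;; CSet v_q (EEq (EV v_ex) (EV v_pr)) ;;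
  CIf (EV v_ex)
    (cParent aJ ;; cCopy aP aX ;; CSet v_rt (ENot (EV v_sf)))
    (cCopy aP aJ) ;;
  CIf (EV v_rt)
    (cNextRoot ;;
     CIf (EV v_posf) (cCopy aJ aA ;; CSet v_ex (EB false) ;; CSet v_pr (EV v_q))
       (CSet v_done (EB true)))
    (cScan ;;
     CIf (EV v_found) (cCopy aJ aB ;; CSet v_ex (EB false) ;; CSet v_pr (EV v_q))
       (cCopy aJ aP ;; CSet v_ex (EB true) ;; CSet v_pr (ENot (EV v_q)))).

(** * Specification of the program *)

Section Loops.
Variables (T : finType) (orc : bool -> pred {set T}) (tau : int).
Local Notation n := #|T|.
Local Notation sem := (sem orc tau).
Local Notation ev := (ev T tau).
Local Notation aset := (aset T).
Implicit Types (s : store) (x y : T).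

(** A frame condition read off the syntax, so that loop invariants need to mention only what
    changes. *)
Definition same c s s0 := (forall j, j \notin modv c -> vs s j = vs s0 j)
  /\ (forall a, a \notin moda c -> ar s a = ar s0 a).

Lemma same_sem c s : same c (sem c s) s.
Proof. by split=> [j|a]; [apply: sem_vs | apply: sem_ar]. Qed.

Lemma same_aset c s s0 a : same c s s0 -> a \notin moda c -> aset s a = aset s0 a.
Proof. by case=> _ h na; apply/eq_aset/h. Qed.

Lemma semSeq p q s : sem (CSeq p q) s = sem q (sem p s). Proof. by []. Qed.
Lemma semSet k e s : sem (CSet k e) s = setv s k (ev s e). Proof. by []. Qed.
Lemma semPut a k e s : sem (CPut a k e) s = putg T s a (vs s k) (ev s e).
Proof. by []. Qed.
Lemma semIf e p q s : sem (CIf e p q) s = if ev s e != 0 then sem p s else sem q s.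
Proof. by []. Qed.
Lemma semWhen e p s : sem (CWhen e p) s = if ev s e != 0 then sem p s else s.
Proof. by []. Qed.
Lemma semIfb (b : bool) e p q s : ev s e = b ->
  sem (CIf e p q) s = if b then sem p s else sem q s.
Proof. by rewrite semIf => ->; case: b. Qed.
Lemma semWhenb (b : bool) e p s : ev s e = b ->
  sem (CWhen e p) s = if b then sem p s else s.
Proof. by rewrite semWhen => ->; case: b. Qed.

Lemma vs_setv s k v j : vs (setv s k v) j = if j == k then v else vs s j.
Proof. by []. Qed.
Lemma ar_setv s k v : ar (setv s k v) = ar s. Proof. by []. Qed.
Lemma aset_setv s k v a : aset (setv s k v) a = aset s a. Proof. by []. Qed.

Lemma sing_rk x : sing T (rk x) = [set x].
Proof. by apply/setP => y; rewrite !inE (inj_eq (@rk_inj _)). Qed.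

Lemma sing_n : sing T n = set0.
Proof. by apply/setP => y; rewrite !inE ltn_eqF // rk_lt. Qed.

Lemma semTest0 b a k s : sem (CTest b a None None k) s = setv s k (orc b (aset s a)).
Proof. by rewrite /= !sing_n setU0 setD0. Qed.

Lemma semTest1 b a u k s x : vs s u = rk x ->
  sem (CTest b a (Some u) None k) s = setv s k (orc b (x |: aset s a)).
Proof. by move=> e; rewrite /= e sing_n sing_rk setD0 setUC. Qed.

Lemma semTest2 b a u v k s x y : vs s u = rk x -> vs s v = rk y ->
  sem (CTest b a (Some u) (Some v) k) s = setv s k (orc b ((x |: aset s a) :\ y)).
Proof. by move=> eu ev; rewrite /= eu ev !sing_rk setUC. Qed.

Lemma semGuard1 e b a u k s x : vs s u = rk x ->
  sem (CGuard e b a (Some u) None k) s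
  = setv s k ((ev s e != 0) && orc b (x |: aset s a)).
Proof. by move=> eu; rewrite /CGuard semIf (semTest1 _ _ _ eu) semSet; case: ifP. Qed.

Lemma semGuard2 e b a u v k s x y : vs s u = rk x -> vs s v = rk y ->
  sem (CGuard e b a (Some u) (Some v) k) s
  = setv s k ((ev s e != 0) && orc b ((x |: aset s a) :\ y)).
Proof. by move=> eu ev; rewrite /CGuard semIf (semTest2 _ _ _ eu ev) semSet; case: ifP. Qed.

Lemma ev_EA s a k x : vs s k = rk x -> ev s (EA a k) = ar s a (rk x).
Proof. by move=> /= ->; rewrite rk_lt. Qed.

Lemma in_aset s a x : (x \in aset s a) = (ar s a (rk x) != 0).
Proof. by rewrite inE. Qed.

Lemma ar_putx s a x v b y : ar (putg T s a (rk x) v) b (rk y)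
  = if (b == a) && (y == x) then v else ar s b (rk y).
Proof. by rewrite ar_putg ?rk_lt // (inj_eq (@rk_inj _)). Qed.

Lemma aset_putx s a x v :
  aset (putg T s a (rk x) v) a = if v != 0 then x |: aset s a else aset s a :\ x.
Proof.
apply/setP => y; rewrite in_aset ar_putx eqxx /=.
by case: (boolP (v != 0)) => v0; rewrite !inE; case: (y == x); rewrite ?v0 //; apply/negbTE.
Qed.

Lemma aset_put_other s a i v b : b != a -> aset (putg T s a i v) b = aset s b.
Proof.
by move=> ne; apply/setP => y; rewrite !inE ar_putg ?rk_lt // (negPf ne).
Qed.

Lemma for_nat (P : nat -> store -> Prop) (b : bool) k p s0 : P 0 s0 ->
  (forall i s, i < n + b -> same (CFor b k p) s s0 -> P i s ->
     P i.+1 (sem p (setv s k i))) ->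
  exists s, [/\ sem (CFor b k p) s0 = setv s k (n + b),
    same (CFor b k p) s s0 & P (n + b) s].
Proof.
move=> P0 Pstep; set g := fun s i => sem p (setv s k i).
suff inv i : i <= n + b ->
    same (CFor b k p) (foldl g s0 (iota 0 i)) s0 /\ P i (foldl g s0 (iota 0 i)).
  by exists (foldl g s0 (iota 0 (n + b))); have [] := inv _ (leqnn _).
elim: i => [|i IH] lei; first by split=> //; split.
have [sm Pi] := IH (ltnW lei); rewrite -addn1 iotaD foldl_cat /= add0n addn1.
set s := foldl _ _ _ in sm Pi *; split; last exact: Pstep.
case: sm => sv sa; split=> [j|a] h.
  rewrite /g sem_vs; last by move: h; rewrite inE negb_or => /andP[].
  by rewrite vs_setv; case: eqP h => [->|_ h]; rewrite ?mem_head // sv.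
by rewrite /g sem_ar // ar_setv sa.
Qed.

Lemma for_each (P : seq T -> store -> Prop) k p s0 : P [::] s0 ->
  (forall pre x post s, enum T = pre ++ x :: post -> same (CEach k p) s s0 ->
     P pre s -> P (rcons pre x) (sem p (setv s k (rk x)))) ->
  exists s, [/\ sem (CEach k p) s0 = setv s k n,
    same (CEach k p) s s0 & P (enum T) s].
Proof.
move=> P0 Pstep.
have [|i s lti sm|s] := @for_nat (fun i => P (take i (enum T))) false k p s0.
- by rewrite take0.
- rewrite addn0 in lti; have [x ex] := rk_surj lti; move=> Pi.
  have xi : nth x (enum T) i = x by rewrite -ex nth_enum_rank.
  have lti' : i < size (enum T) by rewrite -cardE.
  have e : enum T = take i (enum T) ++ x :: drop i.+1 (enum T).
    by rewrite -{1}(cat_take_drop i (enum T)) (drop_nth x) // xi.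
  by rewrite (take_nth x) // xi; have := Pstep _ x _ s e sm Pi; rewrite ex.
by rewrite addn0 take_oversize ?cardE // => h; exists s.
Qed.

Lemma for_fold (A : Type) (R : A -> store -> Prop) g a0 k p s0 : R a0 s0 ->
  (forall a x s, same (CEach k p) s s0 -> R a s -> R (g a x) (sem p (setv s k (rk x)))) ->
  exists s, [/\ sem (CEach k p) s0 = setv s k n,
    same (CEach k p) s s0 & R (foldl g a0 (enum T)) s].
Proof.
move=> R0 Rstep; apply: (for_each (P := fun pre => R (foldl g a0 pre))) => //.
by move=> pre x post s _ sm Rp; rewrite foldl_rcons; apply: Rstep.
Qed.

(** The array is updated in place, so a pass may meet old and new entries; it may rely only on each
    being one of the two, and on its own entry being old. *)
Lemma for_map a (f : T -> nat) k p s0 :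
  (forall x s, same (CEach k p) s s0 ->
     (forall y, ar s a (rk y) = f y \/ ar s a (rk y) = ar s0 a (rk y)) ->
     ar s a (rk x) = ar s0 a (rk x) ->
     forall y, ar (sem p (setv s k (rk x))) a (rk y) = if y == x then f x else ar s a (rk y)) ->
  forall y, ar (sem (CEach k p) s0) a (rk y) = f y.
Proof.
move=> step.
pose P (pre : seq T) s := forall y, ar s a (rk y) = if y \in pre then f y else ar s0 a (rk y).
have [||s [-> _ Pe] y] := @for_each P k p s0 => //.
  move=> pre x post s e sm Pp y; rewrite step //.
  - rewrite mem_rcons inE; case: eqP => [->|_] //=.
  - by move=> z; rewrite Pp; case: ifP => _; [left | right].
  rewrite Pp ifN //; have := enum_uniq T; rewrite e cat_uniq /= negb_or.
  by case/and3P=> _ /andP[].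
by rewrite ar_setv Pe mem_enum.
Qed.

Lemma for_exists v (f : pred T) k p s0 : v != k -> vs s0 v = 0 ->
  (forall x s (b : bool), same (CEach k p) s s0 -> vs s v = b ->
     vs (sem p (setv s k (rk x))) v = b || f x) ->
  vs (sem (CEach k p) s0) v = [exists x, f x] :> nat.
Proof.
move=> ne v0 step.
have [||s [-> _ Pe]] := @for_each (fun pre s => vs s v = has f pre :> nat) k p s0.
- by [].
- move=> pre x post s e sm Pp; by rewrite (step _ _ _ sm Pp) has_rcons orbC.
rewrite vs_setv (negPf ne) Pe; congr nat_of_bool; apply/hasP/existsP => -[x].
  by exists x.
by move=> fx; exists x; rewrite ?mem_enum.
Qed.

End Loops.

Arguments sem : simpl never.

(** * Copying, counting and comparing sets *)

Section Basic.
Variables (T : finType) (orc : bool -> pred {set T}) (tau : int).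
Local Notation n := #|T|.
Local Notation sem := (sem orc tau).
Local Notation ev := (ev T tau).
Local Notation aset := (aset T).
Implicit Types (s : store) (x y : T).

Lemma sem_copy a b s : b != a -> aset (sem (cCopy a b) s) a = aset s b.
Proof.
move=> ne; apply/setP => x; rewrite !in_aset /cCopy.
rewrite (@for_map _ _ _ a (fun x => ar s b (rk x))) // => {}x s' sm _ _ y.
by rewrite semPut vs_setv ar_putx  (@ev_EA _ _ _ _ _ x) // eqxx ar_setv sm.2 // inE.
Qed.

Lemma sem_clear a s : aset (sem (cClear a) s) a = set0.
Proof.
apply/setP => x; rewrite !in_aset /cClear inE.
rewrite (@for_map _ _ _ a (fun=> 0)) // => {}x s' sm _ _ y.
by rewrite semPut vs_setv ar_putx eqxx.
Qed.

Lemma sem_count a s : vs (sem (cCount a) s) v_cnt = #|aset s a|.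
Proof.
have -> : #|aset s a| = count (mem (aset s a)) (enum T).
  by rewrite cardE enumT -size_filter.
rewrite /cCount semSeq semSet.
have [||s' [-> sm e']] // := @for_each T orc tau
  (fun pre s' => vs s' v_cnt = count (mem (aset s a)) pre) v_i
  (CWhen (EA a v_i) (CSet v_cnt (ES (EV v_cnt)))) (setv s v_cnt (ev s (EB false))) _ _.
move=> pre x post s' e sm Pp; rewrite semWhen  (@ev_EA _ _ _ _ _ x) // ar_setv sm.2 // ar_setv.
  rewrite -cats1 count_cat /= addn0 in_aset; case: ifP => _; last by rewrite addn0.
  rewrite semSet vs_setv /= /upd /= Pp.
  (* The successor saturates only at [n.+1], which the count of a prefix does not reach. *)
  suff -> : count (mem (aset s a)) pre < n.+1 by [].
  by rewrite ltnS (leq_trans (count_size _ _)) // cardE e size_cat leq_addr.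
Qed.

Lemma ltn_double_add A B (a b : bool) :
  (A.*2 + a < B.*2 + b) = (A < B) || [&& A == B, ~~ a & b].
Proof. by case: a; case: b => /=; lia. Qed.

Lemma eqn_double_add A B (a b : bool) :
  (A.*2 + a == B.*2 + b) = (A == B) && (a == b).
Proof. by case: a; case: b => /=; lia. Qed.

(** Codes may exceed a word, so they are compared digit by digit from the leading one: the flags
    tell whether the prefix read is already smaller, or still equal. *)
Lemma sem_cmp a b s :
  vs (sem (cCmp a b) s) v_lt = (code (aset s a) < code (aset s b)) /\
  vs (sem (cCmp a b) s) v_eq = (aset s a == aset s b).
Proof.
rewrite /cCmp !semSeq !semSet.
set s1 := setv _ v_eq _; set p := _ ;; _.
have [||s' [-> sm [e1 e2]]] // := @for_each T orc tau
  (fun pre s' => vs s' v_lt = (pcode (aset s a) pre < pcode (aset s b) pre) :> nat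
    /\ vs s' v_eq = (pcode (aset s a) pre == pcode (aset s b) pre) :> nat) v_i p s1 _ _.
  move=> pre x post s' _ sm [Pl Pe].
  have aE c : ar s' c = ar s c by rewrite sm.2.
  rewrite /p semSeq !semSet !vs_setv /= /upd /= rk_lt !aE Pl Pe !pcode_rcons !in_aset.
  rewrite ltn_double_add eqn_double_add.
  case: (pcode (aset s a) pre < pcode (aset s b) pre);
  case: (pcode (aset s a) pre == pcode (aset s b) pre);
  by case: (ar s a (rk x) =P 0) => _ /=; case: (ar s b (rk x) =P 0) => _.
split; first by rewrite vs_setv e1.
by rewrite vs_setv e2 -(inj_eq (@code_inj T)).
Qed.

End Basic.

(** * Distances, augmenting steps and completion in the program *)

Section Augment.
Variables (T : finType) (M1 M2 : matroid T) (tau : int).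
Local Notation n := #|T|.
Local Notation sem := (sem (oracles M1 M2) tau).
Local Notation ev := (ev T tau).
Local Notation aset := (aset T).
Local Notation common := (common_indep M1 M2).
Local Notation dist := (dist M1 M2).
Local Notation arc := (arc M1 M2).
Implicit Types (s : store) (x y u v : T).

Definition enc_opt s f k (o : option T) :=
  if o is Some x then vs s f = 1 /\ vs s k = rk x else vs s f = 0.

Lemma sem_dist0 s y :
  ar (sem cDist0 s) aD (rk y) = snk M2 (aset s aF) (aset s aX) y.
Proof.
rewrite /cDist0; apply: (for_map (f := fun y => snk M2 (aset s aF) (aset s aX) y)).
move=> x s' sm _ _ {}y; rewrite semSeq (@semGuard1 _ _ _ _ _ _ _ _ _ x) //.
rewrite semPut !vs_setv ar_putx eqxx /= /upd /= rk_lt.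
rewrite aset_setv !(same_aset _ sm) // /snk !in_aset !negbK.
by rewrite (sm.2 aX isT) (sm.2 aF isT) !eqb0 !negbK andbA.
Qed.

Lemma sem_arc s u v : vs s v_u = rk u -> vs s v_v = rk v ->
  sem cArc s = setv s v_t1 (arc (aset s aF) (aset s aX) u v).
Proof.
move=> eu ev; rewrite /cArc semIf (semGuard2 _ _ _ _ _ _ eu ev) (semGuard2 _ _ _ _ _ _ ev eu).
rewrite /= eu ev !rk_lt /arc !in_aset.
case: (ar s aX (rk v)) => [|i]; case: (ar s aX (rk u)) => [|j];
case: (ar s aF (rk v)) => [|k]; case: (ar s aF (rk u)) => [|l] //=.
Qed.

Lemma sem_round s k : k < n -> vs s v_d = k ->
  (forall y, ar s aD (rk y) = dist (aset s aF) (aset s aX) k y) ->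
  forall y, ar (sem cRound s) aD (rk y) = dist (aset s aF) (aset s aX) k.+1 y.
Proof.
move=> ltk vd D; set F := aset s aF in D *; set I := aset s aX in D *.
rewrite /cRound; apply: for_map => x s' sm D' D'x y.
(* Updating in place is safe: the round turns zeros into [k.+2] only, so the entries equal to [k.+1]
   are those of the previous round. *)
have Dk v : (ar s' aD (rk v) == k.+1) = (dist F I k v == k.+1).
  case: (D' v) => ->; last by rewrite D.
  by rewrite /=; case: (dist F I k v) => //=; case: ifP => //; rewrite eqn_leq ltnn.
rewrite semWhen [ev _ _]/= /upd /= rk_lt D'x D.
case: (dist F I k x =P 0) => [dx|dx] /=; last first.
  by case: eqP => // ->; rewrite D'x D; case: (dist F I k x) dx.
rewrite semSeq semSet semSeq.
set s2 := setv (setv s' v_u (rk x)) v_h _; set inner := CEach v_v _.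
have vh : vs (sem inner s2) v_h =
    [exists v, (dist F I k v == k.+1) && arc F I x v] :> nat.
  apply: for_exists => // v s3 b sm3 eb.
  have e3 : ev (setv s3 v_v (rk v)) (EEq (EA aD v_v) (ES (EV v_d)))
     = (dist F I k v == k.+1) :> nat.
    rewrite /= /upd /= rk_lt (sm3.1 v_d isT) (sm3.2 aD isT) /= /upd /= (sm.1 v_d isT) vd.
    by rewrite ltnS (ltnW ltk) addn1 Dk.
  rewrite (semWhenb _ _ e3); case: (dist F I k v == k.+1); last by rewrite orbF.
  have eu : vs (setv s3 v_v (rk v)) v_u = rk x by rewrite vs_setv (sm3.1 v_u isT).
  rewrite semSeq semSet (sem_arc eu (erefl : vs (setv s3 v_v (rk v)) v_v = rk v)) vs_setv.
  rewrite !aset_setv !(same_aset _ sm3) // !aset_setv !(same_aset _ sm) // -/F -/I.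
  by rewrite /= /upd /= eb; case: (b); case: (arc F I x v).
have vd3 : vs (sem inner s2) v_d = k by rewrite sem_vs // !vs_setv (sm.1 v_d isT).
have vu3 : vs (sem inner s2) v_u = rk x by rewrite sem_vs.
have a3 : ar (sem inner s2) aD = ar s' aD by rewrite sem_ar.
move: (sem inner s2) vh vd3 vu3 a3 => s4 vh vd3 vu3 a3.
rewrite (semWhenb _ _ (vh : ev _ (EV v_h) = _)); case: ifP => ex; last first.
  by rewrite a3; case: eqP => // ->; rewrite D'x D dx.
rewrite semPut vu3 ar_putx eqxx a3 /=.
by rewrite vd3 ltnS (ltnW ltk) addn1 ltnS ltk addn1.
Qed.

Lemma sem_dist s y :
  ar (sem cDist s) aD (rk y) = dist (aset s aF) (aset s aX) n y.
Proof.
rewrite /cDist semSeq; set s0 := sem cDist0 s.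
have aE a : a != aD -> aset s0 a = aset s a by move=> ne; rewrite sem_aset // inE.
have [||s' [-> _ e]] := @for_nat T (oracles M1 M2) tau
  (fun i s' => forall y, ar s' aD (rk y) = dist (aset s aF) (aset s aX) i y) false v_d cRound s0.
- by move=> z; rewrite sem_dist0.
- move=> i s' lti sm D z; rewrite addn0 in lti.
  rewrite (@sem_round _ i) // !aset_setv !(same_aset _ sm) // !aE //.
by rewrite ar_setv e addn0.
Qed.

Lemma sem_start s :
  (forall y, ar s aD (rk y) = dist (aset s aF) (aset s aX) n y) ->
  enc_opt (sem cStart s) v_sf v_st (start M1 M2 (aset s aF) (aset s aX)).
Proof.
move=> D; rewrite /cStart semSeq semSet /start; set d := dist _ _ _ in D *.
set s1 := setv s v_sf _; set p := (X in sem (CEach v_u X)); rewrite /best.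
have [||s' [-> _ e]] := @for_fold T (oracles M1 M2) tau _ (fun o s' => enc_opt s' v_sf v_st o)
  (better (fun u => (d u != 0) && src M1 (aset s aF) (aset s aX) u) d) None v_u p s1.
- by [].
- move=> o x s' sm R.
  rewrite /p semSeq (@semGuard1 _ _ _ _ _ _ _ _ _ x) // aset_setv (same_aset _ sm) // aset_setv.
  set c := (_ && _ : bool) ; have -> : c = (d x != 0) && src M1 (aset s aF) (aset s aX) x.
    rewrite /c /= /upd /= rk_lt !(sm.2 _ isT) /src !in_aset /s1 !ar_setv D.
    by case: (d x); case: (ar s 2 (rk x)); case: (ar s 3 (rk x)).
  rewrite {c} /better; set c := _ && src _ _ _ _.
  set s2 := setv _ v_t1 _.
  have e2 : ev s2 (EAnd (EV v_t1) (EOr (ENot (EV v_sf)) (ELt (EA aD v_u) (EA aD v_st))))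
     = c && (if o is Some v then d x < d v else true).
    rewrite /= /upd /= rk_lt !(sm.2 _ isT).
    case: o R => [v|] /= => [[-> ->]|->]; rewrite ?rk_lt !D; case: (c) => //=.
    by case: (_ < _).
  rewrite (semWhenb _ _ e2); case: ifP => _; last first.
    by case: o R {e2}.
  by rewrite semSeq !semSet.
by case: foldl e.
Qed.

Lemma sem_pivot s v : vs s v_st = rk v -> v \notin aset s aX -> v \notin aset s aF ->
  (forall y, ar s aD (rk y) = dist (aset s aF) (aset s aX) n y) ->
  enc_opt (sem cPivot s) v_pf v_pv (pivot M1 M2 (aset s aF) (aset s aX) v).
Proof.
move=> est vX vF D; rewrite /cPivot semSeq semSet /pivot.
have dP := dist_is_dist M1 M2 (aset s aF) (aset s aX); set d := dist _ _ _ in D dP *.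
set s1 := setv s v_pf _; set p := (X in sem (CEach v_v X)); rewrite /best.
have [||s' [-> _ e]] := @for_fold T (oracles M1 M2) tau _ (fun o s' => enc_opt s' v_pf v_pv o)
  (better (fun w => ((d w).+1 == d v) && arc (aset s aF) (aset s aX) v w) (fun=> 0)) None v_v p s1.
- by [].
- move=> o x s' sm R.
  rewrite /p semSeq (@semGuard2 _ _ _ _ _ _ _ _ _ _ v x) //; last first.
    by rewrite vs_setv (sm.1 v_st isT).
  rewrite aset_setv (same_aset _ sm) // aset_setv.
  set c := (_ && _ : bool); have -> : c = ((d x).+1 == d v) && arc (aset s aF) (aset s aX) v x.
    rewrite /c /arc vF vX (negPf vX) /= /upd /= (sm.1 v_st isT) /= /upd /= est !rk_lt.
    rewrite !(sm.2 _ isT) /s1 /= !in_aset !D ltnS (dist_max dP) addn1.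
    by case: (_ == d v); case: (ar s 2 (rk x)); case: (ar s 3 (rk x)).
  rewrite {c} /better; set c := _ && arc _ _ _ _.
  set s2 := setv _ v_t1 _.
  have e2 : ev s2 (EAnd (EV v_t1) (ENot (EV v_pf)))
     = c && (if o is Some v then 0 < 0 else true).
    rewrite /= /upd /=.
    by case: o R => [w|] /= => [[-> _]|->]; case: (c).
  rewrite (semWhenb _ _ e2); case: ifP => _; last first.
    by case: o R {e2}.
  by rewrite semSeq !semSet.
by case: foldl e.
Qed.

Lemma sem_step s : common (aset s aX) ->
  vs (sem cStep s) v_sf = isSome (augstep M1 M2 (aset s aF) (aset s aX)) /\
  aset (sem cStep s) aX = odflt (aset s aX) (augstep M1 M2 (aset s aF) (aset s aX)).
Proof.
move=> cX; have := augstepP (aset s aF) cX; rewrite /cStep 2!semSeq.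
have F1 : aset (sem cDist s) aF = aset s aF by rewrite sem_aset.
have X1 : aset (sem cDist s) aX = aset s aX by rewrite sem_aset.
have := sem_dist s; rewrite -F1 -X1; move: (sem cDist s) => s1 D.
have a2 a : ar (sem cStart s1) a = ar s1 a by rewrite sem_ar.
have A2 a : aset (sem cStart s1) a = aset s1 a by apply/eq_aset/a2.
have := sem_start D; move: (sem cStart s1) a2 A2 => s2 a2 A2.
rewrite /augstep; case est: (start _ _ _ _) => [v|]; rewrite [enc_opt _ _ _ _]/=; last first.
  move=> sf _; have e0 : ev s2 (EV v_sf) = false by [].
  by rewrite (semWhenb _ _ e0) A2.
case=> sf st; have e1 : ev s2 (EV v_sf) = true by [].
rewrite (semWhenb _ _ e1).
have [dv [vX vF]] : dist (aset s1 aF) (aset s1 aX) n v != 0 /\ v \notin aset s1 aX /\ v \notin aset s1 aF.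
  move: est; rewrite /start; case: bestP => // v' /andP[dv /and3P[h1 h2 _]] _ [<-].
  by [].
have eD : ev s2 (EEq (EA aD v_st) (EB true)) = (dist (aset s1 aF) (aset s1 aX) n v == 1).
  by rewrite /= st rk_lt a2 D.
rewrite (semIfb _ _ _ eD); case: ifP => [_ _|_].
  rewrite semPut vs_putg sf; split=> //.
  by rewrite st aset_putx A2.
have D2 y : ar s2 aD (rk y) = dist (aset s2 aF) (aset s2 aX) n y by rewrite a2 !A2.
rewrite [sem (cPivot ;; _) _]semSeq.
have := sem_pivot st _ _ D2; rewrite !A2 => /(_ vX vF).
have A3 a : aset (sem cPivot s2) a = aset s1 a by rewrite sem_aset.
have st3 : vs (sem cPivot s2) v_st = rk v by rewrite sem_vs.
have sf3 : vs (sem cPivot s2) v_sf = 1 by rewrite sem_vs.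
move: (sem cPivot s2) A3 st3 sf3 => s3 A3 st3 sf3.
case epv: (pivot _ _ _ _ _) => [w|]; last first.
  (* Without a pivot [augstep] would return [None] in spite of a source, which [augstepP] excludes;
     so a stale [v_pv] is never read. *)
  by move=> _ h; inversion h as [h' _| |]; rewrite est in h'.
case=> pf pv _; rewrite semSeq !semPut !vs_putg.
by rewrite st3 pv sf3; split=> //; rewrite !aset_putx A3.
Qed.

Lemma sem_complete s : aset (sem cComplete s) aX = complete M1 M2 (aset s aX).
Proof.
rewrite /cComplete /complete; set p := (X in sem (CEach v_u X)).
have [||s' [-> _ e]] := @for_fold T (oracles M1 M2) tau _ (fun J s' => aset s' aX = J)
  (fun J x => if common (x |: J) then x |: J else J) (aset s aX) v_u p s.
- by [].
- move=> J x s' sm R; rewrite /p !semSeq (@semTest1 _ _ _ _ _ _ _ _ x) //.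
  rewrite (@semTest1 _ _ _ _ _ _ _ _ x) // !aset_setv R.
  set s2 := setv _ v_t2 _.
  have e2 : ev s2 (EAnd (EV v_t1) (EV v_t2)) = common (x |: J).
    by rewrite /= /upd /= /common_indep; case: indep; case: indep.
  rewrite (semWhenb _ _ e2); case: ifP => _; last by rewrite !aset_setv.
  by rewrite semPut !vs_setv aset_putx /= !aset_setv R.
by rewrite aset_setv.
Qed.

End Augment.

(** * Recognising children and finding the next one *)

Section Kids.
Variables (T : finType) (M1 M2 : matroid T) (tau : int).
Local Notation n := #|T|.
Local Notation orc := (oracles M1 M2).
Local Notation sem := (sem orc tau).
Local Notation ev := (ev T tau).
Local Notation aset := (aset T).
Local Notation common := (common_indep M1 M2).
Local Notation sols := (solutions M1 M2 tau).
Local Notation parent := (parent M1 M2).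
Local Notation kids := (kids sols parent).
Implicit Types (s : store) (x y u v : T) (P K : {set T}).

Lemma sem_common a s : sem (cCommon a) s
  = setv (setv s v_t1 (indep M1 (aset s a))) v_t2 (indep M2 (aset s a)).
Proof. by rewrite /cCommon semSeq !semTest0. Qed.

Lemma in_solutions K : (K \in sols) =
  [&& common K, ~~ [exists x, (x \notin K) && common (x |: K)] & (tau <= Posz #|K|)%R].
Proof.
rewrite inE /large andbA; congr (_ && _); apply/maxcommonP/andP => -[cK mK]; split=> //.
  by rewrite negb_exists; apply/forallP => x; rewrite negb_and -implybE; apply/implyP/mK.
move=> x xK; move: mK; rewrite negb_exists => /forallP/(_ x).
by rewrite negb_and xK.
Qed.

Lemma sem_solution s : vs (sem cSolution s) v_ok = (aset s aK \in sols).
Proof.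
rewrite /cSolution semSeq semSet semSeq; set s1 := setv s _ _.
set p := CEach v_u _.
have h : vs (sem p s1) v_h =
    [exists x, (x \notin aset s aK) && common (x |: aset s aK)] :> nat.
  apply: for_exists => // x s' b sm eb; rewrite semSeq (@semGuard1 _ _ _ _ _ _ _ _ _ x) //.
  rewrite semSeq (@semGuard1 _ _ _ _ _ _ _ _ _ x) // semSet !aset_setv !(same_aset _ sm) //.
  rewrite !aset_setv /= /upd /= eb rk_lt (sm.2 aK isT) in_aset /common_indep.
  have -> : ar s1 = ar s by [].
  by case: (b); case: (ar s aK (rk x)); case: indep; case: indep.
have K2 : aset (sem p s1) aK = aset s aK by rewrite sem_aset.
move: (sem p s1) K2 h => s2 K2 h; rewrite semSeq.
have c3 := sem_count (oracles M1 M2) tau aK s2.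
have K3 : aset (sem (cCount aK) s2) aK = aset s aK by rewrite sem_aset.
have h3 : vs (sem (cCount aK) s2) v_h = vs s2 v_h by rewrite sem_vs.
move: (sem (cCount aK) s2) K3 h3 c3 => s3 K3 h3 c3.
rewrite semSeq sem_common semSet vs_setv /= /upd /= h3 h c3 K2 K3 in_solutions /common_indep.
by do 2!case: indep; case: existsP => //=; case: (_ <= _)%R.
Qed.

Lemma sem_parent a s : a != aF -> a != aX -> a != aD -> common (aset s a) ->
  vs (sem (cParent a) s) v_sf = isSome (parent (aset s a)) /\
  (forall P, parent (aset s a) = Some P -> aset (sem (cParent a) s) aX = P).
Proof.
move=> aF' aX' aD' ca; rewrite /cParent semSeq.
have F1 := sem_clear (oracles M1 M2) tau aF s.
have A1 : aset (sem (cClear aF) s) a = aset s a by rewrite sem_aset // inE.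
move: (sem (cClear aF) s) F1 A1 => s1 F1 A1; rewrite semSeq.
have X2 := sem_copy (oracles M1 M2) tau s1 aX'.
have F2 : aset (sem (cCopy aX a) s1) aF = set0 by rewrite sem_aset.
move: (sem (cCopy aX a) s1) X2 F2 => s2 X2 F2; rewrite semSeq.
rewrite A1 in X2; rewrite -X2 in ca; have [sf X3] := sem_step tau ca.
move: (sem cStep s2) sf X3 => s3 sf X3.
rewrite sem_complete sem_vs // sf X3 F2 X2 parentE.
by case: augstep => //= I; split=> // P [].
Qed.

Lemma in_kids o K : (K \in kids o) = (K \in sols) && (parent K == o).
Proof. by rewrite inE. Qed.

Lemma sem_iskid s : vs (sem cIsKid s) v_ok = (aset s aK \in kids (Some (aset s aP))).
Proof.
rewrite /cIsKid semSeq; have ok := sem_solution s.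
have K1 : aset (sem cSolution s) aK = aset s aK by rewrite sem_aset.
have P1 : aset (sem cSolution s) aP = aset s aP by rewrite sem_aset.
move: (sem cSolution s) ok K1 P1 => s1 ok K1 P1.
rewrite (semWhenb _ _ (ok : ev s1 (EV v_ok) = _)) in_kids.
case Ksol: (aset s aK \in sols); last by move: ok; rewrite Ksol.
have cK : common (aset s1 aK) by rewrite K1; move: Ksol; rewrite in_solutions => /and3P[].
rewrite semSeq; have [//|//|//|sf X] := @sem_parent aK s1 _ _ _ cK.
have P2 : aset (sem (cParent aK) s1) aP = aset s aP by rewrite sem_aset.
move: (sem (cParent aK) s1) sf X P2 => s2 sf X P2; rewrite semSeq.
have [_ eq3] := sem_cmp (oracles M1 M2) tau aX aP s2.
have sf3 : vs (sem (cCmp aX aP) s2) v_sf = vs s2 v_sf by rewrite sem_vs.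
move: (sem (cCmp aX aP) s2) eq3 sf3 => s3 eq3 sf3.
rewrite semSet vs_setv /= sf3 sf eq3 P2 -K1.
case eP: (parent _) X => [P|] // /(_ P erefl) -> //=.
have -> : (Some P == Some (aset s aP)) = (P == aset s aP) by [].
by case: (P == _).
Qed.

Definition improves s K :=
  [&& K \in kids (Some (aset s aP)), (vs s v_ex == 0) || (code (aset s aJ) < code K)
    & (vs s v_found == 0) || (code K < code (aset s aB))].

Definition trip P e f1 f2 : {set T} := ((e |: P) :\ f1) :\ f2.

Lemma sem_candidate s e f1 f2 : vs s v_e = rk e -> vs s v_f1 = rk f1 -> vs s v_f2 = rk f2 ->
  let K := trip (aset s aP) e f1 f2 in
  if improves s K then
    vs (sem cCandidate s) v_found = 1 /\ aset (sem cCandidate s) aB = K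
  else vs (sem cCandidate s) v_found = vs s v_found /\
    aset (sem cCandidate s) aB = aset s aB.
Proof.
move=> ee e1 e2 K; rewrite /cCandidate semSeq; set p := (X in sem X s).
have fr := same_sem (oracles M1 M2) tau p s.
have K1 : aset (sem p s) aK = K.
  rewrite /p semSeq; have c := sem_copy (oracles M1 M2) tau s (isT : aP != aK).
  have v j : j != v_i -> vs (sem (cCopy aK aP) s) j = vs s j by move=> ne; rewrite sem_vs // inE.
  move: (sem (cCopy aK aP) s) c v => s1 c v.
  rewrite !semSeq !semPut !vs_putg !v // ee e1 e2 !aset_putx c //.
move: (sem p s) fr K1 => s1 fr1 K1; rewrite semSeq.
have ok := sem_iskid s1; have fr2 := same_sem (oracles M1 M2) tau cIsKid s1.
rewrite K1 !(same_aset _ fr1) // in ok.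
move: (sem cIsKid s1) ok fr2 => s2 ok2 fr2; rewrite /cUpdate semSeq.
have [lt3 _] := sem_cmp (oracles M1 M2) tau aJ aK s2.
have fr3 := same_sem (oracles M1 M2) tau (cCmp aJ aK) s2.
rewrite !(same_aset _ fr2) // K1 !(same_aset _ fr1) // in lt3.
move: (sem (cCmp aJ aK) s2) lt3 fr3 => s3 lt3 fr3; rewrite semSeq semSet.
set ok' := ev s3 _.
have eok : ok' = (K \in kids (Some (aset s aP))) && ((vs s v_ex == 0) || (code (aset s aJ) < code K)) :> nat.
  rewrite /ok' /= lt3 (fr3.1 v_ok isT) ok2.
  rewrite (fr3.1 v_ex isT) (fr2.1 v_ex isT) (fr1.1 v_ex isT).
  by case: (K \in _); case: (vs s v_ex == 0); case: (code _ < _).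
move: ok' eok => ok' eok; rewrite semSeq.
have [lt4 _] := sem_cmp (oracles M1 M2) tau aK aB (setv s3 v_ok ok').
have fr4 := same_sem (oracles M1 M2) tau (cCmp aK aB) (setv s3 v_ok ok').
rewrite !aset_setv !(same_aset _ fr3) // !(same_aset _ fr2) // K1 !(same_aset _ fr1) // in lt4.
move: (sem (cCmp aK aB) _) lt4 fr4 => s4 lt4 fr4; rewrite semSeq semSet.
have ef : vs s4 v_found = vs s v_found.
  by rewrite (fr4.1 v_found isT) vs_setv (fr3.1 v_found isT) (fr2.1 v_found isT) (fr1.1 v_found isT).
have eB : aset s4 aB = aset s aB.
  by rewrite (same_aset _ fr4) // aset_setv (same_aset _ fr3) // (same_aset _ fr2) // (same_aset _ fr1).
have eK : aset s4 aK = K.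
  by rewrite (same_aset _ fr4) // aset_setv (same_aset _ fr3) // (same_aset _ fr2).
set ok2' := ev s4 _.
have eok2 : ok2' = improves s K.
  rewrite /improves /ok2' /= lt4 (fr4.1 v_ok isT) vs_setv /= eok ef.
  case: (K \in _) => //=; case: (_ || _) => //=.
  by case: (vs s v_found == 0); case: (code _ < _).
move: ok2' eok2 => ok2' eok2; rewrite (semWhenb _ _ (eok2 : ev (setv s4 v_ok ok2') (EV v_ok) = _)).
case: (improves s K); last by split.
by rewrite semSeq semSet vs_setv aset_setv sem_copy // aset_setv.
Qed.

(** A rule for nested searches: [C s z] says that candidate [z] has been accounted for, [D x z] that
    the pass for [x] takes care of it. The conclusion has the form required of an enclosing loop's
    body. *)
Lemma for_cover (Z : Type) (inv : store -> Prop) (C : store -> Z -> Prop)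
    (D : T -> Z -> Prop) k p s0 :
  (forall s i, inv s -> inv (setv s k i)) ->
  (forall s i z, C s z -> C (setv s k i) z) ->
  inv s0 ->
  (forall x s, same (CEach k p) s s0 -> inv s ->
     let s' := sem p (setv s k (rk x)) in
     [/\ inv s', forall z, C s z -> C s' z & forall z, D x z -> C s' z]) ->
  let s' := sem (CEach k p) s0 in
  [/\ inv s', forall z, C s0 z -> C s' z & forall x z, D x z -> C s' z].
Proof.
move=> istab cstab i0 step s'.
have [||s1 [e _ [i1 c1 d1]]] := @for_each T orc tau (fun pre s => [/\ inv s,
  forall z, C s0 z -> C s z & {in pre, forall x z, D x z -> C s z}]) k p s0.
- by [].
- move=> pre x post s _ sm [i c d]; have [i' c' d'] := step x s sm i; split=> //.
    by move=> z /c/c'.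
  by move=> y; rewrite mem_rcons inE => /predU1P[->|/d yd z /yd/c'].
rewrite /s' e; split; first exact: istab.
  by move=> z /c1/cstab.
by move=> x z /d1 h; apply/cstab/h; rewrite mem_enum.
Qed.

Section Scan.
Variables (P J : {set T}) (ex : nat).

Definition ctx s := [/\ aset s aP = P, aset s aJ = J & vs s v_ex = ex].
Definition bound := if ex == 0 then 0 else (code J).+1.

Definition good s := vs s v_found = 0 \/
  [/\ vs s v_found = 1, aset s aB \in kids (Some P) & bound <= code (aset s aB)].
Definition covers s K := K \in kids (Some P) -> bound <= code K ->
  vs s v_found = 1 /\ code (aset s aB) <= code K.

Lemma boundE K : (bound <= code K) = (ex == 0) || (code J < code K).
Proof. by rewrite /bound; case: eqP. Qed.

Lemma scan_candidate s e f1 f2 : ctx s -> good s ->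
  vs s v_e = rk e -> vs s v_f1 = rk f1 -> vs s v_f2 = rk f2 ->
  let s' := sem cCandidate s in
  [/\ good s', forall K, covers s K -> covers s' K & covers s' (trip P e f1 f2)].
Proof.
case=> eP eJ eex gs ee e1 e2 s'; have := sem_candidate ee e1 e2; rewrite -/s' eP /=.
set K := trip P e f1 f2; rewrite /improves eP eJ eex -boundE.
case: ifP => [/and3P[oK bK lt] [f' B']|no [f' B']].
  have cK : covers s' K by move=> _ _; rewrite B'.
  split=> //; first by right; rewrite B'.
  move=> K' cK' oK' bK'; split=> //; have [f B] := cK' oK' bK'.
  by rewrite B'; apply: leq_trans B; move: lt; rewrite f => /ltnW.
split; first by case: gs => [g|[g1 g2 g3]]; [left|right]; rewrite f' ?B'.
  by move=> K' cK' oK' bK'; rewrite f' B'; apply: cK'.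
move=> oK bK; move/negbT: no; rewrite oK bK /= negb_or -leqNgt => /andP[f le].
by rewrite f' B'; case: gs f => [->|[->]].
Qed.

Lemma sem_scan s : ctx s ->
  let s' := sem cScan s in
  if nextkid (@code T) sols parent (Some P) bound is Some K then
    vs s' v_found = 1 /\ aset s' aB = K
  else vs s' v_found = 0.
Proof.
move=> cs; rewrite /cScan semSeq semSet; set s0 := setv s v_found _.
have stab1 k : k != v_found -> forall s i, good s -> good (setv s k i).
  by move=> ne s1 i; rewrite /good vs_setv eq_sym (negPf ne).
have stab2 k : k != v_found -> forall s i K, covers s K -> covers (setv s k i) K.
  by move=> ne s1 i K; rewrite /covers vs_setv eq_sym (negPf ne).
have g0 : good s0 by left.
pose D3 e f1 f2 K := K = trip P e f1 f2.
pose D2 e f1 K := exists f2, D3 e f1 f2 K.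
pose D1 e K := exists f1, D2 e f1 K.
set p := CEach v_e _.
have [gs _ cov] : let s' := sem p s0 in
    [/\ good s', forall K, covers s0 K -> covers s' K & forall e K, D1 e K -> covers s' K].
  apply: for_cover; [exact: stab1|exact: stab2|by []|] => e s1 sm1 g1.
  set s2 := setv s1 v_e (rk e); have g2 : good s2 by exact: stab1.
  have [gs' mono cov] : let s' := sem (CEach v_f1 (CEach v_f2 cCandidate)) s2 in
    [/\ good s', forall K, covers s2 K -> covers s' K & forall f1 K, D2 e f1 K -> covers s' K].
    apply: for_cover; [exact: stab1|exact: stab2|by []|] => f1 s3 sm3 g3.
    set s4 := setv s3 v_f1 (rk f1); have g4 : good s4 by exact: stab1.
    have [gs' mono cov] : let s' := sem (CEach v_f2 cCandidate) s4 in
      [/\ good s', forall K, covers s4 K -> covers s' K & forall f2 K, D3 e f1 f2 K -> covers s' K].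
      apply: for_cover; [exact: stab1|exact: stab2|by []|] => f2 s5 sm5 g5.
      have [|||||gs' mono cov] := @scan_candidate (setv s5 v_f2 (rk f2)) e f1 f2.
      - case: cs => cP' cJ' cex; split.
        + by rewrite aset_setv (same_aset _ sm5) // aset_setv (same_aset _ sm3) // aset_setv (same_aset _ sm1).
        + by rewrite aset_setv (same_aset _ sm5) // aset_setv (same_aset _ sm3) // aset_setv (same_aset _ sm1).
        by rewrite vs_setv (sm5.1 v_ex isT) vs_setv (sm3.1 v_ex isT) vs_setv (sm1.1 v_ex isT).
      - exact: stab1.
      - by rewrite vs_setv (sm5.1 v_e isT) vs_setv (sm3.1 v_e isT).
      - by rewrite vs_setv (sm5.1 v_f1 isT).
      - by [].
      by move=> s'; split=> // K ->.
    by move=> s'; split=> // K [f2 /cov].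
  by move=> s'; split=> // K [f1 /cov].
move: (sem p s0) gs cov => s' gs cov.
(* By [parentP] every child of [P] is some [trip P e f1 f2], so the three loops have met it. *)
have {}cov K : covers s' K.
  move=> oK bK; have := oK; rewrite in_kids inE => /andP[/andP[mK _] /eqP eK].
  have [_ _ _ [e [f1 [f2 tK]]]] := parentP mK eK.
  by apply: (cov e K) => //; exists f1, f2.
case: gs => [f0|[f1 oB bB]].
  rewrite (nextkid_uniq (@code_inj T) (r := None)) //; constructor => K oK.
  by rewrite ltnNge; apply/negP => bK; have [] := cov K oK bK; rewrite f0.
rewrite (nextkid_uniq (@code_inj T) (r := Some (aset s' aB))) //; constructor => // K oK bK.
by have [] := cov K oK bK.
Qed.

End Scan.
End Kids.

(** * Maximum sets and their successors in the program *)

Section RootSpecs.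
Variables (T : finType) (M1 M2 : matroid T) (tau : int).
Local Notation n := #|T|.
Local Notation orc := (oracles M1 M2).
Local Notation sem := (sem orc tau).
Local Notation ev := (ev T tau).
Local Notation aset := (aset T).
Local Notation common := (common_indep M1 M2).
Local Notation extendable := (extendable M1 M2).
Implicit Types (s : store) (x y u v : T) (P K : {set T}).

Lemma sem_maximize s : common (aset s aX) ->
  aset (sem cMaximize s) aX = maximize M1 M2 (aset s aF) (aset s aX).
Proof.
move=> cX; set F := aset s aF; set I := aset s aX in cX *.
pose f J := odflt J (augstep M1 M2 F J).
have cf k : common (iter k f I).
  elim: k => //= k IH; rewrite {1}/f; case e: (augstep _ _ _ _) => [J|] //=.
  by have [] := augstep_common IH e.
have [||s' [-> _ e]] := @for_nat T orc tau (fun i s' => aset s' aX = iter i (iter n.+1 f) I)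
  true v_r1 (CFor true v_r2 cStep) s.
- by [].
- move=> i s1 _ sm1 e1.
  have [||s2 [-> _ e2]] := @for_nat T orc tau
    (fun j s' => aset s' aX = iter (j + i * n.+1) f I) true v_r2 cStep (setv s1 v_r1 i).
  + by rewrite add0n iterM aset_setv.
  + move=> j s3 _ sm3 e3; set s4 := setv s3 _ _.
    have F4 : aset s4 aF = F by rewrite !aset_setv (same_aset _ sm3) // aset_setv (same_aset _ sm1).
    have [|_ ->] := @sem_step T M1 M2 tau s4; first by rewrite aset_setv e3.
    by rewrite F4 aset_setv e3.
  by rewrite aset_setv e2 addn1 -mulSn iterM.
by rewrite aset_setv e addn1 /maximize -iterM.
Qed.

Lemma sem_extendable s : vs s v_nu = nu M1 M2 ->
  vs (sem cExtendable s) v_ok = extendable (aset s aF) (aset s aA).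
Proof.
move=> enu; rewrite /cExtendable semSeq.
have X1 := sem_copy orc tau s (isT : aA != aX).
have F1 : aset (sem (cCopy aX aA) s) aF = aset s aF by rewrite sem_aset.
have n1 : vs (sem (cCopy aX aA) s) v_nu = nu M1 M2 by rewrite sem_vs.
move: (sem (cCopy aX aA) s) X1 F1 n1 => s1 X1 F1 n1.
rewrite semSeq sem_common X1; set s2 := setv _ v_t2 _.
have c2 : ev s2 (EAnd (EV v_t1) (EV v_t2)) = common (aset s aA).
  by rewrite /= /upd /= /common_indep; case: indep; case: indep.
rewrite (semIfb _ _ _ c2) /extendable; case: ifP => cA //.
have X2 : aset s2 aX = aset s aA by rewrite 2!aset_setv.
have F2 : aset s2 aF = aset s aF by rewrite 2!aset_setv.
rewrite semSeq; have X3 := @sem_maximize s2; rewrite F2 X2 in X3.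
have n3 : vs (sem cMaximize s2) v_nu = nu M1 M2 by rewrite sem_vs.
move: (sem cMaximize s2) (X3 cA) n3 => s3 {}X3 n3; rewrite semSeq.
have c4 := sem_count orc tau aX s3.
have n4 : vs (sem (cCount aX) s3) v_nu = nu M1 M2 by rewrite sem_vs.
move: (sem (cCount aX) s3) c4 n4 => s4 c4 n4.
by rewrite semSet vs_setv /= c4 n4 X3.
Qed.

Lemma sem_greedy s : vs s v_nu = nu M1 M2 ->
  aset (sem cGreedy s) aA = greedy M1 M2 (aset s aF) (aset s aA).
Proof.
move=> enu; rewrite /cGreedy /greedy; set p := (X in sem (CEach v_x X)).
have [||s' [-> _ [_ e]]] := @for_fold T orc tau _
  (fun FA s' => aset s' aF = FA.1 /\ aset s' aA = FA.2) (greedy_step M1 M2)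
  (aset s aF, aset s aA) v_x p s.
- by [].
- move=> [F A] x s1 sm [/= eF eA]; rewrite /p /greedy_step.
  set s2 := setv s1 v_x _.
  have e2 : ev s2 (EA aF v_x) = ar s1 aF (rk x) by apply: ev_EA.
  rewrite semIf e2 -in_aset eF; case: (x \in F) => //.
  rewrite semSeq semPut vs_setv.
  have x3 : vs (putg T s2 aF (rk x) true) v_x = rk x by rewrite vs_putg.
  have n3 : vs (putg T s2 aF (rk x) true) v_nu = nu M1 M2.
    by rewrite vs_putg vs_setv (sm.1 v_nu isT).
  have F3 : aset (putg T s2 aF (rk x) true) aF = x |: F by rewrite aset_putx aset_setv eF.
  have A3 : aset (putg T s2 aF (rk x) true) aA = A.
    by rewrite aset_put_other // aset_setv.
  move: (putg T s2 aF (rk x) true) x3 n3 F3 A3 => s3 x3 n3 F3 A3.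
  rewrite semSeq; have ok := sem_extendable n3; rewrite F3 A3 in ok.
  have x4 : vs (sem cExtendable s3) v_x = rk x by rewrite sem_vs.
  have F4 : aset (sem cExtendable s3) aF = x |: F by rewrite sem_aset.
  have A4 : aset (sem cExtendable s3) aA = A by rewrite sem_aset.
  move: (sem cExtendable s3) ok x4 F4 A4 => s4 ok x4 F4 A4.
  rewrite (semIfb _ _ _ (ok : ev s4 (EV v_ok) = _)); case: (extendable _ _) => //.
  rewrite semPut x4 /=; split; first by rewrite aset_put_other.
  by rewrite aset_putx A4.
by rewrite aset_setv e.
Qed.

Lemma sem_flip z s x : z != v_i -> vs s z = rk x ->
  aset (sem (cFlip z) s) aF = upto x /\ aset (sem (cFlip z) s) aA = flip (aset s aJ) x.
Proof.
move=> ne ez; rewrite /cFlip; set p := (X in sem (CEach v_i X)).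
have [||s' [-> _ e]] := @for_each T orc tau (fun pre s' => {in pre, forall y,
  (y \in aset s' aF) = (rk y <= rk x) /\
  (y \in aset s' aA) = (y \in flip (aset s aJ) x)}) v_i p s.
- by [].
- move=> pre y post s1 _ sm IH y'; rewrite mem_rcons inE => mem.
  have z1 : vs s1 z = rk x by rewrite (sm.1 z) ?inE ?negb_or ?ne.
  rewrite /p semSeq; set s2 := setv s1 v_i _.
  have z2 : vs s2 z = rk x by rewrite vs_setv (negPf ne).
  have J2 : ar s2 aJ = ar s aJ by rewrite ar_setv (sm.2 aJ isT).
  have i2 : vs s2 v_i = rk y by [].
  have a2 : ar s2 = ar s1 by [].
  move: s2 z2 J2 i2 a2 => s2 z2 J2 i2 a2.
  rewrite [sem (CPut aF _ _) _]semPut i2; set w := ev s2 _.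
  have ew : w = (rk y <= rk x) :> nat by rewrite /w /= z2 i2 [in RHS]leqNgt; case: (_ < _).
  set s3 := putg _ _ _ _ _.
  have z3 : vs s3 z = rk x by rewrite vs_putg.
  have i3 : vs s3 v_i = rk y by rewrite vs_putg.
  have J3 : ar s3 aJ (rk y) = ar s aJ (rk y) by rewrite ar_putx J2.
  rewrite semPut i3; set w' := ev s3 _.
  have ew' : w' = (y \in flip (aset s aJ) x) :> nat.
    rewrite /w' !inE -(inj_eq (@rk_inj T)) /= i3 z3 rk_lt J3.
    by case: (rk y == rk x); case: (ar s aJ (rk y)); case: (rk y < rk x).
  rewrite aset_put_other // /s3.
  have eA u : (u \in aset (putg T (putg T s2 aF (rk y) w) aA (rk y) w') aA) =
      if u == y then w' != 0 else u \in aset s1 aA.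
    by rewrite in_aset ar_putx /= !in_aset; case: (u == y) => //; rewrite ar_putx a2.
  have eF u : (u \in aset (putg T s2 aF (rk y) w) aF) =
      if u == y then w != 0 else u \in aset s1 aF.
    by rewrite in_aset ar_putx /= !in_aset a2; case: (u == y).
  rewrite eA eF; case: (eqVneq y' y) mem => [->|_] /=; last exact: IH.
  by rewrite ew ew'; case: (_ <= _); case: (_ \in _).
by split; apply/setP => y; have [eF eA] := e y (mem_enum _ _); rewrite aset_setv ?eF ?eA // inE.
Qed.

Lemma sem_flippable s : vs s v_nu = nu M1 M2 ->
  enc_opt (sem cFlippable s) v_posf v_pos (flippable M1 M2 (aset s aJ)).
Proof.
move=> enu; rewrite /cFlippable semSeq semSet /flippable.
set s0 := setv s v_posf _; set p := (X in sem (CEach v_x X)).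
have [||s' [-> _ e]] := @for_fold T orc tau _
  (fun o s' => enc_opt s' v_posf v_pos o)
  (fun o x => if (x \notin aset s aJ) && extendable (upto x) (flip (aset s aJ) x)
              then Some x else o) None v_x p s0.
- by [].
- move=> o x s1 sm R; rewrite /p; set s2 := setv s1 v_x _.
  have e2 : ev s2 (EA aJ v_x) = ar s1 aJ (rk x) by apply: ev_EA.
  have J1 : aset s1 aJ = aset s aJ by rewrite (same_aset _ sm).
  rewrite semIf e2 -in_aset J1; case: (x \in aset s aJ) => /=; first by case: o R.
  have R2 : enc_opt s2 v_posf v_pos o by case: o R.
  have n2 : vs s2 v_nu = nu M1 M2 by rewrite vs_setv (sm.1 v_nu isT).
  have x2 : vs s2 v_x = rk x by [].
  have J2 : aset s2 aJ = aset s aJ by [].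
  move: s2 R2 n2 x2 J2 {e2} => s2 R2 n2 x2 J2.
  rewrite [sem (cFlip _ ;; _) _]semSeq; have [F3 A3] := sem_flip (isT : v_x != v_i) x2.
  rewrite J2 in A3.
  have v3 j : j != v_i -> vs (sem (cFlip v_x) s2) j = vs s2 j by move=> ne; rewrite sem_vs // inE.
  move: (sem (cFlip v_x) s2) F3 A3 v3 => s3 F3 A3 v3.
  rewrite semSeq.
  have n3 : vs s3 v_nu = nu M1 M2 by rewrite v3.
  have ok := sem_extendable n3; rewrite F3 A3 in ok.
  have x4 : vs (sem cExtendable s3) v_x = rk x by rewrite sem_vs // v3.
  have f4 : vs (sem cExtendable s3) v_posf = vs s2 v_posf by rewrite sem_vs // v3.
  have p4 : vs (sem cExtendable s3) v_pos = vs s2 v_pos by rewrite sem_vs // v3.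
  move: (sem cExtendable s3) ok x4 f4 p4 => s4 ok x4 f4 p4.
  rewrite (semWhenb _ _ (ok : ev s4 (EV v_ok) = _)); case: (extendable _ _).
    by rewrite semSeq !semSet.
  by case: o R2 {R}; rewrite /= f4 ?p4.
by case: foldl e.
Qed.

Lemma sem_nextroot s : vs s v_nu = nu M1 M2 ->
  if nextroot M1 M2 (aset s aJ) is Some R then
    vs (sem cNextRoot s) v_posf = 1 /\ aset (sem cNextRoot s) aA = R
  else vs (sem cNextRoot s) v_posf = 0.
Proof.
move=> enu; rewrite /nextroot /cNextRoot semSeq.
have := sem_flippable enu.
have J1 : aset (sem cFlippable s) aJ = aset s aJ by rewrite sem_aset.
have n1 : vs (sem cFlippable s) v_nu = nu M1 M2 by rewrite sem_vs.
move: (sem cFlippable s) J1 n1 => s1 J1 n1.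
case: (flippable _ _ _) => [x|]; last first.
  rewrite [enc_opt _ _ _ _]/= => e0 /=.
  by rewrite (semWhenb _ _ (e0 : ev s1 (EV v_posf) = false)).
rewrite [enc_opt _ _ _ _]/= => -[e1 ex].
rewrite [omap _ _]/= (semWhenb _ _ (e1 : ev s1 (EV v_posf) = true)).
rewrite [sem (cFlip _ ;; _) _]semSeq.
have [F2 A2] := sem_flip (isT : v_pos != v_i) ex; rewrite J1 in A2.
have n2 : vs (sem (cFlip v_pos) s1) v_nu = nu M1 M2 by rewrite sem_vs.
have f2 : vs (sem (cFlip v_pos) s1) v_posf = 1 by rewrite sem_vs.
move: (sem (cFlip v_pos) s1) F2 A2 n2 f2 => s2 F2 A2 n2 f2.
by rewrite sem_vs // sem_greedy // F2 A2.
Qed.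

End RootSpecs.

(** * One pass of the main loop is one move of the traversal *)

Section Main.
Variables (T : finType) (M1 M2 : matroid T) (tau : int).
Local Notation n := #|T|.
Local Notation orc := (oracles M1 M2).
Local Notation sem := (sem orc tau).
Local Notation ev := (ev T tau).
Local Notation aset := (aset T).
Local Notation common := (common_indep M1 M2).
Local Notation sols := (solutions M1 M2 tau).
Local Notation parent := (parent M1 M2).
Local Notation next := (next (@code T) sols parent).
Local Notation after := (after (@code T) sols parent).
Local Notation nu := (nu M1 M2).
Implicit Types (s : store) (J P K : {set T}).

(** The bound of [tau] by [nu] is carried along because it makes the roots all the maximum sets, as
    [nextkid_nextroot] requires. *)
Definition repr s (st : option (state {set T})) :=
  if st is Some (J, ex, pr) then
    [/\ vs s v_done = 0, aset s aJ = J, vs s v_ex = ex, vs s v_pr = pr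
      & [/\ vs s v_nu = nu, J \in sols & (tau <= Posz nu)%R]]
  else vs s v_done = 1.

Lemma sem_body s J ex pr : repr s (Some (J, ex, pr)) ->
  repr (sem cBody s) (next (J, ex, pr)).
Proof.
case=> done0 eJ eex epr [enu Jsol large].
have mJ : maxset common J by move: Jsol; rewrite inE => /andP[].
have cJ : common J by case/maxsetP: mJ.
rewrite /cBody semSeq semSet semSeq semSet; set s1 := setv _ v_q _.
pose o := if ex then parent J else Some J.
pose b := if ex then (code J).+1 else 0.
pose q := ex == pr.
(* The parity passed on is [pr] on leaving and its negation on entering; [ex == pr] is both. *)
have -> : next (J, ex, pr) = after o b q by rewrite /o /b /q; case: (ex); case: (pr).
have J1 : aset s1 aJ = J by [].
have q1 : vs s1 v_q = q by rewrite /= /upd /= eex epr /q; case: (ex); case: (pr).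
have ex1 : ev s1 (EV v_ex) = ex by [].
have nu1 : vs s1 v_nu = nu by [].
have done1 : vs s1 v_done = 0 by [].
have rt1 : vs s1 v_rt = 0 by [].
move: s1 J1 q1 ex1 nu1 done1 rt1 => s1 J1 q1 ex1 nu1 done1 rt1 {s done0 eJ eex epr enu}.
rewrite semSeq; set c := (X in sem X s1).
have J2 : aset (sem c s1) aJ = J by rewrite sem_aset.
have q2 : vs (sem c s1) v_q = q by rewrite sem_vs.
have ex2 : vs (sem c s1) v_ex = ex by rewrite sem_vs.
have nu2 : vs (sem c s1) v_nu = nu by rewrite sem_vs.
have done2 : vs (sem c s1) v_done = 0 by rewrite sem_vs.
have [rt2 P2] : vs (sem c s1) v_rt = ~~ isSome o /\
    forall P, o = Some P -> aset (sem c s1) aP = P.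
  rewrite /c (semIfb _ _ _ ex1) /o; case: (ex).
    rewrite semSeq; have [||||] := @sem_parent T M1 M2 tau aJ s1;
      [by [] | by [] | by [] | by rewrite J1 |].
    move: (sem (cParent aJ) s1) => s3 sf3 X3; rewrite semSeq semSet vs_setv.
    have sf4 : vs (sem (cCopy aP aX) s3) v_sf = vs s3 v_sf by rewrite sem_vs.
    have P4 := sem_copy orc tau s3 (isT : aX != aP).
    move: (sem (cCopy aP aX) s3) sf4 P4 => s4 sf4 P4.
    rewrite J1 in sf3 X3; rewrite /= sf4 sf3; split; first by case: (parent J).
    by move=> P /X3 <-.
  split; first by rewrite sem_vs.
  by move=> P [<-]; rewrite sem_copy.
move: (sem c s1) J2 q2 ex2 nu2 done2 rt2 P2 => s2 J2 q2 ex2 nu2 done2 rt2 P2 {c}.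
rewrite (semIfb _ _ _ (rt2 : ev s2 (EV v_rt) = _)).
case eo: o P2 => [P|] P2 /=; last first.
  have [exT eP] : ex = true /\ parent J = None by move: eo; rewrite /o; case: (ex).
  rewrite semSeq afterE /b exT nextkid_nextroot //.
  have := @sem_nextroot T M1 M2 tau s2 nu2; rewrite J2.
  have q3 : vs (sem cNextRoot s2) v_q = q by rewrite sem_vs.
  have nu3 : vs (sem cNextRoot s2) v_nu = nu by rewrite sem_vs.
  have done3 : vs (sem cNextRoot s2) v_done = 0 by rewrite sem_vs.
  have := nextrootP M1 M2 J.
  move: (sem cNextRoot s2) q3 nu3 done3 => s3 q3 nu3 done3.
  case: (nextroot _ _ _) => [R [mR _ _] [f3 A3]|_ f3].
    rewrite (semIfb _ _ _ (f3 : ev s3 (EV v_posf) = true)).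
    rewrite 2!semSeq !semSet /repr.
    have A4 := sem_copy orc tau s3 (isT : aA != aJ).
    have q4 : vs (sem (cCopy aJ aA) s3) v_q = q by rewrite sem_vs.
    have nu4 : vs (sem (cCopy aJ aA) s3) v_nu = nu by rewrite sem_vs.
    have done4 : vs (sem (cCopy aJ aA) s3) v_done = 0 by rewrite sem_vs.
    move: (sem (cCopy aJ aA) s3) A4 q4 nu4 done4 => s4 A4 q4 nu4 done4.
    split=> //; first by rewrite aset_setv aset_setv A4.
    split=> //; have : R \in kids sols parent None by rewrite in_kids_root mR.
    by rewrite inE => /andP[].
  rewrite (semIfb _ _ _ (f3 : ev s3 (EV v_posf) = false)).
  by rewrite semSet.
have Psol : P \in sols.
  move: eo; rewrite /o; case: (ex); last by case=> <-.
  by move/(parent_solutions Jsol) => [].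
have mP : maxset common P by move: Psol; rewrite inE => /andP[].
have cs : ctx P J ex s2 by split=> //; apply: P2.
rewrite semSeq; have := sem_scan M1 M2 tau cs.
have P3 : aset (sem cScan s2) aP = P by rewrite sem_aset // (P2 P).
have q3 : vs (sem cScan s2) v_q = q by rewrite sem_vs.
have nu3 : vs (sem cScan s2) v_nu = nu by rewrite sem_vs.
have done3 : vs (sem cScan s2) v_done = 0 by rewrite sem_vs.
move: (sem cScan s2) P3 q3 nu3 done3 => s3 P3 q3 nu3 done3.
rewrite afterE.
have -> : bound J ex = b by rewrite /bound /b; case: (ex).
case: nextkidP => [_ f3|K oK _ _ [f3 B3]].
  rewrite (semIfb _ _ _ (f3 : ev s3 (EV v_found) = false)).
  rewrite 2!semSeq !semSet /repr.
  have A4 := sem_copy orc tau s3 (isT : aP != aJ).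
  have q4 : vs (sem (cCopy aJ aP) s3) v_q = q by rewrite sem_vs.
  have nu4 : vs (sem (cCopy aJ aP) s3) v_nu = nu by rewrite sem_vs.
  have done4 : vs (sem (cCopy aJ aP) s3) v_done = 0 by rewrite sem_vs.
  move: (sem (cCopy aJ aP) s3) A4 q4 nu4 done4 => s4 A4 q4 nu4 done4.
  split=> //; first exact: etrans A4 P3.
  by rewrite /= /upd /= q4; case: (q).
rewrite (semIfb _ _ _ (f3 : ev s3 (EV v_found) = true)).
rewrite 2!semSeq !semSet /repr.
have A4 := sem_copy orc tau s3 (isT : aB != aJ).
have q4 : vs (sem (cCopy aJ aB) s3) v_q = q by rewrite sem_vs.
have nu4 : vs (sem (cCopy aJ aB) s3) v_nu = nu by rewrite sem_vs.
have done4 : vs (sem (cCopy aJ aB) s3) v_done = 0 by rewrite sem_vs.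
move: (sem (cCopy aJ aB) s3) A4 q4 nu4 done4 => s4 A4 q4 nu4 done4.
split=> //; first exact: etrans A4 B3.
split=> //; by move: oK; rewrite inE => /andP[].
Qed.

Definition store0 := St (fun=> 0) (fun _ _ => 0).

Lemma sem_init : repr (sem cInit store0) (after None 0 false).
Proof.
rewrite /cInit semSeq.
have a0 a : aset store0 a = set0 by apply/setP => x; rewrite !inE.
have X1 := @sem_maximize T M1 M2 tau store0; rewrite !a0 in X1.
have {}X1 := X1 (common0 M1 M2).
have F1 : aset (sem cMaximize store0) aF = set0 by rewrite sem_aset.
have A1 : aset (sem cMaximize store0) aA = set0 by rewrite sem_aset.
have v1 j : j \in [:: v_done; v_ex; v_pr] -> vs (sem cMaximize store0) j = 0.
  by rewrite !inE => /or3P[] /eqP->; rewrite sem_vs.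
move: (sem cMaximize store0) X1 F1 A1 v1 => s1 X1 F1 A1 v1; rewrite semSeq.
have c2 := sem_count orc tau aX s1; rewrite X1 -/nu in c2.
have F2 : aset (sem (cCount aX) s1) aF = set0 by rewrite sem_aset.
have A2 : aset (sem (cCount aX) s1) aA = set0 by rewrite sem_aset.
have v2 j : j \in [:: v_done; v_ex; v_pr] -> vs (sem (cCount aX) s1) j = 0.
  by rewrite !inE => /or3P[] /eqP->; rewrite sem_vs ?v1.
move: (sem (cCount aX) s1) c2 F2 A2 v2 => s2 c2 F2 A2 v2; rewrite semSeq semSet.
set s3 := setv s2 v_nu _.
have nu3 : vs s3 v_nu = nu by [].
have F3 : aset s3 aF = set0 by [].
have A3 : aset s3 aA = set0 by [].
have v3 j : j \in [:: v_done; v_ex; v_pr] -> vs s3 j = 0.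
  by rewrite !inE => /or3P[] /eqP->; rewrite vs_setv v2.
have t3 : ev s3 (ETau (EV v_nu)) = (tau <= Posz nu)%R by rewrite -nu3.
move: s3 nu3 F3 A3 v3 t3 => s3 nu3 F3 A3 v3 t3.
rewrite (semIfb _ _ _ t3) afterE; case: ifP => [le|/negbT gt]; last first.
  by rewrite nextkid_no_root.
rewrite nextkid_first // semSeq.
have G4 := @sem_greedy T M1 M2 tau s3 nu3; rewrite F3 A3 -/(firstroot M1 M2) in G4.
have nu4 : vs (sem cGreedy s3) v_nu = nu by rewrite sem_vs.
have v4 j : j \in [:: v_done; v_ex; v_pr] -> vs (sem cGreedy s3) j = 0.
  by rewrite !inE => /or3P[] /eqP->; rewrite sem_vs ?v3.
move: (sem cGreedy s3) G4 nu4 v4 => s4 G4 nu4 v4.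
split; [by rewrite sem_vs // v4|by rewrite sem_copy|by rewrite sem_vs // v4|by rewrite sem_vs // v4|].
split=> //; first by rewrite sem_vs.
have [m _] := firstrootP M1 M2.
have : firstroot M1 M2 \in kids sols parent None by rewrite in_kids_root m.
by rewrite inE => /andP[].
Qed.

End Main.

(** * Execution on the machine *)

Section Execution.
Variables (T : finType) (M1 M2 : matroid T) (tau : int) (Q Qs W : nat).
Hypothesis leW : #|T|.+1 <= W.
Local Notation n := #|T|.
Local Notation orc := (oracles M1 M2).
Local Notation run := (run orc Q Qs W).
Local Notation enc := (enc T tau).
Local Notation quiet := (@quiet T Qs).
Local Notation sols := (solutions M1 M2 tau).
Local Notation parent := (parent M1 M2).
Local Notation next := (next (@code T) sols parent).
Local Notation after := (after (@code T) sols parent).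
Local Notation trek := (trek (@code T) sols parent).
Local Notation repr := (repr M1 M2 tau).
Implicit Types (tr : seq (event T)).

Definition econd := compe (ENot (EV v_done)).
Definition eout := compe (EEq (EV v_ex) (EV v_pr)).
Definition main_loop :=
  While econd (If eout [:: Output (eaddr aJ (Const 0))] [::] :: comp cBody).

Lemma quiet_outputs tr1 tr2 : all quiet tr1 -> outputs (tr1 ++ tr2) = outputs tr2.
Proof.
elim: tr1 => //= e tr1 IH /andP[/andP[qe _] /IH eq]; rewrite -eq /outputs /=.
by case: (ev_out e) qe.
Qed.

Lemma quiet_delay t tr1 tr2 : all quiet tr1 ->
  delay_from t (tr1 ++ tr2) = delay_from (t + ttime tr1) tr2.
Proof.
elim: tr1 t => [t _|e tr1 IH t /= /andP[/andP[qe _] /IH eq]].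
  by rewrite /ttime big_nil addn0.
by case: (ev_out e) qe => // _; rewrite eq /ttime big_cons addnA.
Qed.

Definition fits tr := all (fun e => ev_space e <= msize T + Qs) tr.

Lemma quiet_fits tr : all quiet tr -> fits tr.
Proof. by apply: sub_all => e /andP[]. Qed.

Lemma fits_space tr : fits tr -> peak_space tr <= msize T + Qs.
Proof.
rewrite /peak_space; elim: tr => [_|e tr IH /= /andP[he /IH le]]; first by rewrite big_nil.
by rewrite big_cons geq_max he.
Qed.

Variable X : nat.
Hypothesis leX : 50 + n + tc T Q cBody <= X.

Lemma step_while e p k m : step orc Q Qs W (While e p :: k, m) =
  Some (Event (1 + expr_time e) (size m) None,
    (if eval m e != 0 then p ++ While e p :: k else k, m)).
Proof. by []. Qed.

Lemma step_if e p q k m : step orc Q Qs W (If e p q :: k, m) =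
  Some (Event (1 + expr_time e) (size m) None,
    ((if eval m e != 0 then p else q) ++ k, m)).
Proof. by []. Qed.

Lemma step_output a k m : step orc Q Qs W (Output a :: k, m) =
  Some (Event (1 + expr_time a + n) (size m) (Some (set_at T m (eval m a))), (k, m)).
Proof. by []. Qed.

(** [X] bounds a pass with its overhead. By [next_emit], a state without output follows one with
    output, so at most [X] has elapsed before it, and at most [X + X] before any other. The third
    [X] pays for reaching the output itself, or for halting. *)
Lemma run_main ss s m st t : enc m s -> repr s st -> trek st ss None ->
  t <= (if st is Some x then if emit x is None then X else X + X else X + X) ->
  exists tr, [/\ run ([:: main_loop], m) tr, outputs tr = outs ss, fits tr
    & delay_from t tr <= X + X + X].
Proof.
elim: ss s m st t => [|x ss IH] s m st t E R e le.
  have {}e : st = None by [].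
  rewrite e in R le; have cond : eval m econd = 0.
    by rewrite (eval_compe E) //= R.
  exists [:: Event (1 + expr_time econd) (size m) None]; split=> //.
  - by apply: (RunStep (cf' := ([::], m))); [rewrite step_while cond | apply: RunHalt].
  - by rewrite /fits /= (leq_trans (enc_size E)) // leq_addr.
  rewrite [delay_from _ _]/=; apply: leq_add le _.
  by apply: leq_trans leX; rewrite -addnA leq_addr.
case: e => e te; rewrite e in R le.
case: x e te R le => [[J ex] pr] _ te R le.
have [done0 eJ eex epr _] := R.
have cond : eval m econd = 1 by rewrite (eval_compe E) //= done0.
have out : eval m eout = (ex == pr) by rewrite (eval_compe E) //= eex epr; case: (ex); case: (pr).
have [m' E' [trb [qb tb rb]]] := @comp_exec T orc tau Q Qs W leW cBody m s isT E.
have R' := sem_body R.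
have sz : size m <= msize T + Qs by apply: leq_trans (enc_size E) (leq_addr _ _).
pose ev1 : event T := Event (1 + expr_time econd) (size m) None.
pose ev2 : event T := Event (1 + expr_time eout) (size m) None.
pose ev3 : event T := Event (1 + expr_time (eaddr aJ (Const 0)) + n) (size m) (Some J).
have tbX : 20 + n + ttime trb <= X.
  by apply: leq_trans leX; rewrite leq_add ?leq_add2r.
have step1 k : step orc Q Qs W ([:: main_loop] ++ k, m) = Some (ev1,
    ((If eout [:: Output (eaddr aJ (Const 0))] [::] :: comp cBody) ++ [:: main_loop] ++ k, m)).
  by rewrite step_while cond.
have [nx|nx] := boolP (ex == pr).
  have [|tr' [r' o' f' d']] := IH _ m' _ (ttime trb) E' R' te.
    have leb : ttime trb <= X by apply: leq_trans tbX; apply: leq_addl.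
    by case: next => [y|]; rewrite ?(leq_trans leb) ?leq_addr //; case: emit => [_|];
      rewrite ?(leq_trans leb) ?leq_addr.
  exists [:: ev1, ev2, ev3 & trb ++ tr']; split.
  - apply: RunStep (step1 [::]) _.
    apply: (RunStep (cf' := ([:: Output (eaddr aJ (Const 0))] ++ comp cBody ++ [:: main_loop], m))).
      by rewrite step_if out nx.
    apply: (RunStep (cf' := (comp cBody ++ [:: main_loop], m))); last exact: rb.
    have ea : eval m (eaddr aJ (Const 0)) = abase + 0 * n by rewrite /= (enc_n E) addn0.
    by rewrite step_output ea (set_at_enc E) // eJ.
  - rewrite /outputs /= -/(outputs _) (quiet_outputs _ qb) o'.
    by rewrite /outs /= nx.
  - by rewrite /fits /= sz /= all_cat -/(fits trb) -/(fits tr') (quiet_fits qb).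
  have -> : delay_from t [:: ev1, ev2, ev3 & trb ++ tr'] =
      maxn (t + 5 + 6 + (9 + n)) (delay_from 0 (trb ++ tr')) by [].
  rewrite (quiet_delay _ _ qb) add0n geq_max d' andbT.
  have lt : t <= X + X.
    by apply: leq_trans le _; rewrite /= nx leqnn.
  (* The loop test costs 5, the parity test 6 and the output [9 + n], in all [20 + n]. *)
  rewrite -!addnA (addnA X) (leq_add lt) // -[5 + _]/(20 + n).
  by apply: leq_trans tbX; apply: leq_addr.
have ltX : t <= X by move: le; rewrite /= (negPf nx).
have nemit : emit (J, ex, pr) = None by rewrite /= (negPf nx).
have [|tr' [r' o' f' d']] := IH _ m' _ (t + 5 + 6 + ttime trb) E' R' te.
  have leb : t + 5 + 6 + ttime trb <= X + X.
    rewrite -!addnA leq_add //; apply: leq_trans tbX.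
    rewrite addnA leq_add2r; exact: (leq_addr (9 + n) 11).
  case ny: (next (J, ex, pr)) => [y|] //.
  by have := next_emit ny nemit; case: emit.
exists [:: ev1, ev2 & trb ++ tr']; split.
- apply: RunStep (step1 [::]) _.
  apply: (RunStep (cf' := (comp cBody ++ [:: main_loop], m))); last exact: rb.
  by rewrite step_if out (negPf nx).
- rewrite /outputs /= -/(outputs _) (quiet_outputs _ qb) o'.
  by rewrite /outs /= (negPf nx).
- by rewrite /fits /= sz /= all_cat -/(fits trb) -/(fits tr') (quiet_fits qb).
have -> : delay_from t [:: ev1, ev2 & trb ++ tr'] =
  delay_from (t + 5 + 6) (trb ++ tr') by [].
by rewrite (quiet_delay _ _ qb).
Qed.

End Execution.

Lemma enc_input (T : finType) (tau : int) : enc T tau (input #|T| tau) store0.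
Proof.
by split=> // *; rewrite nth_default.
Qed.

Theorem theorem2 :
  exists (p : program) (c : nat),
    forall (T : finType) (M1 M2 : matroid T) (tau : int) (Q Qs : nat),
      0 < Q ->
      exists tr : seq (event T),
        [/\ run (oracles M1 M2) Q Qs (word_max c #|T| tau)
              (p, input #|T| tau) tr,
            uniq (outputs tr),
            forall I : {set T},
              (I \in outputs tr) =
                maxset (common_indep M1 M2) I && (tau <= Posz #|I|)%R,
            delay tr <= c * (#|T|.+1 ^ 6 * Q)
          & peak_space tr <= c * (#|T|.+1 ^ 2 + Qs)].
Proof.
(* The weights are large unary numbers; hiding them behind variables keeps conversion from computing
   them. *)
have [wI eI] : exists x, x = weight cInit by eexists.
have [wB eB] : exists x, x = weight cBody by eexists.
(* The 60 covers both the overhead [50 + n] of a pass and the memory of [35 + 8 n] words. The factor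
   3 below is that of [run_main]. *)
pose w := wI + wB + 60.
exists (comp cInit ++ [:: main_loop]), (3 * w) => T M1 M2 tau Q Qs Q0.
have w60 : 60 <= w by apply: leq_addl.
have w0 : 0 < 3 * w by rewrite muln_gt0 (leq_trans _ w60).
set W := word_max _ _ _.
have leW : #|T|.+1 <= W.
  rewrite /W /word_max leq_max; apply/orP; right.
  by rewrite (leq_trans _ (leq_pmull _ w0)) // -{1}(expn1 #|T|.+1) leq_pexp2l.
pose N := #|T|.+1 ^ 6 * Q.
have leN : #|T|.+1 <= N.
  by rewrite /N (leq_trans _ (leq_pmulr _ Q0)) // -{1}(expn1 #|T|.+1) leq_pexp2l.
(* The depths compute to 6: three candidate loops around the three of [cDist], or one loop over
   elements around the two of [cMaximize] and the three of [cDist]. *)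
have tcB : tc T Q cBody <= wB * N by rewrite eB; apply: tc_le.
have tcI : tc T Q cInit <= wI * N by rewrite eI; apply: tc_le.
have le60 : 50 + #|T| <= 60 * N.
  apply: leq_trans (leq_mul (leqnn 60) leN).
  by rewrite mulnS leq_add // leq_pmull.
have leX : 50 + #|T| + tc T Q cBody <= w * N.
  rewrite (addnC (50 + _)) /w -addnA !mulnDl; apply: leq_trans (leq_add tcB le60) _.
  exact: leq_addl.
have leI : tc T Q cInit <= w * N.
  by rewrite /w !mulnDl -addnA; apply: leq_trans tcI (leq_addr _ _).
have [m E [tri [qi ti ri]]] :=
  @comp_exec T (oracles M1 M2) tau Q Qs W leW cInit _ _ isT (enc_input T tau).
have [ss [tk us ms]] := visit_all (@code_inj T) (@parent_solutions T M1 M2 tau).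
have [|tr [rr oo ff dd]] := run_main Qs leW leX E (sem_init M1 M2 tau) tk (t := ttime tri).
  have leb : ttime tri <= w * N by apply: leq_trans leI.
  by case: after => [y|]; rewrite ?(leq_trans leb) ?leq_addr //; case: emit => [_|];
    rewrite ?(leq_trans leb) ?leq_addr.
exists (tri ++ tr); split.
- exact: ri.
- by rewrite (quiet_outputs _ qi) oo.
- by move=> I; rewrite (quiet_outputs _ qi) oo ms inE.
- rewrite /delay (quiet_delay _ _ qi) add0n; apply: leq_trans dd _.
  by rewrite -mulnA -/N !mulSn mul0n addn0 addnA.
apply: (@leq_trans (msize T + Qs)).
  by apply: fits_space; rewrite /fits all_cat; apply/andP; split; [apply: quiet_fits|].
rewrite mulnDr leq_add //; last by rewrite leq_pmull.
rewrite /msize /abase /nv /na; have : #|T|.+1 <= #|T|.+1 ^ 2.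
  by rewrite -{1}(expn1 #|T|.+1) leq_pexp2l.
move: (#|T|.+1 ^ 2) => N2 le2; apply: (@leq_trans (60 * N2)); first by clear -le2; lia.
by rewrite leq_mul2r (leq_trans w60) ?orbT // leq_pmull.
Qed.
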